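(* Let $m$ be a positive integer and let $A\subseteq(\mathbb{Z}/m\mathbb{Z})^2$ contain some $(n_1,n_2)$ such that $\gcd(n_1,n_2,m)=1$. For $n\in\mathbb{N}$, $\alpha>0$, and $c\geq1$, let $$S(n,\alpha,c,A)=\left\{\xi\in[0,1]:\ \text{there exist }a,q\in\mathbb{Z}_{\geq0}\text{ such that }\gcd(a,q)=1,\ (a,q)\bmod m\in A,\ n\leq q\leq nc,\ |q\xi-a|\leq\tfrac{\alpha}{q}\right\},$$ and for a given subinterval $I\subseteq[0,1]$ let $S_I(n,\alpha,c,A)=I\cap S(n,\alpha,c,A)$. Then the limits $$\lim_{n\to\infty}\lambda(S(n,\alpha,c,A))\quad\text{and}\quad\lim_{n\to\infty}\lambda(S_I(n,\alpha,c,A))$$ exist, and $$\lim_{n\to\infty}\lambda(S_I(n,\alpha,c,A))=|I|\lim_{n\to\infty}\lambda(S(n,\alpha,c,A)).$$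
   Context: $\lambda$ is Lebesgue measure on $\mathbb{R}$, $|I|$ is the length of $I$, and $\mathbb{N}$ is the set of positive integers. *)

(* Defs.v *)
From mathcomp Require Import all_boot all_order all_algebra.
From mathcomp Require Import all_classical all_reals all_analysis.

Set Implicit Arguments.
Unset Strict Implicit.
Unset Printing Implicit Defensive.

Import Order.TTheory GRing.Theory Num.Theory.
Import numFieldNormedType.Exports.

Local Open Scope classical_set_scope.
Local Open Scope ring_scope.

(* Z/mZ is represented by 'I_m rather than by 'Z_m, because 'Z_1 denotes the
   integers modulo 2 and m = 1 is allowed here. *)
Definition residue (m : nat) (m_gt0 : (0 < m)%N) (a : nat) : 'I_m :=
  Ordinal (ltn_pmod a m_gt0).

Definition approx_set (R : realType) (m : nat) (m_gt0 : (0 < m)%N)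
    (A : {set 'I_m * 'I_m}) (alpha c : R) (n : nat) : set R :=
  [set xi : R | 0 <= xi <= 1 /\
    exists a q : nat,
      [/\ coprime a q,
          (residue m_gt0 a, residue m_gt0 q) \in A,
          (n <= q)%N,
          q%:R <= n%:R * c
        & `|q%:R * xi - a%:R| <= alpha / q%:R] ].

(* For a nonempty bounded interval this is the difference of its endpoints;
   sup and inf of the empty set are both 0. *)
Definition interval_length (R : realType) (I : set R) : R := sup I - inf I.

(* Main.v *)
(* Let p/q < p'/q' be neighbours in the Farey sequence of order n, and write
   xi = p/q + tau/(q q') with 0 <= tau < 1.  The pair (a, b) = i (p, q) + j (p', q')
   is coprime iff (i, j) is, and the conditions defining S(n, alpha, c, A) become
   conditions on tau that only involve q/n, q'/n and the class modulo m of the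
   matrix with rows (p, q), (p', q').  So the measure of the intersection of S with
   an interval is a sum over Farey tiles of weights depending only on these data,
   and the theorem follows once the matrices of a given class with p/q in [s, t[
   and (q, q') in n times a box number rho (t - s) |box| n^2 + o(n^2).
   For p/q between two consecutive images of multiples of m near a cusp, such
   matrices correspond to primitive lattice points in a residue class (Bezout),
   which a sieve counts; Farey intervals are cut into such pieces, the error being
   reduced at each step of an induction along mediants.
   The weights are compared on a grid by enlarging the parameters of S by del; the
   enlargement, the tiles with a small denominator and the grid cells meeting the
   line q + q' = n all contribute little. *)
Require Import Defs.
From mathcomp Require Import all_boot all_order all_algebra.
From mathcomp Require Import all_classical all_reals all_analysis.
From mathcomp Require Import measurable_realfun finmap zify ring lra.

Set Implicit Arguments.
Unset Strict Implicit.
Unset Printing Implicit Defensive.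

Import Order.TTheory GRing.Theory Num.Theory.
Import numFieldNormedType.Exports.

Local Open Scope classical_set_scope.
Local Open Scope ring_scope.

(** * Counting in intervals of integers *)

(** Given the denominators, [p] is minus an inverse of [q'] modulo [q], so counting matrices with
    [p / q] in a given interval is in general a question of Kloosterman type. The intervals near a
    cusp are chosen to avoid it: in the coordinates of the cusp the numerator [P] runs over a window
    of length exactly [m * Q], and the determinant with the congruences leaves exactly one [P]
    modulo [m * Q]. So each admissible pair of denominators counts once, wherever the inverse lies.
    The price is a distortion of the box, small only far along the progression; what is left of a
    Farey interval is again made of Farey intervals, and a fixed proportion is settled at each step,
    so the error decays geometrically. Continuity of the weights of the tiles is not at hand.
    Neighbouring tiles are compared through inclusions of enlarged sets, and the cost of the
    enlargement is estimated on S itself by a union bound. No constant is evaluated: rho is an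
    infimum of sieve densities and the limit is a supremum of lower bounds. Proportionality to the
    length of I holds because the approximate density depends on the tolerated error but not on the
    window. *)

(* fset_set sends an infinite set to the empty one, whose count is 0. *)
Definition cnt (T : choiceType) (A : set T) : nat := #|` fset_set A|%fset.

Lemma cnt_le (T : choiceType) (A B : set T) :
  finite_set B -> A `<=` B -> (cnt A <= cnt B)%N.
Proof.
move=> fB AB; apply: fsubset_leq_card; rewrite -fset_set_sub//.
exact: sub_finite_set fB.
Qed.

Lemma finite_inj (T U : choiceType) (f : T -> U) (A : set T) (B : set U) :
  finite_set B -> (forall x, A x -> B (f x)) -> {in A &, injective f} ->
  finite_set A.
Proof.
move=> fB AB finj.
have fI : finite_set (f @` A).
  by apply: sub_finite_set fB => _ [x Ax <-]; exact: AB.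
by rewrite -(eq_finite_set (inj_card_eq finj)).
Qed.

Lemma cnt_surj (T U : choiceType) (f : T -> U) (A : set T) (B : set U) :
  finite_set A -> (forall y, B y -> exists2 x, A x & f x = y) ->
  (cnt B <= cnt A)%N.
Proof.
move=> fA BA; apply: (@leq_trans (cnt (f @` A))).
  by apply: cnt_le; [exact: finite_image|move=> y /BA[x Ax <-]; exists x].
by rewrite /cnt fset_set_image// leq_imfset_card.
Qed.

Lemma cnt_inj (T U : choiceType) (f : T -> U) (A : set T) (B : set U) :
  finite_set B -> (forall x, A x -> B (f x)) -> {in A &, injective f} ->
  (cnt A <= cnt B)%N.
Proof.
move=> fB AB finj; have fA := finite_inj fB AB finj.
apply: (@leq_trans (cnt (f @` A))).
  rewrite /cnt fset_set_image// card_in_imfset//= => x y.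
  by rewrite !in_fset_set//; exact: finj.
by apply: cnt_le => // _ [x Ax <-]; exact: AB.
Qed.

Lemma cntX (T U : choiceType) (A : set T) (B : set U) :
  finite_set A -> finite_set B -> cnt (A `*` B) = (cnt A * cnt B)%N.
Proof.
move=> fA fB.
rewrite /cnt -(size_allpairs pair); apply: perm_size; apply: uniq_perm.
- exact: fset_uniq.
- by apply: allpairs_uniq; rewrite ?fset_uniq// => -[? ?] [? ?] _ _ [-> ->].
- move=> [x y]; rewrite fset_setX// in_fsetM/=.
  apply/andP/allpairsP => [[Ax By]|[[x' y'] /= [Ax By [-> ->]]]//].
  by exists (x, y).
Qed.

Lemma cnt_partition (T : choiceType) (I : finType) (f : T -> I) (A : set T) :
  finite_set A -> cnt A = (\sum_(i : I) cnt [set x | A x /\ f x = i])%N.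
Proof.
move=> fA.
rewrite /cnt card_fset_sum1 (partition_big f xpredT)//=.
apply: eq_bigr => i _; rewrite [RHS]card_fset_sum1.
have fAi : finite_set [set x | A x /\ f x = i].
  by apply: sub_finite_set fA => x [].
rewrite -big_filter; apply: perm_big; apply: uniq_perm.
- by rewrite filter_uniq// fset_uniq.
- exact: fset_uniq.
move=> x; rewrite mem_filter !in_fset_set//.
apply/andP/idP => [[/eqP xi /set_mem Ax]|/set_mem[Ax xi]].
  by apply/mem_set.
by split; [apply/eqP|apply/mem_set].
Qed.

Lemma cnt_split (T : choiceType) (A B C : set T) :
  finite_set A -> (forall x, A x -> B x \/ C x) -> B `<=` A -> C `<=` A ->
  (forall x, B x -> C x -> False) -> cnt A = (cnt B + cnt C)%N.
Proof.
move=> fA ABC BA CA BC.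
rewrite (cnt_partition (fun x => `[< B x >]) fA) big_bool/=.
congr (_ + _)%N; congr cnt; apply/seteqP; split => x /=.
- by case=> _ /asboolP.
- by move=> Bx; split; [exact: BA|apply/asboolP].
- by case=> /ABC[Bx|//] /negbT/asboolPn.
- by move=> Cx; split; [exact: CA|apply/negbTE/asboolPn => Bx; exact: BC Cx].
Qed.

Lemma cnt_II n : cnt `I_n = n.
Proof. by rewrite /cnt (card_fset_set (card_eqxx _)). Qed.

Lemma cnt_bij (T U : choiceType) (f : T -> U) (A : set T) (B : set U) :
  finite_set A -> (forall x, A x -> B (f x)) ->
  (forall y, B y -> exists2 x, A x & f x = y) -> {in A &, injective f} ->
  finite_set B /\ cnt B = cnt A.
Proof.
move=> fA AB BA finj.
have fB : finite_set B.
  by apply: sub_finite_set (finite_image f fA) => y /BA[x Ax <-]; exists x.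
split=> //; apply/eqP; rewrite eqn_leq; apply/andP; split.
  exact: (cnt_surj fA BA).
exact: (cnt_inj fB AB finj).
Qed.

Section Windows.
Variable R : realType.
Implicit Types (a b : R).

Lemma int_range (x y : int) : x <= y ->
  finite_set [set t : int | x < t <= y] /\
  cnt [set t : int | x < t <= y] = `|y - x|%N.
Proof.
move=> xy; rewrite -[RHS]cnt_II.
apply: (@cnt_bij _ _ (fun i : nat => x + 1 + i%:Z)).
- exact: finite_II.
- move=> /= i ilt; apply/andP; split; lia.
- move=> /= t /andP[h1 h2]; exists (absz (t - x - 1)%R) => /=; lia.
- by move=> /= i j _ _; lia.
Qed.

Lemma int_window a b : a <= b ->
  finite_set [set t : int | a < t%:~R <= b] /\
  cnt [set t : int | a < t%:~R <= b] = `|Num.floor b - Num.floor a|%N.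
Proof.
move=> ab; rewrite (_ : [set t : int | _] =
    [set t : int | Num.floor a < t <= Num.floor b]).
  by apply: int_range; exact: le_floor.
by apply/seteqP; split => t /=; rewrite -floor_lt_int -floor_ge_int.
Qed.

Lemma window_count (L : nat) (w : int) a b : (0 < L)%N -> a <= b ->
  finite_set [set i : int | a < i%:~R <= b /\ (L %| i - w)%Z] /\
  `|(cnt [set i : int | a < i%:~R <= b /\ (L %| i - w)%Z])%:R - (b - a) / L%:R|
    <= 1.
Proof.
move=> L0 ab; have L0' : 0 < L%:R :> R by rewrite ltr0n.
pose u := (a - w%:~R) / L%:R; pose v := (b - w%:~R) / L%:R.
have uv : u <= v by rewrite ler_pM2r ?invr_gt0// lerB.
have [fV cV] := int_window uv.
set W := [set i : int | _].
have [fW cW] : finite_set W /\ cnt W = cnt [set t : int | u < t%:~R <= v].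
  apply: (cnt_bij (f := fun t : int => w + t * L%:Z)) => //.
- move=> /= t /andP[]; rewrite ltr_pdivrMr// ler_pdivlMr// => h1 h2.
  split; last by rewrite addrAC subrr add0r dvdz_mull.
  rewrite rmorphD rmorphM /=; apply/andP; split; lra.
- move=> /= i [/andP[h1 h2] /dvdzP[t ht]]; exists t; last by lia.
  rewrite /= ltr_pdivrMr// ler_pdivlMr//.
  have : i%:~R = w%:~R + t%:~R * L%:R :> R.
    by rewrite (_ : i = w + t * L%:Z) ?rmorphD ?rmorphM//; lia.
  by move=> hi; apply/andP; split; lra.
- by move=> /= s t _ _; nia.
split=> //; rewrite cW cV.
have fuv : Num.floor u <= Num.floor v by exact: le_floor.
have e : `|Num.floor v - Num.floor u| = Num.floor v - Num.floor u.
  by rewrite ger0_norm ?subr_ge0.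
rewrite natr_absz e rmorphB/=.
have -> : (b - a) / L%:R = v - u by rewrite -mulrBl; congr (_ / _); ring.
have /andP[u1 u2] := floor_itv u; have /andP[v1 v2] := floor_itv v.
by rewrite ler_norml; move: u2 v2; rewrite !rmorphD/= => u2 v2; apply/andP; split; lra.
Qed.

End Windows.

(** * Coprime pairs in a residue class *)

Lemma dvdz_add (d a b c : int) :
  (d %| a)%Z -> (d %| b)%Z -> c = a + b -> (d %| c)%Z.
Proof. by move=> /dvdzP[x ->] /dvdzP[y ->] ->; rewrite -mulrDl dvdz_mull. Qed.

Lemma dvdz_sub (d a b c : int) :
  (d %| a)%Z -> (d %| b)%Z -> c = a - b -> (d %| c)%Z.
Proof. by move=> /dvdzP[x ->] /dvdzP[y ->] ->; rewrite -mulrBl dvdz_mull. Qed.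

Definition residuez (D : nat) (D0 : (0 < D)%N) (i : int) : 'I_D :=
  Ordinal (ltn_pmod `|(i %% D)%Z| D0).

Lemma residuezP D (D0 : (0 < D)%N) (i : int) (u : 'I_D) :
  residuez D0 i = u <-> (D %| i - (nat_of_ord u)%:Z)%Z.
Proof.
have iD : (0 <= (i %% D)%Z < D%:Z) by rewrite modz_ge0 ?ltz_mod//; lia.
rewrite -eqz_mod_dvd; split => [<-|/eqP h].
  by rewrite /= modn_small ?modz_mod; [apply/eqP; rewrite gez0_abs ?modz_mod//|]; lia.
apply/val_inj; rewrite /= h modz_small; last by have := ltn_ord u; lia.
by rewrite /= modn_small.
Qed.

Section PrimitiveDensity.
Variables (R : realType) (m : nat).
Hypothesis m_gt0 : (0 < m)%N.

(** The Chinese remainder theorem merges the two congruences into one modulo [m * D]. *)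
Lemma window_count2 (D : nat) (r u : int) (a b : R) :
  (0 < D)%N -> coprime m D -> a <= b ->
  finite_set [set i : int | [/\ a < i%:~R <= b, (m %| i - r)%Z & (D %| i - u)%Z]]
  /\ `|(cnt [set i : int | [/\ a < i%:~R <= b, (m %| i - r)%Z
                          & (D %| i - u)%Z]])%:R - (b - a) / (m * D)%:R| <= 1.
Proof.
move=> D0 cmD ab; pose w : int := zchinese m D r u.
have -> : [set i : int | [/\ a < i%:~R <= b, (m %| i - r)%Z & (D %| i - u)%Z]]
   = [set i : int | a < i%:~R <= b /\ ((m * D)%N %| i - w)%Z].
  have e1 : (m %| w - r)%Z by rewrite -eqz_mod_dvd zchinese_modl.
  have e2 : (D %| w - u)%Z by rewrite -eqz_mod_dvd zchinese_modr.
  clearbody w; apply/seteqP; split => /= i.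
    case=> ab' h1 h2; split=> //.
    rewrite PoszM Gauss_dvdz//; apply/andP; split.
      by apply: (dvdz_sub h1 e1); lia.
    by apply: (dvdz_sub h2 e2); lia.
  case=> ab'; rewrite PoszM Gauss_dvdz// => /andP[h1 h2]; split=> //.
    by apply: (dvdz_add h1 e1); lia.
  by apply: (dvdz_add h2 e2); lia.
by apply: window_count => //; rewrite muln_gt0 m_gt0.
Qed.

(** Only divisors prime to [m] are tested: a common factor shared with [m] is excluded by an
    admissible residue class, and coprimality makes the sieve independent of that class. All
    integers are tested, not only primes, so that a gcd up to [z] is itself one of the [d]. *)
Definition sieve (z : nat) (i j : int) : bool :=
  [forall d : 'I_z.+1, ((1 < d)%N && coprime d m) ==>
     ~~ ((d %| i)%Z && (d %| j)%Z)].

(* A multiple of every d <= z prime to m, so that [sieve z] is periodic modulo it. *)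
Definition sieve_mod (z : nat) : nat :=
  (\prod_(d < z.+1 | (0 < d)%N && coprime d m) d)%N.

Lemma sieve_mod_gt0 z : (0 < sieve_mod z)%N.
Proof. by apply: prodn_cond_gt0 => i /andP[]. Qed.

Lemma sieve_mod_coprime z : coprime m (sieve_mod z).
Proof.
rewrite /sieve_mod; elim/big_ind: _ => [|x y|i /andP[_]].
- exact: coprimen1.
- by rewrite coprimeMr => -> ->.
- by rewrite coprime_sym.
Qed.

Lemma sieve_periodic z (i j u v : int) :
  (sieve_mod z %| i - u)%Z -> (sieve_mod z %| j - v)%Z ->
  sieve z i j = sieve z u v.
Proof.
move=> iu jv; apply: eq_forallb => d.
have [/andP[d1 dm]|//] := boolP ((1 < d)%N && coprime d m).
have dD : (d %| (sieve_mod z)%:Z)%Z.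
  rewrite dvdzE/= /sieve_mod (bigD1 d)/=; first by rewrite dvdn_mulr.
  by rewrite dm (ltn_trans _ d1).
have dE (a b : int) : (sieve_mod z %| a - b)%Z -> (d %| a)%Z = (d %| b)%Z.
  move=> /(dvdz_trans dD) h; apply/idP/idP => h'.
    by apply: (dvdz_sub h' h); lia.
  by apply: (dvdz_add h' h); lia.
by rewrite (dE _ _ iu) (dE _ _ jv).
Qed.

(** The gcd [g] is prime to [m], because a common factor of [g] and [m] divides [r1], [r2] and [m].
    Were [g] at most [z], the sieve would have tested [d = g]. *)
Lemma sieveN_gcd z (i j r1 r2 : int) :
  (m %| i - r1)%Z -> (m %| j - r2)%Z -> gcdz (gcdz r1 r2) m = 1 ->
  0 < i -> sieve z i j -> ~~ coprimez i j -> (z < gcdn `|i| `|j|)%N.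
Proof.
move=> h1 h2 adm i0 sv ncop; set g := gcdn _ _.
have g0 : (0 < g)%N by rewrite gcdn_gt0; apply/orP; left; lia.
have gi : (g %| i)%Z by rewrite dvdzE/= dvdn_gcdl.
have gj : (g %| j)%Z by rewrite dvdzE/= dvdn_gcdr.
have gm : coprime g m.
  rewrite /coprime; set h := gcdn g m.
  have hg : (h %| g%:Z)%Z by rewrite dvdzE/= dvdn_gcdl.
  have hm : (h %| m%:Z)%Z by rewrite dvdzE/= dvdn_gcdr.
  have hh a b : (m %| a - b)%Z -> (g %| a)%Z -> (h %| b)%Z.
    move=> ab ga; apply: (dvdz_sub (dvdz_trans hg ga) (dvdz_trans hm ab)); lia.
  have : (h %| gcdz (gcdz r1 r2) m)%Z.
    by rewrite !dvdz_gcd (hh _ _ h1 gi) (hh _ _ h2 gj) hm.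
  by rewrite adm dvdzE/= dvdn1.
have g1 : (1 < g)%N.
  by rewrite ltn_neqAle g0 andbT eq_sym.
rewrite ltnNge; apply/negP => gz.
have gz' : (g < z.+1)%N by [].
move/forallP : sv => /(_ (Ordinal gz'))/=.
by rewrite g1 gm gi gj.
Qed.

Definition pairs (T x1 x2 y1 y2 : R) (r1 r2 : int) : set (int * int) :=
  [set ij | [/\ T * x1 < ij.1%:~R <= T * x2, T * y1 < ij.2%:~R <= T * y2,
     (m %| ij.1 - r1)%Z, (m %| ij.2 - r2)%Z & coprimez ij.1 ij.2]].

Definition spairs z (T x1 x2 y1 y2 : R) (r1 r2 : int) : set (int * int) :=
  [set ij | [/\ T * x1 < ij.1%:~R <= T * x2, T * y1 < ij.2%:~R <= T * y2,
     (m %| ij.1 - r1)%Z, (m %| ij.2 - r2)%Z & sieve z ij.1 ij.2]].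

Lemma finite_box (a b c d : R) : a <= b -> c <= d ->
  finite_set [set ij : int * int | a < ij.1%:~R <= b /\ c < ij.2%:~R <= d].
Proof.
move=> ab cd.
apply: (sub_finite_set _ (finite_setX (int_window ab).1 (int_window cd).1)).
by move=> [i j] [].
Qed.

Definition sieve_classes (z : nat) : {set 'I_(sieve_mod z) * 'I_(sieve_mod z)} :=
  [set u | sieve z (nat_of_ord u.1) (nat_of_ord u.2)].

Lemma mul_window_error (a b X Y : R) : 0 <= X -> 0 <= Y ->
  `|a - X| <= 1 -> `|b - Y| <= 1 -> `|a * b - X * Y| <= X + Y + 1.
Proof.
move=> X0 Y0; rewrite !ler_norml => /andP[a1 a2] /andP[b1 b2].
have -> : a * b - X * Y = (a - X) * (b - Y) + X * (b - Y) + Y * (a - X) by ring.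
by apply/andP; split; nra.
Qed.

(** Modulo [sieve_mod z] the pairs passing the sieve form [#|sieve_classes z|] classes, and each
    contributes a product of two windows modulo [m * sieve_mod z]. The main term does not involve
    [r1] and [r2], hence one density for all residue classes. *)
Lemma spairs_count z (T x1 x2 y1 y2 : R) (r1 r2 : int) :
  1 <= T -> x1 <= x2 -> y1 <= y2 ->
  `|(cnt (spairs z T x1 x2 y1 y2 r1 r2))%:R -
    #|sieve_classes z|%:R * ((T * x2 - T * x1) / (m * sieve_mod z)%:R *
      ((T * y2 - T * y1) / (m * sieve_mod z)%:R))|
  <= #|sieve_classes z|%:R * ((x2 - x1) + (y2 - y1) + 1) * T.
Proof.
set L := (m * sieve_mod z)%N.
move=> T1 x12 y12; have T0 : 0 < T by lra.
have Tx : T * x1 <= T * x2 by rewrite ler_pM2l.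
have Ty : T * y1 <= T * y2 by rewrite ler_pM2l.
have fS : finite_set (spairs z T x1 x2 y1 y2 r1 r2).
  by apply: sub_finite_set (finite_box Tx Ty) => -[i j] [].
set D := sieve_mod z; have D0 : (0 < D)%N := sieve_mod_gt0 z.
have L1 : 1 <= L%:R :> R by rewrite ler1n muln_gt0 m_gt0 D0.
pose f (ij : int * int) := (residuez D0 ij.1, residuez D0 ij.2).
rewrite (cnt_partition f fS) (bigID (mem (sieve_classes z)))/=.
rewrite [X in (_ + X)%N]big1 ?addn0; last first.
  move=> u uN; apply/eqP; rewrite cardfs_eq0; apply/eqP.
  rewrite (_ : [set x | _] = set0) ?fset_set0//.
  apply/seteqP; split => // -[i j] /= [[_ _ _ _ sv]] fu; move: uN; rewrite -fu inE/=.
  rewrite -(@sieve_periodic z i j) ?sv//.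
    exact: ((residuezP D0 i (residuez D0 i)).1 erefl).
  exact: ((residuezP D0 j (residuez D0 j)).1 erefl).
rewrite natr_sum -[X in _ <= X]mulrA [X in _ - X]mulr_natl.
rewrite [X in _ <= X]mulr_natl -!sumr_const -sumrB.
apply: le_trans (ler_norm_sum _ _ _) _; apply: ler_sum => u uU.
set W1 := [set i : int | [/\ T * x1 < i%:~R <= T * x2, (m %| i - r1)%Z
   & (D %| i - (nat_of_ord u.1)%:Z)%Z]].
set W2 := [set i : int | [/\ T * y1 < i%:~R <= T * y2, (m %| i - r2)%Z
   & (D %| i - (nat_of_ord u.2)%:Z)%Z]].
have cD : coprime m D := sieve_mod_coprime z.
have [fW1 cW1] := window_count2 r1 (nat_of_ord u.1) D0 cD Tx.
have [fW2 cW2] := window_count2 r2 (nat_of_ord u.2) D0 cD Ty.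
rewrite (_ : [set x | _] = W1 `*` W2); last first.
  apply/seteqP; split => -[i j] /=.
    move=> [[? ? ? ? sv] fu]; split; split=> //; apply/(residuezP D0); by rewrite -fu.
  move=> [[? ? /(residuezP D0) e1] [? ? /(residuezP D0) e2]].
  have fu : f (i, j) = u by rewrite /f/= e1 e2 -surjective_pairing.
  split=> //; split=> //=; move: uU; rewrite inE => uU.
  rewrite (@sieve_periodic z i j (nat_of_ord u.1) (nat_of_ord u.2))//.
    by apply/(residuezP D0); rewrite e1.
  by apply/(residuezP D0); rewrite e2.
rewrite cntX// natrM.
have X0 : 0 <= (T * x2 - T * x1) / L%:R by rewrite divr_ge0 ?subr_ge0.
have Y0 : 0 <= (T * y2 - T * y1) / L%:R by rewrite divr_ge0 ?subr_ge0.
apply: le_trans (mul_window_error X0 Y0 cW1 cW2) _.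
have hle x y : x <= y -> (T * y - T * x) / L%:R <= T * (y - x).
  move=> xy; rewrite ler_pdivrMr ?(lt_le_trans _ L1)//.
  rewrite -mulrBr ler_peMr ?mulr_ge0 ?subr_ge0//; lra.
have := hle _ _ x12; have := hle _ _ y12; lra.
Qed.

Lemma cnt_multiples (g : nat) (X : R) : (0 < g)%N -> 0 <= X ->
  finite_set [set i : int | (0 : R) < i%:~R <= X /\ (g %| i)%Z] /\
  (cnt [set i : int | (0 : R) < i%:~R <= X /\ (g %| i)%Z])%:R <= X / g%:R.
Proof.
move=> g0 X0; have g0' : 0 < g%:R :> R by rewrite ltr0n.
have Xg : 0 <= X / g%:R by rewrite divr_ge0// ltW.
have [fV cV] := int_window Xg.
have sub : forall i : int, [set i : int | (0 : R) < i%:~R <= X /\ (g %| i)%Z] i ->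
    [set t : int | (0 : R) < t%:~R <= X / g%:R] (i %/ g)%Z.
  move=> i [/andP[i0 iX] /dvdzP[t it]] /=.
  rewrite it mulzK; last by lia.
  move: i0 iX; rewrite it rmorphM/= => i0 iX.
  by rewrite -(pmulr_lgt0 _ g0') i0/= ler_pdivlMr.
have inj : {in [set i : int | (0 : R) < i%:~R <= X /\ (g %| i)%Z] &,
    injective (fun i : int => (i %/ g)%Z)}.
  move=> i j /set_mem[_ gi] /set_mem[_ gj] /= ij.
  by rewrite -(divzK gi) -(divzK gj) ij.
split; first exact: (finite_inj fV sub inj).
have := cnt_inj fV sub inj; rewrite cV floor0 subr0 => h.
apply: (@le_trans _ _ (`|Num.floor (X / g%:R)|%N%:R)); first by rewrite ler_nat.
have f0 : 0 <= Num.floor (X / g%:R) by rewrite floor_ge_int.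
by rewrite natr_absz ger0_norm// floor_le.
Qed.

Lemma sum_inv_sq (z N : nat) : (0 < z)%N -> (z <= N)%N ->
  \sum_(g < N.+1 | (z < g)%N) (g%:R ^+ 2)^-1 <= z%:R^-1 - N%:R^-1 :> R.
Proof.
move=> z0; elim: N => [|N IH]; first by case: z z0.
rewrite leq_eqVlt => /orP[/eqP<-|]; last rewrite ltnS => zN.
  rewrite subrr big1// => i zi; have := ltn_ord i; lia.
have N0 : 0 < N%:R :> R by rewrite ltr0n (leq_trans z0).
rewrite big_mkcond big_ord_recr/= -big_mkcond/= ltnS zN.
have := IH zN; set S := (\sum_(_ < _ | _) _) => hS.
have -> : N.+1%:R = N%:R + 1 :> R by rewrite -natr1.
suff : ((N%:R + 1) ^+ 2)^-1 <= N%:R^-1 - (N%:R + 1)^-1 :> R by lra.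
have -> : N%:R^-1 - (N%:R + 1)^-1 = (N%:R * (N%:R + 1))^-1 :> R.
  by field; apply/andP; split; lra.
have N1 : 0 < N%:R + 1 :> R by lra.
rewrite lef_pV2 ?posrE ?exprn_gt0 ?mulr_gt0//; nra.
Qed.

(** At most [(X / g) * (Y / g)] pairs have gcd [g], and the tail of the sum of [1 / g ^ 2] beyond
    [z] is at most [1 / z]. *)
Lemma cnt_large_gcd (z : nat) (X Y : R) : (0 < z)%N -> 0 <= X -> 0 <= Y ->
  (cnt [set ij : int * int | [/\ (0 : R) < ij.1%:~R <= X, (0 : R) < ij.2%:~R <= Y
     & (z < gcdn `|ij.1| `|ij.2|)%N]])%:R <= X * Y / z%:R.
Proof.
move=> z0 X0 Y0; set G := [set ij | _].
have fG : finite_set G.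
  by apply: sub_finite_set (finite_box X0 Y0) => -[i j] [].
pose N := maxn z `|Num.floor X|%N.
have gN ij : G ij -> (gcdn `|ij.1| `|ij.2| < N.+1)%N.
  case: ij => i j [/= /andP[i0 iX] _ _].
  rewrite ltr0z in i0.
  have : i <= Num.floor X by rewrite floor_ge_int.
  move: (Num.floor X) @N => x N ix; rewrite ltnS leq_max; apply/orP; right.
  by apply: (@leq_trans `|i|); [rewrite dvdn_leq ?dvdn_gcdl//; lia|lia].
pose f (ij : int * int) : 'I_N.+1 := inord (gcdn `|ij.1| `|ij.2|).
have fE ij : G ij -> f ij = gcdn `|ij.1| `|ij.2| :> nat.
  by move=> Gij; rewrite inordK ?gN.
rewrite (cnt_partition f fG) natr_sum (bigID (fun g : 'I_N.+1 => (z < g)%N))/=.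
rewrite [X in _ + X]big1 ?addr0; last first.
  move=> g zg; rewrite (_ : [set x | _] = set0) /cnt ?fset_set0//.
  apply/seteqP; split => // -[i j] /= [Gij] fg.
  by move: zg; rewrite -fg fE//; case: Gij => _ _ ->.
apply: (@le_trans _ _ (\sum_(g < N.+1 | (z < g)%N) (X * Y) * (g%:R ^+ 2)^-1)).
  apply: ler_sum => g zg; have g0 : (0 < g)%N by apply: leq_trans zg.
  have [f1 c1] := cnt_multiples g0 X0; have [f2 c2] := cnt_multiples g0 Y0.
  apply: (@le_trans _ _ (X / g%:R * (Y / g%:R))); last first.
    by rewrite expr2 invfM mulrACA.
  apply: le_trans (ler_pM _ _ c1 c2) => //; rewrite -natrM -cntX// ler_nat.
  apply: cnt_le; first exact: finite_setX.
  move=> [i j] /= [Gij fg]; have [/= iX jY _] := Gij.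
  have := fE _ Gij; rewrite fg/= => gE.
  by split; split=> //; rewrite dvdzE/= gE ?dvdn_gcdl ?dvdn_gcdr.
rewrite -mulr_sumr ler_wpM2l ?mulr_ge0//.
have zN : (z <= N)%N by rewrite leq_maxl.
apply: le_trans (sum_inv_sq z0 zN) _.
by rewrite lerBlDr lerDl invr_ge0.
Qed.

Lemma exists_nat_gt (x : R) : exists2 n : nat, (0 < n)%N & x < n%:R.
Proof.
exists (`|Num.floor `|x| |%N.+1) => //.
have f0 : 0 <= Num.floor `|x| by rewrite floor_ge_int.
rewrite -natr1 natr_absz ger0_norm//.
have := floorD1_gt `|x|; rewrite rmorphD/= => h.
by apply: le_lt_trans h; exact: ler_norm.
Qed.

(** [rho] is the infimum over [z] of the densities of the sieved pairs. Coprime pairs pass every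
    sieve, which gives the upper bound with a [z] whose density is close to the infimum. For the
    lower bound [z] is large: the sieved pairs that are not coprime have gcd above [z], so they are
    few. *)
Lemma pairs_density : exists2 rho : R, 0 <= rho &
  forall r1 r2 : int, gcdz (gcdz r1 r2) m = 1 ->
  forall x1 x2 y1 y2 : R, 0 < x1 <= x2 -> 0 < y1 <= y2 ->
  forall e : R, 0 < e -> exists2 T0 : R, 1 <= T0 & forall T, T0 <= T ->
  `|(cnt (pairs T x1 x2 y1 y2 r1 r2))%:R
     - rho * ((x2 - x1) * (y2 - y1)) * T ^+ 2| <= e * T ^+ 2.
Proof.
pose L z := (m * sieve_mod z)%N.
have L0 z : 0 < (L z)%:R :> R by rewrite ltr0n muln_gt0 m_gt0 sieve_mod_gt0.
pose rz z : R := #|sieve_classes z|%:R / (L z)%:R ^+ 2.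
have rz0 z : 0 <= rz z by rewrite divr_ge0// exprn_ge0// ltW.
pose E := range rz.
have E0 : has_lbound E by exists 0 => _ [z _ <-].
have hE : has_inf E by split => //; exists (rz 0%N), 0%N.
exists (inf E) => [|r1 r2 adm x1 x2 y1 y2 /andP[x10 x12] /andP[y10 y12] e e0].
  by apply: lb_le_inf; [case: hE|move=> _ [z _ <-]].
set B := (x2 - x1) * (y2 - y1).
have B0 : 0 <= B by rewrite mulr_ge0// subr_ge0.
have count z T : 1 <= T -> `|(cnt (spairs z T x1 x2 y1 y2 r1 r2))%:R
    - rz z * B * T ^+ 2| <= #|sieve_classes z|%:R * ((x2 - x1) + (y2 - y1) + 1) * T.
  move=> T1; have := spairs_count z r1 r2 T1 x12 y12.
  have -> : rz z * B * T ^+ 2 = #|sieve_classes z|%:R *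
     ((T * x2 - T * x1) / (L z)%:R * ((T * y2 - T * y1) / (L z)%:R)).
    by rewrite /rz /B; field; rewrite gt_eqF.
  by [].
(* The [+ 1] allows a degenerate box with [B = 0]. *)
have e2 : 0 < e / 2 / (B + 1) by rewrite !divr_gt0// ltr_wpDl.
have [_ [zu _ <-] ru] := inf_adherent e2 hE.
(* The false positives of the sieve number at most [T ^+ 2 * (x2 * y2) / zl], hence at most
   [e / 2 * T ^+ 2]. *)
have [zl zl0 zlP] := exists_nat_gt (x2 * y2 / (e / 2)).
pose K z : R := #|sieve_classes z|%:R * ((x2 - x1) + (y2 - y1) + 1).
have K0 z : 0 <= K z by rewrite mulr_ge0//; lra.
exists (1 + K zu / (e / 2) + K zl / (e / 2)) => [|T hT].
  by rewrite -addrA lerDl addr_ge0// divr_ge0//; lra.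
have [k1 k2] : K zu <= e / 2 * T /\ K zl <= e / 2 * T.
  have := K0 zu; have := K0 zl => kl ku.
  have h1 : 0 <= K zu / (e / 2) by rewrite divr_ge0//; lra.
  have h2 : 0 <= K zl / (e / 2) by rewrite divr_ge0//; lra.
  by split; rewrite mulrC -ler_pdivrMr//; lra.
have T1 : 1 <= T.
  apply: le_trans hT; rewrite -addrA lerDl addr_ge0// divr_ge0//; lra.
have T0 : 0 < T by lra.
have Tx : T * x1 <= T * x2 by rewrite ler_pM2l.
have Ty : T * y1 <= T * y2 by rewrite ler_pM2l.
have fS z : finite_set (spairs z T x1 x2 y1 y2 r1 r2).
  by apply: sub_finite_set (finite_box Tx Ty) => -[i j] [].
have up : (cnt (pairs T x1 x2 y1 y2 r1 r2) <= cnt (spairs zu T x1 x2 y1 y2 r1 r2))%N.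
  apply: cnt_le => // -[i j] [/= h1 h2 h3 h4 cop]; split => //=.
  apply/forallP => d; apply/implyP => /andP[d1 _]; apply/negP => /andP[di dj].
  have : (d %| gcdz i j)%Z by rewrite dvdz_gcd di dj.
  by rewrite (eqP cop) dvdzE/= dvdn1 => /eqP d1'; rewrite d1' in d1.
pose G := [set ij : int * int | [/\ (0 : R) < ij.1%:~R <= T * x2,
  (0 : R) < ij.2%:~R <= T * y2 & (zl < gcdn `|ij.1| `|ij.2|)%N]].
have Tx2 : 0 <= T * x2 by rewrite mulr_ge0//; lra.
have Ty2 : 0 <= T * y2 by rewrite mulr_ge0//; lra.
have lo : (cnt (spairs zl T x1 x2 y1 y2 r1 r2) <=
    cnt (pairs T x1 x2 y1 y2 r1 r2) + cnt G)%N.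
  set S := spairs _ _ _ _ _ _ _ _.
  have fG : finite_set G by apply: sub_finite_set (finite_box Tx2 Ty2) => -[i j] [].
  have -> : cnt S = (cnt (S `&` [set ij | coprimez ij.1 ij.2]) +
      cnt (S `&` [set ij | ~~ coprimez ij.1 ij.2]))%N.
    apply: cnt_split; first exact: fS.
    - by move=> ij Sij; case: (boolP (coprimez ij.1 ij.2)) => h; [left|right].
    - by move=> ? [].
    - by move=> ? [].
    - by move=> ij [_ /= ->] [].
  apply: leq_add.
    apply: cnt_le; last by move=> [i j] [[]].
    by apply: sub_finite_set (finite_box Tx Ty) => -[i j] [].
  apply: cnt_le => // -[i j] [[/= /andP[h1 h1'] /andP[h2 h2'] h3 h4 sv] nc].
  have i0 : (0 : R) < i%:~R by apply: lt_trans h1; rewrite mulr_gt0.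
  have j0 : (0 : R) < j%:~R by apply: lt_trans h2; rewrite mulr_gt0.
  split; rewrite /= ?i0 ?j0//; apply: (sieveN_gcd h3 h4 adm _ sv nc).
  by rewrite ltr0z in i0.
have cG : (cnt G)%:R <= e / 2 * T ^+ 2.
  apply: le_trans (cnt_large_gcd zl0 Tx2 Ty2) _.
  rewrite ler_pdivrMr ?ltr0n//.
  have : x2 * y2 <= e / 2 * zl%:R.
    by rewrite [X in _ <= X]mulrC -ler_pdivrMr; [exact: ltW|lra].
  move=> h; have -> : T * x2 * (T * y2) = (x2 * y2) * T ^+ 2 by ring.
  have -> : e / 2 * T ^+ 2 * zl%:R = (e / 2 * zl%:R) * T ^+ 2 by ring.
  by rewrite ler_wpM2r// exprn_ge0// ltW.
have cu := count zu T T1; have cl := count zl T T1.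
rewrite -/(K _) in cu; rewrite -/(K _) in cl.
have ru' : rz zu * B <= inf E * B + e / 2.
  have : rz zu * B <= (inf E + e / 2 / (B + 1)) * B by rewrite ler_wpM2r// ltW.
  move/le_trans; apply; rewrite mulrDl lerD2l mulrAC ler_pdivrMr; last by lra.
  by rewrite ler_wpM2l//; lra.
have rl' : inf E * B <= rz zl * B.
  by rewrite ler_wpM2r//; apply: ge_inf => //; exists zl.
have T20 : 0 <= T ^+ 2 by rewrite exprn_ge0// ltW.
have ru2 : rz zu * B * T ^+ 2 <= inf E * B * T ^+ 2 + e / 2 * T ^+ 2.
  by rewrite -mulrDl ler_wpM2r.
have rl2 : inf E * B * T ^+ 2 <= rz zl * B * T ^+ 2 by rewrite ler_wpM2r.
have k1' : K zu * T <= e / 2 * T ^+ 2 by rewrite expr2 mulrA ler_wpM2r// ltW.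
have k2' : K zl * T <= e / 2 * T ^+ 2 by rewrite expr2 mulrA ler_wpM2r// ltW.
have up' : (cnt (pairs T x1 x2 y1 y2 r1 r2))%:R <= (cnt (spairs zu T x1 x2 y1 y2 r1 r2))%:R :> R.
  by rewrite ler_nat.
have lo' : (cnt (spairs zl T x1 x2 y1 y2 r1 r2))%:R <=
    (cnt (pairs T x1 x2 y1 y2 r1 r2))%:R + (cnt G)%:R :> R.
  by rewrite -natrD ler_nat.
move: cu cl; rewrite !ler_norml => /andP[_ cu] /andP[cl _].
by apply/andP; split; lra.
Qed.

End PrimitiveDensity.

(** * Unimodular matrices with denominators in a box *)

Section Bases.
Variables (R : realType) (m : nat).
Hypothesis m_gt0 : (0 < m)%N.

(** The condition on [p / q] is free of division, and half-open so that counts over adjacent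
    intervals add up. *)
Definition basis_in (x1 x2 y1 y2 : R) (M1 M2 M3 M4 : int) (s t T : R)
    (p q p' q' : int) : Prop :=
  [/\ p' * q - p * q' = 1,
      s * q%:~R <= p%:~R < t * q%:~R,
      T * x1 < q%:~R <= T * x2,
      T * y1 < q'%:~R <= T * y2 &
      [/\ (m %| p - M1)%Z, (m %| q - M2)%Z, (m %| p' - M3)%Z & (m %| q' - M4)%Z]].

Definition bases (x1 x2 y1 y2 : R) (M1 M2 M3 M4 : int) (s t T : R) :
    set (int * int * int * int) :=
  [set g | basis_in x1 x2 y1 y2 M1 M2 M3 M4 s t T g.1.1.1 g.1.1.2 g.1.2 g.2].

Lemma eq_of_close_mul (q a b k : int) :
  0 < q -> a - b = q * k -> - q < a - b < q -> a = b.
Proof.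
move=> q0 abk /andP[h1 h2]; have : k = 0; last by move=> k0; lia.
by have [k0|k0|//] := ltgtP k 0; exfalso; nia.
Qed.

(** A matrix is determined by [q], by [p] measured from its least admissible value, and by
    [q' %/ q]: for fixed [(p, q)] the possible [(p', q')] differ by multiples of [(p, q)], which the
    quotient tells apart. The bound is the product of the three ranges. *)
Lemma bases_bound x1 x2 y1 y2 M1 M2 M3 M4 s t T :
  0 < x1 -> x1 <= x2 -> 0 < y1 -> y1 <= y2 -> s <= t -> 0 < T ->
  finite_set (bases x1 x2 y1 y2 M1 M2 M3 M4 s t T) /\
  (cnt (bases x1 x2 y1 y2 M1 M2 M3 M4 s t T))%:R <=
    T * x2 * ((t - s) * (T * x2) + 1) * (y2 / x1 + 1).
Proof.
move=> x10 x12 y10 y12 st T0.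
have x20 : 0 < x2 by apply: lt_le_trans x12.
have y20 : 0 < y2 by apply: lt_le_trans y12.
have Tx2 : 0 <= T * x2 by rewrite mulr_ge0// ltW.
(* Windows exclude their left end; starting at -1 admits the value 0. *)
have A2 : -1 <= (t - s) * (T * x2).
  by apply: (@le_trans _ _ 0); [rewrite lerN10|rewrite mulr_ge0// subr_ge0].
have A3 : -1 <= y2 / x1.
  by apply: (@le_trans _ _ 0); [rewrite lerN10|rewrite divr_ge0// ltW].
have [f1 c1] := int_window Tx2; have [f2 c2] := int_window A2.
have [f3 c3] := int_window A3.
set W1 := [set _ | _] in f1 c1; set W2 := [set _ | _] in f2 c2.
set W3 := [set _ | _] in f3 c3.
have fW : finite_set ((W1 `*` W2) `*` W3) by do 2 apply: finite_setX => //.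
set B := bases _ _ _ _ _ _ _ _ _ _ _.
pose f (g : int * int * int * int) : int * int * int :=
  (g.1.1.2, g.1.1.1 - Num.ceil (s * g.1.1.2%:~R), (g.2 %/ g.1.1.2)%Z).
have qpos p q p' q' : B (p, q, p', q') -> 0 < q.
  move=> [/= _ _ /andP[h _] _ _].
  by rewrite -(ltr0z R); apply: lt_trans h; rewrite mulr_gt0.
have Bf g : B g -> ((W1 `*` W2) `*` W3) (f g).
  case: g => [[[p q] p'] q'] Bg; have q0 := qpos _ _ _ _ Bg.
  have q0' : (0 : R) < q%:~R by rewrite ltr0z.
  case: Bg => /= _ /andP[sp pt] /andP[q1 q2] /andP[q1' q2'] _; split; [split|].
  - by rewrite /W1/= q0'.
  - rewrite /W2/= rmorphB/=; have := real_ceil_itv (num_real (s * q%:~R)).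
    rewrite rmorphB/= => /andP[cl cu]; have cp : Num.ceil (s * q%:~R) <= p.
      by rewrite ceil_le_int.
    move: cp; rewrite -(ler_int R) => cp; apply/andP; split; first by lra.
    have : (t - s) * q%:~R <= (t - s) * (T * x2) by rewrite ler_wpM2l// subr_ge0.
    by rewrite mulrBl; lra.
  - rewrite /W3/=; have q'0 : 0 < q'.
      by rewrite -(ltr0z R); apply: lt_trans q1'; rewrite mulr_gt0.
    have d0 : (0 <= (q' %/ q)%Z) by rewrite divz_ge0// ltW.
    apply/andP; split; first by rewrite (lt_le_trans (ltrN10 R))// ler0z.
    rewrite ler_pdivlMr//.
    have dq : (q' %/ q)%Z * q <= q' by rewrite lez_floor// gt_eqF.
    have d0' : (0 : R) <= (q' %/ q)%Z%:~R by rewrite ler0z.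
    have : (q' %/ q)%Z%:~R * q%:~R <= T * y2.
      by apply: le_trans q2'; rewrite -intrM ler_int.
    have : (q' %/ q)%Z%:~R * (T * x1) <= (q' %/ q)%Z%:~R * q%:~R :> R.
      by rewrite ler_wpM2l// ltW.
    move=> h1 h2; rewrite -(ler_pM2l T0).
    by rewrite mulrCA (le_trans h1 h2).
have finj : {in B &, injective f}.
  move=> [[[p1 q1] p1'] q1'] [[[p2 q2] p2'] q2'] /set_mem B1 /set_mem B2.
  move=> [] /= eq; move: B1 B2; rewrite {}eq => B1 B2 /addIr ep; rewrite {}ep in B1 *.
  move=> ed; have q0 := qpos _ _ _ _ B2.
  case: B1 => /= d1 _ _ _ _; case: B2 => /= d2 _ _ _ _.
  have eq' : q1' = q2'.
    apply: (@eq_of_close_mul q2 _ _ (p1' * (q1' - q2') - q1' * (p1' - p2'))) => //.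
      have h : p2 * (q1' - q2') = q2 * (p1' - p2').
        apply/eqP; rewrite -subr_eq0 (_ : _ - _ = (p2' * q2 - p2 * q2') -
          (p1' * q2 - p2 * q1')); last by ring.
        by rewrite d1 d2 subrr.
      have -> : q2 * (p1' * (q1' - q2') - q1' * (p1' - p2')) =
        (p1' * q2) * (q1' - q2') - q1' * (q2 * (p1' - p2')) by ring.
      rewrite -h [RHS](_ : _ = (p1' * q2 - p2 * q1') * (q1' - q2')); last by ring.
      by rewrite d1 mul1r.
    have := divz_eq q1' q2; have := divz_eq q2' q2; rewrite ed.
    have := ltz_pmod q1' q0; have := ltz_pmod q2' q0.
    have q2n0 : q2 != 0 by rewrite gt_eqF.
    have := modz_ge0 q1' q2n0; have := modz_ge0 q2' q2n0.
    move: (q1' %% q2)%Z (q2' %% q2)%Z ((q2' %/ q2)%Z * q2) => u v w.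
    by clear; lia.
  rewrite eq' in d1 *; have : q2 * (p1' - p2') = 0.
    rewrite (_ : q2 * _ = (p1' * q2 - p2 * q2') - (p2' * q2 - p2 * q2')); last by ring.
    by rewrite d1 d2 subrr.
  by move/eqP; rewrite mulf_eq0 subr_eq0 gt_eqF//= => /eqP ->.
split; first exact: (finite_inj fW Bf finj).
have le3 : (cnt B <= cnt W1 * cnt W2 * cnt W3)%N.
  by rewrite -!cntX//; [exact: cnt_inj fW Bf finj|exact: finite_setX].
apply: (@le_trans _ _ (cnt W1 * cnt W2 * cnt W3)%:R); first by rewrite ler_nat.
have bnd (x : R) : -1 <= x -> (`|Num.floor x - Num.floor (-1 : R)|%N)%:R <= x + 1.
  move=> x0; have h : Num.floor (-1 : R) <= Num.floor x by exact: le_floor.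
  have e : `|Num.floor x - Num.floor (-1 : R)| = Num.floor x - Num.floor (-1 : R).
    by rewrite ger0_norm ?subr_ge0.
  rewrite natr_absz e rmorphB/= (_ : (Num.floor (-1 : R))%:~R = -1).
    by have := floor_le x; lra.
  by rewrite (_ : -1 = (-1)%:~R) ?intrKfloor// rmorphN.
rewrite c1 c2 c3 !natrM; apply: ler_pM; rewrite ?mulr_ge0// ?bnd//.
apply: ler_pM; rewrite ?bnd//.
have h : Num.floor (0 : R) <= Num.floor (T * x2) by exact: le_floor.
have e : `|Num.floor (T * x2) - Num.floor (0 : R)| = Num.floor (T * x2) - Num.floor (0 : R).
  by rewrite ger0_norm ?subr_ge0.
by rewrite natr_absz e floor0 subr0 floor_le.
Qed.

Lemma modz_shift (x B d : int) : 0 < d ->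
  B <= x - ((x - B) %/ d)%Z * d < B + d.
Proof.
move=> d0; have d0' : d != 0 by rewrite gt_eqF.
have h1 := modz_ge0 (x - B) d0'; have h2 := ltz_pmod (x - B) d0.
have h3 := divz_eq (x - B) d.
move: (_ %% _)%Z ((_ %/ _)%Z * _) h1 h2 h3 => r w; clear; lia.
Qed.

(* Bezout gives one solution; the others differ by multiples of (Q, Q'), and the
   congruences fix the multiple modulo m, the interval for P fixes it exactly. *)
Lemma complete_basis (sg Q Q' a1 a3 B : int) :
  sg * sg = 1 -> 0 < Q -> coprimez Q Q' -> (m %| (a3 * Q - a1 * Q') - sg)%Z ->
  exists P P' : int, [/\ P' * Q - P * Q' = sg, (m %| P - a1)%Z, (m %| P' - a3)%Z
    & B <= P < B + m%:Z * Q].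
Proof.
move=> sg2 Q0 /coprimezP[[u v] /= uv] /dvdzP[w hw].
pose P0 := - (sg * v); pose P0' := sg * u.
(* Cramer's rule modulo [m]: as [a3 * Q - a1 * Q'] is [sg] modulo [m], adding [t] times [(Q, Q')]
   carries [(P0, P0')] to [(a1, a3)] modulo [m]. *)
pose t := sg * (P0' * a1 - P0 * a3).
pose mQ := m%:Z * Q; pose s := ((P0 + t * Q - B) %/ mQ)%Z.
have mQ0 : 0 < mQ by rewrite mulr_gt0// ltz_nat.
exists (P0 + t * Q - s * mQ), (P0' + t * Q' - s * (m%:Z * Q')); split.
- rewrite [LHS](_ : _ = sg * (u * Q + v * Q')); first by rewrite uv mulr1.
  by rewrite /mQ /P0 /P0'; ring.
- apply/dvdzP; exists (v * w - s * Q).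
  have E : P0 + t * Q - a1 = v * (a3 * Q - a1 * Q' - sg) * 1
     + a1 * (u * Q + v * Q' - 1) * 1 + (sg * sg - 1) * (u * a1 + v * a3) * Q.
    by rewrite /P0 /P0' /t /P0 /P0'; ring.
  rewrite hw uv sg2 in E.
  rewrite [LHS](_ : _ = (P0 + t * Q - a1) - s * mQ); last by ring.
  by rewrite E /mQ; ring.
- apply/dvdzP; exists (- u * w - s * Q').
  have E : P0' + t * Q' - a3 = - u * (a3 * Q - a1 * Q' - sg) * 1
     + a3 * (u * Q + v * Q' - 1) * 1 + (sg * sg - 1) * (u * a1 + v * a3) * Q'.
    by rewrite /P0 /P0' /t /P0 /P0'; ring.
  rewrite hw uv sg2 in E.
  rewrite [LHS](_ : _ = (P0' + t * Q' - a3) - s * (m%:Z * Q')); last by ring.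
  by rewrite E; ring.
- exact: modz_shift.
Qed.

(** * Matrices between two images of a progression near a cusp *)

Section Cusp.
Variables (e f g h sg : int).
Hypotheses (g0 : 0 < g) (h0 : 0 < h) (det_sg : e * h - f * g = sg)
  (sg1 : (sg == 1) || (sg == -1)).

(* The images of the nonnegative integers under the Moebius map of determinant sg
   with matrix (e f; g h); they converge to the cusp e/g. *)
Definition cusp_pt (i : nat) : R := (e * i%:Z + f)%:~R / (g * i%:Z + h)%:~R.

Lemma cusp_den_gt0 (i : nat) : (0 : R) < (g * i%:Z + h)%:~R.
Proof. by rewrite ltr0z ltr_wpDl// mulr_ge0// ltW. Qed.

Lemma cusp_pt_le (i : nat) (p q : int) :
  (cusp_pt i * q%:~R <= p%:~R) = ((e * i%:Z + f) * q <= p * (g * i%:Z + h)).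
Proof.
by rewrite /cusp_pt mulrAC ler_pdivrMr ?cusp_den_gt0// -!intrM ler_int.
Qed.

Lemma cusp_pt_gt (i : nat) (p q : int) :
  (p%:~R < cusp_pt i * q%:~R) = (p * (g * i%:Z + h) < (e * i%:Z + f) * q).
Proof. by rewrite ltNge cusp_pt_le -ltNge. Qed.

(** The Moebius map increases for [sg = 1] and decreases for [sg = -1]; for [i <= j] these are the
    two images in increasing order. *)
Definition cusp_lo (i j : nat) := if sg == 1 then cusp_pt i else cusp_pt j.
Definition cusp_hi (i j : nat) := if sg == 1 then cusp_pt j else cusp_pt i.

Lemma sg_sqr : sg * sg = 1.
Proof. by case/orP: sg1 => /eqP ->. Qed.

Lemma cusp_window (i j : nat) (p q : int) :
  cusp_lo i j * q%:~R <= p%:~R < cusp_hi i j * q%:~R ->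
  i%:Z * (sg * (e * q - g * p)) <= sg * (h * p - f * q)
    <= j%:Z * (sg * (e * q - g * p)).
Proof.
rewrite /cusp_lo /cusp_hi; case/orP: sg1 => /eqP ->; rewrite ?eqxx/=.
  by rewrite cusp_pt_le cusp_pt_gt => /andP[h1 h2]; apply/andP; split; lia.
by rewrite cusp_pt_le cusp_pt_gt => /andP[h1 h2]; apply/andP; split; lia.
Qed.

Lemma cusp_windowV (i j : nat) (p q : int) :
  i%:Z * (sg * (e * q - g * p)) < sg * (h * p - f * q)
    < j%:Z * (sg * (e * q - g * p)) ->
  cusp_lo i j * q%:~R <= p%:~R < cusp_hi i j * q%:~R.
Proof.
rewrite /cusp_lo /cusp_hi; case/orP: sg1 => /eqP ->; rewrite ?eqxx/=.
  by rewrite cusp_pt_le cusp_pt_gt => /andP[h1 h2]; apply/andP; split; lia.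
by rewrite cusp_pt_le cusp_pt_gt => /andP[h1 h2]; apply/andP; split; lia.
Qed.

(* (p, q) = inv_num p q (e, g) + inv_den p q (f, h). *)
Definition inv_num (p q : int) : int := sg * (h * p - f * q).
Definition inv_den (p q : int) : int := sg * (e * q - g * p).

Lemma inv_numK (p q : int) : e * inv_num p q + f * inv_den p q = p.
Proof.
have -> : e * inv_num p q + f * inv_den p q = sg * (e * h - f * g) * p.
  by rewrite /inv_num /inv_den; ring.
by rewrite det_sg sg_sqr mul1r.
Qed.

Lemma inv_denK (p q : int) : g * inv_num p q + h * inv_den p q = q.
Proof.
have -> : g * inv_num p q + h * inv_den p q = sg * (e * h - f * g) * q.
  by rewrite /inv_num /inv_den; ring.
by rewrite det_sg sg_sqr mul1r.
Qed.

Lemma inv_det (p q p' q' : int) :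
  inv_num p' q' * inv_den p q - inv_num p q * inv_den p' q' =
  sg * (p' * q - p * q').
Proof.
have -> : inv_num p' q' * inv_den p q - inv_num p q * inv_den p' q' =
    sg * sg * (e * h - f * g) * (p' * q - p * q').
  by rewrite /inv_num /inv_den; ring.
by rewrite det_sg sg_sqr mul1r.
Qed.

(** For determinant 1 the right side is plus or minus [g]. So the new second denominator is [q']
    times the ratio [inv_den p q / q], up to an error [g / q]; this transfers the range of [q'], and
    [eta] below absorbs the error. *)
Lemma inv_den_cross (p q p' q' : int) :
  q' * inv_den p q - inv_den p' q' * q = sg * g * (p' * q - p * q').
Proof. by rewrite /inv_den; ring. Qed.

Lemma cusp_den_le (a b : nat) (P Q : int) :
  0 < Q -> a%:Z * Q <= P <= b%:Z * Q ->
  (g * a%:Z + h) * Q <= g * P + h * Q <= (g * b%:Z + h) * Q.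
Proof. by move=> Q0 /andP[aP Pb]; apply/andP; split; nia. Qed.

(** If [P] were [c * Q], then [Q > 1] would divide the determinant [sg]. This turns the weak
    inequalities of [cusp_window], whose strict end depends on [sg], into the strict ones that
    [cusp_windowV] asks for. *)
Lemma strict_window (a b : nat) (P Q P' Q' : int) :
  1 < Q -> P' * Q - P * Q' = sg -> a%:Z * Q <= P <= b%:Z * Q ->
  a%:Z * Q < P < b%:Z * Q.
Proof.
move=> Q1 d /andP[h1 h2].
have neq (c : int) : P <> c * Q.
  move=> Pc; have : Q * (P' - c * Q') = sg by rewrite -d Pc; ring.
  move=> hQ; have : (Q %| 1)%Z.
    by apply/dvdzP; exists (sg * (P' - c * Q'));
       rewrite -mulrA [_ * Q]mulrC hQ sg_sqr.
  by rewrite dvdz1; lia.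
rewrite !lt_neqAle h1 h2 !andbT; apply/andP; split; apply/eqP.
  by move=> /esym; exact: neq.
exact: neq.
Qed.

Lemma cusp_pt_sub (i j : nat) :
  cusp_pt j - cusp_pt i = sg%:~R * (j%:R - i%:R) /
    ((g * i%:Z + h)%:~R * (g * j%:Z + h)%:~R).
Proof.
have := cusp_den_gt0 i; have := cusp_den_gt0 j.
rewrite /cusp_pt -det_sg !rmorphD/= rmorphN !rmorphM/= => dj di.
by field; rewrite !gt_eqF.
Qed.

Lemma cusp_length (i j : nat) :
  cusp_hi i j - cusp_lo i j = (j%:R - i%:R) /
    ((g * i%:Z + h)%:~R * (g * j%:Z + h)%:~R).
Proof.
rewrite /cusp_lo /cusp_hi; have [s1|s1] := boolP (sg == 1).
  by rewrite cusp_pt_sub (eqP s1) mul1r.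
move: sg1; rewrite (negbTE s1)/= => /eqP sE.
by rewrite -opprB cusp_pt_sub sE mulN1r mulNr opprK.
Qed.

Lemma cusp_lo_le_hi (i j : nat) : (i <= j)%N -> cusp_lo i j <= cusp_hi i j.
Proof.
move=> ij; rewrite -subr_ge0 cusp_length divr_ge0 ?subr_ge0 ?ler_nat//.
by rewrite mulr_ge0// ltW// cusp_den_gt0.
Qed.

Lemma mul_div_cancel (T y u Q : R) : 0 < u -> T * (y / u) * (u * Q) = T * y * Q.
Proof. by move=> u0; field; rewrite gt_eqF. Qed.

Section Comparison.
Variables (x1 x2 y1 y2 eta T : R) (M1 M2 M3 M4 : int) (a : nat).
Hypotheses (x10 : 0 < x1) (x12 : x1 <= x2) (y10 : 0 < y1) (y12 : y1 <= y2)
  (T0 : 0 < T) (etaT : g%:~R <= T * eta * (T * x1)).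

Let sa : R := (g * a%:Z + h)%:~R.
Let sb : R := (g * (a + m)%N%:Z + h)%:~R.

Let sa0 : 0 < sa. Proof. exact: cusp_den_gt0. Qed.
Let sb0 : 0 < sb. Proof. exact: cusp_den_gt0. Qed.
Let sab : sa <= sb. Proof. by rewrite ler_int; nia. Qed.
Let g0' : (0 : R) < g%:~R. Proof. by rewrite ltr0z. Qed.

Let isab : sb^-1 <= sa^-1. Proof. by rewrite lef_pV2 ?posrE. Qed.
Let le_box (u v : R) : 0 < u -> u <= v -> u / sb <= v / sa.
Proof.
by move=> u0 uv; apply: ler_pM; rewrite ?isab//; [exact: ltW|rewrite invr_ge0 ltW].
Qed.

Let eta0 : 0 < eta.
Proof.
have := lt_le_trans g0' etaT.
by rewrite pmulr_lgt0; [rewrite pmulr_rgt0|exact: mulr_gt0].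
Qed.

Let c_lo := cusp_lo a (a + m).
Let c_hi := cusp_hi a (a + m).

(** The map keeps only the denominators [(Q, Q')] in the coordinates of the cusp. As [q] lies
    between [sa * Q] and [sb * Q], the box for [(q, q')] becomes the stated one, and the map is
    injective because the window for [P] has length [m * Q]. *)
Lemma cusp_bases_le : sb <= T * x1 ->
  (cnt (bases x1 x2 y1 y2 M1 M2 M3 M4 c_lo c_hi T) <=
   cnt (pairs m T (x1 / sb) (x2 / sa) (y1 / sb - eta) (y2 / sa + eta)
     (inv_den M1 M2) (inv_den M3 M4)))%N.
Proof.
move=> sbT.
pose F (u : int * int * int * int) := (inv_den u.1.1.1 u.1.1.2, inv_den u.1.2 u.2).
set B := bases _ _ _ _ _ _ _ _ _ _ _.
have Bfacts p q p' q' : B (p, q, p', q') ->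
  [/\ 0 < q, 1 < inv_den p q,
    a%:Z * inv_den p q < inv_num p q < (a + m)%N%:Z * inv_den p q,
    sa * (inv_den p q)%:~R <= q%:~R <= sb * (inv_den p q)%:~R &
    inv_num p' q' * inv_den p q - inv_num p q * inv_den p' q' = sg].
  move=> [/= d win /andP[q1 q2] _ _].
  have q0 : 0 < q by rewrite -(ltr0z R); apply: lt_trans q1; rewrite mulr_gt0.
  have := cusp_window win; rewrite -/(inv_den p q) -/(inv_num p q) => w.
  have Q0 : 0 < inv_den p q.
    have Q0 : 0 <= inv_den p q.
      case/andP: w => w1 w2; have := le_trans w1 w2.
      by rewrite PoszD mulrDl lerDl pmulr_rge0.
    rewrite lt_neqAle Q0 andbT; apply/eqP => /esym QE.
    have PE : inv_num p q = 0.
      by move: w; rewrite QE !mulr0 -eq_le => /eqP.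
    by have := inv_denK p q; rewrite QE PE !mulr0 addr0 => q_0; rewrite -q_0 in q0.
  have := cusp_den_le Q0 w; rewrite inv_denK => wq.
  have wq' : sa * (inv_den p q)%:~R <= q%:~R <= sb * (inv_den p q)%:~R.
    by rewrite -!intrM !ler_int.
  have dd : inv_num p' q' * inv_den p q - inv_num p q * inv_den p' q' = sg.
    by rewrite inv_det d mulr1.
  (* From [sb <= T * x1 < q <= sb * Q]. *)
  have Q1 : 1 < inv_den p q.
    rewrite -(ltr_int R); case/andP: wq' => _ h2.
    rewrite -(ltr_pM2l sb0) mulr1; apply: lt_le_trans h2.
    exact: le_lt_trans q1.
  by split => //; exact: strict_window Q1 dd w.
apply: (@cnt_inj _ _ F).
- apply: (sub_finite_set _ (@finite_box R (T * (x1 / sb)) (T * (x2 / sa))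
     (T * (y1 / sb - eta)) (T * (y2 / sa + eta)) _ _)).
  + by move=> [i j] [].
  + by rewrite ler_pM2l// le_box.
  + by rewrite ler_pM2l//; apply: lerD; [exact: le_box|have := eta0; lra].
- move=> [[[p q] p'] q'] Bg; have [q0 Q1 win wq dd] := Bfacts _ _ _ _ Bg.
  have q0' : (0 : R) < q%:~R by rewrite ltr0z.
  have Q0' : (0 : R) < (inv_den p q)%:~R by rewrite ltr0z (lt_trans _ Q1).
  case: Bg => /= d _ /andP[q1 q2] /andP[q1' q2'] [c1 c2 c3 c4].
  case/andP: wq => wq1 wq2.
  have q'0 : (0 : R) < q'%:~R by apply: lt_trans q1'; rewrite mulr_gt0.
  have cross : q'%:~R * (inv_den p q)%:~R - (inv_den p' q')%:~R * q%:~R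
     = sg%:~R * g%:~R :> R.
    by rewrite -!intrM -rmorphB inv_den_cross d mulr1.
  have sgb : - g%:~R <= (sg%:~R * g%:~R : R) <= g%:~R.
    have g1 := ltW g0'; have [->|->] : sg%:~R = 1 :> R \/ sg%:~R = -1 :> R.
    - by case/orP: sg1 => /eqP ->; [left|right; rewrite rmorphN].
    - rewrite mul1r; apply/andP; split; last exact: lexx.
      by apply: (le_trans _ g1); rewrite oppr_le0.
    - rewrite mulN1r; apply/andP; split; first exact: lexx.
      by apply: (le_trans _ g1); rewrite oppr_le0.
  have gT : g%:~R < T * eta * q%:~R.
    by apply: le_lt_trans etaT _; rewrite ltr_pM2l// mulr_gt0.
  case/andP: sgb => sg_1 sg_2.
  split => /=.
  + apply/andP; split; rewrite mulrA.
      by rewrite ltr_pdivrMr// [X in _ < X]mulrC; exact: lt_le_trans wq2.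
    by rewrite ler_pdivlMr// mulrC; exact: le_trans q2.
  + apply/andP; split.
      rewrite -(ltr_pM2r q0').
      have : T * (y1 / sb) * q%:~R <= T * y1 * (inv_den p q)%:~R.
        rewrite mulrA mulrAC ler_pdivrMr// -[X in _ <= X]mulrA.
        by rewrite ler_wpM2l ?mulr_ge0 ?(ltW T0) ?(ltW y10)// mulrC.
      have : T * y1 * (inv_den p q)%:~R < q'%:~R * (inv_den p q)%:~R.
        by rewrite ltr_pM2r.
      by rewrite mulrBr mulrBl; lra.
    rewrite -(ler_pM2r q0').
    have : q'%:~R * (inv_den p q)%:~R <= T * y2 * (inv_den p q)%:~R.
      by rewrite ler_pM2r.
    have : T * y2 * (inv_den p q)%:~R <= T * (y2 / sa) * q%:~R.
      rewrite mulrA [X in _ <= X]mulrAC ler_pdivlMr// -[X in X <= _]mulrA.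
      rewrite ler_wpM2l ?mulr_ge0 ?(ltW T0)//; last by rewrite mulrC.
      by apply: ltW; exact: lt_le_trans y12.
    by rewrite mulrDr mulrDl; lra.
  + apply/dvdzP; case/dvdzP: c1 => c1 e1; case/dvdzP: c2 => c2 e2.
    exists (sg * (e * c2 - g * c1)); rewrite /inv_den.
    rewrite [LHS](_ : _ = sg * (e * (q - M2) - g * (p - M1))); last by ring.
    by rewrite e1 e2; ring.
  + apply/dvdzP; case/dvdzP: c3 => c3 e3; case/dvdzP: c4 => c4 e4.
    exists (sg * (e * c4 - g * c3)); rewrite /inv_den.
    rewrite [LHS](_ : _ = sg * (e * (q' - M4) - g * (p' - M3))); last by ring.
    by rewrite e3 e4; ring.
  + apply/coprimezP; exists (sg * inv_num p' q', - sg * inv_num p q) => /=.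
    rewrite [LHS](_ : _ = sg * (inv_num p' q' * inv_den p q
      - inv_num p q * inv_den p' q')); last by ring.
    by rewrite dd sg_sqr.
- move=> [[[p1 q1] p1'] q1'] [[[p2 q2] p2'] q2'] /set_mem B1 /set_mem B2 [QE QE'].
  have [_ Q1 /andP[a1 b1] _ d1] := Bfacts _ _ _ _ B1.
  have [_ _ /andP[a2 b2] _ d2] := Bfacts _ _ _ _ B2.
  case: B1 => /= _ _ _ _ [u1 u2 u3 u4]; case: B2 => /= _ _ _ _ [v1 v2 v3 v4].
  rewrite /= in QE QE'; rewrite -QE in a2 b2 d2; rewrite -QE' in d2.
  have cong (x y x' y' z w : int) : (m %| x - z)%Z -> (m %| y - w)%Z ->
      (m %| x' - z)%Z -> (m %| y' - w)%Z -> (m %| inv_num x y - inv_num x' y')%Z.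
    move=> /dvdzP[k1 e1] /dvdzP[k2 e2] /dvdzP[k3 e3] /dvdzP[k4 e4].
    apply/dvdzP; exists (sg * (h * (k1 - k3) - f * (k2 - k4))).
    rewrite [LHS](_ : _ = sg * (h * ((x - z) - (x' - z)) -
      f * ((y - w) - (y' - w)))); last by rewrite /inv_num; ring.
    by rewrite e1 e2 e3 e4; ring.
  have /dvdzP[k kE] := cong _ _ _ _ _ _ u1 u2 v1 v2.
  have /dvdzP[k' kE'] := cong _ _ _ _ _ _ u3 u4 v3 v4.
  have N1 := inv_numK p1 q1; have N1' := inv_numK p1' q1'.
  have N2 := inv_numK p2 q2; have N2' := inv_numK p2' q2'.
  have D1 := inv_denK p1 q1; have D1' := inv_denK p1' q1'.
  have D2 := inv_denK p2 q2; have D2' := inv_denK p2' q2'.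
  rewrite -QE in N2 D2; rewrite -QE' in N2' D2'.
  move: (inv_num p1 q1) (inv_num p1' q1') (inv_num p2 q2) (inv_num p2' q2')
    (inv_den p1 q1) (inv_den p1' q1') kE kE' N1 N1' N2 N2' D1 D1' D2 D2'
    Q1 a1 b1 a2 b2 d1 d2 {u1 u2 u3 u4 v1 v2 v3 v4 QE QE' cong}
    => P1 P1' P2 P2' Q Q' kE kE' N1 N1' N2 N2' D1 D1' D2 D2' Q1 a1 b1 a2 b2 d1 d2.
  have cr : (P1' - P2') * Q = (P1 - P2) * Q'.
    apply/eqP; rewrite -subr_eq0 [X in X == 0](_ : _ =
      (P1' * Q - P1 * Q') - (P2' * Q - P2 * Q')); last by ring.
    by rewrite d1 d2 subrr.
  (* The two solutions differ by a multiple of [(Q, Q')]. The difference vanishes modulo [m] and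
     [Q], [Q'] are coprime, so it is a multiple of [m] times [(Q, Q')]; but the open window for [P]
     has length [m * Q]. *)
  have PE : P1 = P2.
    apply: (@eq_of_close_mul (m%:Z * Q) _ _ (sg * (P1' * k - P1 * k'))).
    - by rewrite mulr_gt0 ?ltz_nat// (lt_trans _ Q1).
    - rewrite [RHS](_ : _ = sg * (P1' * (k * m%:Z) * Q - P1 * ((k' * m%:Z) * Q)));
        last by ring.
      rewrite -kE -kE' cr [RHS](_ : _ = sg * (P1' * Q - P1 * Q') * (P1 - P2));
        last by ring.
      by rewrite d1 sg_sqr mul1r.
    - move: b1 b2; rewrite PoszD mulrDl => b1 b2.
      by move: a1 b1 a2 b2; move: (a%:Z * Q) (m%:Z * Q) => w v; clear; lia.
  have PE' : P1' = P2'.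
    have Q0 : Q != 0 by rewrite gt_eqF// (lt_trans _ Q1).
    by apply: (mulIf Q0); move: cr; rewrite PE subrr mul0r mulrBl => /eqP;
      rewrite subr_eq0 => /eqP.
  by rewrite -N1 -N1' -D1 -D1' -N2 -N2' -D2 -D2' PE PE'.
Qed.

(** Every coprime pair of the smaller box is reached: [detM] makes the congruences compatible with
    the determinant, and [complete_basis] started at [a * Q] puts [P] in the window. *)
Lemma pairs_le_cusp_bases : sa <= T * x1 ->
  (m %| M3 * M2 - M1 * M4 - 1)%Z ->
  (cnt (pairs m T (x1 / sa) (x2 / sb) (y1 / sa + eta) (y2 / sb - eta)
     (inv_den M1 M2) (inv_den M3 M4)) <=
   cnt (bases x1 x2 y1 y2 M1 M2 M3 M4 c_lo c_hi T))%N.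
Proof.
move=> saT detM.
have lohi : c_lo <= c_hi by apply: cusp_lo_le_hi; rewrite leq_addr.
apply: (@cnt_surj _ _ (fun u : int * int * int * int =>
  (inv_den u.1.1.1 u.1.1.2, inv_den u.1.2 u.2))).
  exact: (bases_bound _ _ _ _ x10 x12 y10 y12 lohi T0).1.
move=> [Q Q'] [/= /andP[Q1 Q2] /andP[Q1' Q2'] c2 c4 cop].
have Qgt1 : 1 < Q.
  rewrite -(ltr_int R); apply: le_lt_trans Q1.
  by rewrite mulrA ler_pdivlMr// mul1r.
have Q0 : 0 < Q by exact: lt_trans Qgt1.
have Q0' : (0 : R) < Q%:~R by rewrite ltr0z.
have Q'0 : (0 : R) < Q'%:~R.
  apply: lt_trans Q1'; rewrite mulr_gt0// addr_gt0//; exact: divr_gt0.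
have cg : (m %| (inv_num M3 M4 * Q - inv_num M1 M2 * Q') - sg)%Z.
  case/dvdzP: c2 => k2 e2; case/dvdzP: c4 => k4 e4; case/dvdzP: detM => k e1.
  apply/dvdzP; exists (inv_num M3 M4 * k2 - inv_num M1 M2 * k4 + sg * k).
  have E := inv_det M1 M2 M3 M4.
  rewrite [LHS](_ : _ = inv_num M3 M4 * (Q - inv_den M1 M2)
    - inv_num M1 M2 * (Q' - inv_den M3 M4)
    + ((inv_num M3 M4 * inv_den M1 M2 - inv_num M1 M2 * inv_den M3 M4) - sg));
    last by ring.
  rewrite e2 e4 E (_ : sg * _ - sg = sg * (M3 * M2 - M1 * M4 - 1)); last by ring.
  by rewrite e1; ring.
have [P [P' [d c1 c3 /andP[aP Pb]]]] :=
  complete_basis (a%:Z * Q) sg_sqr Q0 cop cg.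
have win : a%:Z * Q < P < (a + m)%N%:Z * Q.
  by apply: (strict_window Qgt1 d); rewrite aP PoszD mulrDl ltW.
have nK x y : inv_num (e * x + f * y) (g * x + h * y) = x.
  rewrite (_ : inv_num _ _ = sg * (e * h - f * g) * x); last by rewrite /inv_num; ring.
  by rewrite det_sg sg_sqr mul1r.
have dK x y : inv_den (e * x + f * y) (g * x + h * y) = y.
  rewrite (_ : inv_den _ _ = sg * (e * h - f * g) * y); last by rewrite /inv_den; ring.
  by rewrite det_sg sg_sqr mul1r.
exists (e * P + f * Q, g * P + h * Q, e * P' + f * Q', g * P' + h * Q');
  last by rewrite /= !dK.
have /andP[w1 w2] := win.
have := @cusp_den_le a (a + m) P Q Q0; rewrite (ltW w1) (ltW w2) => /(_ isT) wq.
have {wq} : sa * Q%:~R <= (g * P + h * Q)%:~R <= sb * Q%:~R.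
  by rewrite -!intrM !ler_int.
case/andP => wq1 wq2.
have d1 : (e * P' + f * Q') * (g * P + h * Q)
    - (e * P + f * Q) * (g * P' + h * Q') = 1.
  rewrite [LHS](_ : _ = (e * h - f * g) * (P' * Q - P * Q')); last by ring.
  by rewrite d det_sg sg_sqr.
have cross : (g * P' + h * Q')%:~R * Q%:~R - Q'%:~R * (g * P + h * Q)%:~R
     = sg%:~R * g%:~R :> R.
  rewrite -!intrM -rmorphB; congr (_%:~R).
  by have := inv_den_cross (e * P + f * Q) (g * P + h * Q)
    (e * P' + f * Q') (g * P' + h * Q'); rewrite !dK d1 mulr1.
have sgb : - g%:~R <= (sg%:~R * g%:~R : R) <= g%:~R.
  have g1 := ltW g0'; have [->|->] : sg%:~R = 1 :> R \/ sg%:~R = -1 :> R.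
  - by case/orP: sg1 => /eqP ->; [left|right; rewrite rmorphN].
  - rewrite mul1r; apply/andP; split; last exact: lexx.
    by apply: (le_trans _ g1); rewrite oppr_le0.
  - rewrite mulN1r; apply/andP; split; first exact: lexx.
    by apply: (le_trans _ g1); rewrite oppr_le0.
case/andP: sgb => sg_1 sg_2.
have gQ : g%:~R <= T * eta * (sa * Q%:~R).
  apply: le_trans etaT _; rewrite ler_pM2l ?mulr_gt0//.
  by apply: ltW; move: Q1; rewrite mulrA ltr_pdivrMr// [X in _ < X]mulrC.
have gQb : g%:~R <= T * eta * (sb * Q%:~R).
  by apply: le_trans gQ _; rewrite ler_pM2l ?mulr_gt0// ler_pM2r.
have iQ : (0 : R) <= Q%:~R by exact: ltW.
split => /=.
- by [].
- by apply: cusp_windowV; rewrite -/(inv_den _ _) -/(inv_num _ _) dK nK.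
- apply/andP; split.
    apply: lt_le_trans wq1; move: Q1; rewrite mulrA ltr_pdivrMr//.
    by rewrite [X in _ < X]mulrC.
  by apply: le_trans wq2 _; move: Q2; rewrite mulrA ler_pdivlMr// mulrC.
- have b1 : Q'%:~R * (sa * Q%:~R) <= Q'%:~R * (g * P + h * Q)%:~R by rewrite ler_pM2l.
  have b2 : Q'%:~R * (g * P + h * Q)%:~R <= Q'%:~R * (sb * Q%:~R) by rewrite ler_pM2l.
  apply/andP; split.
    rewrite -(ltr_pM2r Q0').
    have : T * (y1 / sa + eta) * (sa * Q%:~R) < Q'%:~R * (sa * Q%:~R).
      by rewrite ltr_pM2r// mulr_gt0.
    by rewrite mulrDr mulrDl mul_div_cancel//; lra.
  rewrite -(ler_pM2r Q0').
  have : Q'%:~R * (sb * Q%:~R) <= T * (y2 / sb - eta) * (sb * Q%:~R).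
    by rewrite ler_pM2r// mulr_gt0.
  by rewrite mulrBr mulrBl mul_div_cancel//; lra.
- case/dvdzP: c1 => k1 e1; case/dvdzP: c2 => k2 e2.
  case/dvdzP: c3 => k3 e3; case/dvdzP: c4 => k4 e4.
  split; apply/dvdzP.
  + exists (e * k1 + f * k2); rewrite -{1}(inv_numK M1 M2).
    rewrite [LHS](_ : _ = e * (P - inv_num M1 M2) + f * (Q - inv_den M1 M2)).
      by rewrite e1 e2; ring.
    by ring.
  + exists (g * k1 + h * k2); rewrite -{1}(inv_denK M1 M2).
    rewrite [LHS](_ : _ = g * (P - inv_num M1 M2) + h * (Q - inv_den M1 M2)).
      by rewrite e1 e2; ring.
    by ring.
  + exists (e * k3 + f * k4); rewrite -{1}(inv_numK M3 M4).
    rewrite [LHS](_ : _ = e * (P' - inv_num M3 M4) + f * (Q' - inv_den M3 M4)).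
      by rewrite e3 e4; ring.
    by ring.
  + exists (g * k3 + h * k4); rewrite -{1}(inv_denK M3 M4).
    rewrite [LHS](_ : _ = g * (P' - inv_num M3 M4) + h * (Q' - inv_den M3 M4)).
      by rewrite e3 e4; ring.
    by ring.
Qed.

End Comparison.
End Cusp.
End Bases.

(** * Density near a cusp *)

Section NearDensity.
Variables (R : realType) (m : nat).
Hypothesis m_gt0 : (0 < m)%N.
Variables (x1 x2 y1 y2 : R) (M1 M2 M3 M4 : int) (rho : R).
Hypotheses (x10 : 0 < x1) (x12 : x1 < x2) (y10 : 0 < y1) (y12 : y1 < y2).
Hypothesis detM : (m %| M3 * M2 - M1 * M4 - 1)%Z.
Hypothesis rho0 : 0 <= rho.
Hypothesis rhoP : forall r1 r2 : int, gcdz (gcdz r1 r2) m = 1 ->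
  forall x1 x2 y1 y2 : R, 0 < x1 <= x2 -> 0 < y1 <= y2 ->
  forall e : R, 0 < e -> exists2 T0 : R, 1 <= T0 & forall T, T0 <= T ->
  `|(cnt (pairs m T x1 x2 y1 y2 r1 r2))%:R
     - rho * ((x2 - x1) * (y2 - y1)) * T ^+ 2| <= e * T ^+ 2.

Let N (s t T : R) : R := (cnt (bases m x1 x2 y1 y2 M1 M2 M3 M4 s t T))%:R.
(** An interval between images whose indices differ by [m] has length [m / (sa * sb)], with [sa],
    [sb] the denominators at its ends, and it receives about [rho / (sa * sb) * T ^+ 2] times the
    area of the box; hence the division by [m]. *)
Let dens : R := rho / m%:R * ((x2 - x1) * (y2 - y1)).

Let m0 : (0 : R) < m%:R. Proof. by rewrite ltr0n. Qed.
Let x20 : 0 < x2. Proof. exact: lt_trans x12. Qed.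
Let y20 : 0 < y2. Proof. exact: lt_trans y12. Qed.

Local Tactic Notation "keep" ne_hyp_list(hs) :=
  clear -m_gt0 x10 x12 y10 y12 detM rho0 rhoP m0 x20 y20 N dens hs.

Lemma dens_ge0 : 0 <= dens.
Proof.
by rewrite /dens !mulr_ge0 ?invr_ge0 ?(ltW m0)// subr_ge0 ltW.
Qed.

Definition near_density (s t eps : R) : Prop :=
  exists2 T0, 1 <= T0 & forall T, T0 <= T ->
    `|N s t T - dens * (t - s) * T ^+ 2| <= eps * T ^+ 2.

Lemma near_density_le s t e1 e2 : e1 <= e2 ->
  near_density s t e1 -> near_density s t e2.
Proof.
move=> e12 [T0 T01 h]; exists T0 => // T T0T; apply: le_trans (h T T0T) _.
by rewrite ler_wpM2r// sqr_ge0.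
Qed.

Lemma bases_add s t u T : s <= t -> t <= u -> 0 < T ->
  N s u T = N s t T + N t u T.
Proof.
move=> st tu T0; rewrite /N -natrD; congr (_%:R).
have q0 (q : int) : T * x1 < q%:~R <= T * x2 -> (0 : R) < q%:~R.
  by case/andP => h _; apply: lt_trans h; rewrite mulr_gt0.
apply: cnt_split.
- exact: (bases_bound m_gt0 _ _ _ _ x10 (ltW x12) y10 (ltW y12) (le_trans st tu) T0).1.
- move=> [[[p q] p'] q'] [/= d /andP[h1 h2] h3 h4 h5].
  have [h|h] := ltP (p%:~R) (t * q%:~R : R); [left|right]; split => //=.
    by rewrite h1.
  by rewrite h.
- move=> [[[p q] p'] q'] [/= d /andP[h1 h2] h3 h4 h5]; split => //=.
  by rewrite h1/= (lt_le_trans h2)// ler_pM2r// q0.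
- move=> [[[p q] p'] q'] [/= d /andP[h1 h2] h3 h4 h5]; split => //=.
  by rewrite h2 andbT (le_trans _ h1)// ler_pM2r// q0.
- move=> [[[p q] p'] q'] [/= _ /andP[_ h1] _ _ _] [/= _ /andP[h2 _] _ _ _].
  by have := lt_le_trans h1 h2; rewrite ltxx.
Qed.

Lemma near_density_add s t u e1 e2 : s <= t -> t <= u ->
  near_density s t e1 -> near_density t u e2 -> near_density s u (e1 + e2).
Proof.
move=> st tu [T1 T11 h1] [T2 T21 h2]; exists (T1 + T2) => [|T hT]; first by lra.
rewrite (bases_add st tu); last by lra.
have k1 := h1 T ltac:(lra); have k2 := h2 T ltac:(lra).
rewrite [X in `|X|](_ : _ = (N s t T - dens * (t - s) * T ^+ 2) +
  (N t u T - dens * (u - t) * T ^+ 2)); last by ring.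
by rewrite mulrDl; apply: le_trans (ler_normD _ _) _; exact: lerD.
Qed.

Lemma near_density0 s : near_density s s 0.
Proof.
exists 1 => // T T1; rewrite subrr mulr0 !mul0r subr0 /N (_ : bases _ _ _ _ _ _ _ _ _ _ _ _ = set0).
  by rewrite /cnt fset_set0/= normr0.
apply/seteqP; split => // -[[[p q] p'] q'] [/= _ /andP[h1 h2]].
by move: (le_lt_trans h1 h2); rewrite ltxx.
Qed.

Definition crude_slope : R := 2 * x2 ^+ 2 * (y2 / x1 + 1) + dens.

Lemma crude_slope_ge0 : 0 <= crude_slope.
Proof.
apply: addr_ge0; last exact: dens_ge0.
apply: mulr_ge0; first by apply: mulr_ge0 => //; exact: sqr_ge0.
by apply: addr_ge0 => //; apply: divr_ge0; exact: ltW.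
Qed.

(** Once [(t - s) * x2 * T >= 1], the [+ 1] in [bases_bound] is absorbed by a factor 2 and the bound
    becomes linear in [t - s]. *)
Lemma near_density_crude s t : s <= t -> near_density s t (crude_slope * (t - s)).
Proof.
rewrite le_eqVlt => /orP[/eqP->|st].
  by rewrite subrr mulr0; exact: near_density0.
have ts : 0 < t - s by rewrite subr_gt0.
exists (1 + ((t - s) * x2)^-1) => [|T hT].
  by rewrite lerDl invr_ge0 mulr_ge0 ?ltW.
have i0 : 0 < ((t - s) * x2)^-1 by rewrite invr_gt0 mulr_gt0.
have T0 : 0 < T by lra.
have Tb : 1 <= (t - s) * x2 * T.
  by rewrite mulrC -ler_pdivrMr ?mulr_gt0// mul1r; lra.
have [_ b] := bases_bound m_gt0 M1 M2 M3 M4 x10 (ltW x12) y10 (ltW y12) (ltW st) T0.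
rewrite -/(N s t T) in b.
have N0 : 0 <= N s t T by [].
have D0 : 0 <= dens * (t - s) * T ^+ 2.
  by apply: mulr_ge0; [apply: mulr_ge0; [exact: dens_ge0|exact: ltW]|exact: sqr_ge0].
have up : N s t T <= 2 * x2 ^+ 2 * (y2 / x1 + 1) * (t - s) * T ^+ 2.
  apply: le_trans b _.
  rewrite [X in _ <= X](_ : _ = T * x2 * (2 * ((t - s) * (T * x2))) * (y2 / x1 + 1)).
    rewrite ler_wpM2r//; first by apply: addr_ge0 => //; apply: divr_ge0; exact: ltW.
    rewrite ler_wpM2l//; first by rewrite mulr_ge0// ltW.
    by lra.
  by ring.
rewrite /crude_slope mulrDl mulrDl ler_norml; apply/andP; split.
  have : 0 <= 2 * x2 ^+ 2 * (y2 / x1 + 1) * (t - s) * T ^+ 2 by exact: le_trans up.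
  by lra.
by lra.
Qed.

(** The two numbers form a column of a matrix of determinant [sg] modulo [m], so a common divisor of
    both and of [m] divides 1. This is the admissibility required by [rhoP]. *)
Lemma inv_den_coprime (e f g h sg : int) :
  e * h - f * g = sg -> (sg == 1) || (sg == -1) ->
  gcdz (gcdz (inv_den e g sg M1 M2) (inv_den e g sg M3 M4)) m = 1.
Proof.
move=> d sg1; have := inv_det d sg1 M1 M2 M3 M4.
set r1 := inv_den _ _ _ _ _; set r2 := inv_den _ _ _ _ _.
set a3 := inv_num _ _ _ _ _; set a1 := inv_num _ _ _ _ _ => E.
set c := gcdz _ _; case/dvdzP: detM => k kE.
have [/dvdzP[u uE] /dvdzP[v vE]] : (c %| r1)%Z /\ (c %| r2)%Z.
  by split; apply: (dvdz_trans (dvdz_gcdl _ _)); rewrite ?dvdz_gcdl ?dvdz_gcdr.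
have /dvdzP[w wE] : (c %| m%:Z)%Z by exact: dvdz_gcdr.
have : (c %| 1)%Z.
  apply/dvdzP; exists (sg * (a3 * u - a1 * v) - k * w).
  have sg2 : sg * sg = 1 by case/orP: sg1 => /eqP ->.
  rewrite [RHS](_ : _ = sg * (a3 * (u * c) - a1 * (v * c)) - k * (w * c)); last by ring.
  rewrite -uE -vE -wE -kE E mulrA sg2 mul1r; by ring.
by rewrite dvdz1 /c {1}/gcdz absz_nat => /eqP hc; rewrite {1}/gcdz hc.
Qed.

(** [u] and [v] stand for the reciprocals of the denominators at the two ends of the interval. One
    factor is bounded by a multiple of [v] and the other by a multiple of [u], so that [u * v],
    proportional to the length of the interval, comes out. *)
Lemma box_ratio_upper (u v kap : R) : 0 < v -> v <= u -> u <= v * (1 + kap) ->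
  0 <= kap <= 1 ->
  (x2 * u - x1 * v) * (y2 * u - y1 * v) <=
    u * v * ((x2 - x1) * (y2 - y1) + 3 * kap * (x2 * y2)).
Proof.
move=> v0 vu uv /andP[k0 k1]; have u0 : 0 < u by exact: lt_le_trans vu.
have xn : 0 <= x2 - x1 by rewrite subr_ge0 ltW.
have yn : 0 <= y2 - y1 by rewrite subr_ge0 ltW.
have hx : x2 * u - x1 * v <= v * (x2 - x1 + kap * x2).
  by have := ler_wpM2l (ltW x20) uv; lra.
have vk : u * (1 - kap) <= v.
  have : u * (1 - kap) <= v * (1 + kap) * (1 - kap) by rewrite ler_wpM2r// subr_ge0.
  have : 0 <= v * kap ^+ 2 by rewrite mulr_ge0 ?sqr_ge0// ltW.
  by rewrite (_ : v * (1 + kap) * (1 - kap) = v - v * kap ^+ 2); [lra|ring].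
have hy : y2 * u - y1 * v <= u * (y2 - y1 + kap * y1).
  by have := ler_wpM2l (ltW y10) vk; lra.
have px : 0 <= x2 * u - x1 * v.
  by rewrite subr_ge0; apply: ler_pM => //; exact: ltW.
have py : 0 <= y2 * u - y1 * v.
  by rewrite subr_ge0; apply: ler_pM => //; exact: ltW.
apply: le_trans (ler_pM px py hx hy) _.
rewrite [X in X <= _](_ : _ = u * v * ((x2 - x1 + kap * x2) * (y2 - y1 + kap * y1)));
  last by ring.
rewrite ler_wpM2l ?mulr_ge0 ?(ltW u0) ?(ltW v0)//.
have kk : kap * kap <= kap by have := ler_wpM2l k0 k1; rewrite mulr1.
have xy : 0 <= x2 * y1 by rewrite mulr_ge0 ?(ltW x20) ?(ltW y10).
have h1 : kap * kap * (x2 * y1) <= kap * (x2 * y1) by rewrite ler_wpM2r.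
have h2 : kap * ((x2 - x1) * y1) <= kap * (x2 * y2).
  rewrite ler_wpM2l//; apply: ler_pM.
  - exact: xn.
  - exact: ltW.
  - by rewrite lerBlDr lerDl ltW.
  - exact: ltW.
have h3 : kap * (x2 * (y2 - y1)) <= kap * (x2 * y2 - x2 * y1).
  by rewrite mulrBr.
have h4 : 0 <= kap * (x2 * y2) by rewrite !mulr_ge0// ltW.
by lra.
Qed.

Lemma box_ratio_lower (u v kap : R) : 0 < v -> v <= u -> u <= v * (1 + kap) ->
  0 <= kap <= 1 -> x1 * (1 + kap) <= x2 -> y1 <= y2 * (1 - kap) ->
  u * v * ((x2 - x1) * (y2 - y1) - 2 * kap * (x2 * y2)) <=
  (x2 * v - x1 * u) * (y2 * v - y1 * u).
Proof.
move=> v0 vu uv /andP[k0 k1] kx ky; have u0 : 0 < u by exact: lt_le_trans vu.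
have hx : v * (x2 - x1 * (1 + kap)) <= x2 * v - x1 * u.
  by have := ler_wpM2l (ltW x10) uv; lra.
have vk : u * (1 - kap) <= v.
  have : u * (1 - kap) <= v * (1 + kap) * (1 - kap) by rewrite ler_wpM2r// subr_ge0.
  have : 0 <= v * kap ^+ 2 by rewrite mulr_ge0 ?sqr_ge0// ltW.
  by rewrite (_ : v * (1 + kap) * (1 - kap) = v - v * kap ^+ 2); [lra|ring].
have hy : u * (y2 * (1 - kap) - y1) <= y2 * v - y1 * u.
  by have := ler_wpM2l (ltW y20) vk; lra.
have px : 0 <= v * (x2 - x1 * (1 + kap)) by rewrite mulr_ge0 ?(ltW v0) ?subr_ge0.
have py : 0 <= u * (y2 * (1 - kap) - y1) by rewrite mulr_ge0 ?(ltW u0) ?subr_ge0.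
apply: le_trans (ler_pM px py hx hy).
rewrite [X in _ <= X](_ : _ = u * v * ((x2 - x1 * (1 + kap)) * (y2 * (1 - kap) - y1)));
  last by ring.
rewrite ler_wpM2l ?mulr_ge0 ?(ltW u0) ?(ltW v0)//.
have h1 : 0 <= kap * kap * (x1 * y2) by rewrite !mulr_ge0// ltW.
have h2 : kap * (x1 * (y2 - y1)) <= kap * (x2 * y2).
  rewrite ler_wpM2l//; apply: ler_pM.
  - exact: ltW.
  - by rewrite subr_ge0 ltW.
  - exact: ltW.
  - by rewrite lerBlDr lerDl ltW.
have h3 : kap * (x2 - x1) * y2 <= kap * (x2 * y2).
  by rewrite -mulrA ler_wpM2l// ler_wpM2r ?(ltW y20)// lerBlDr lerDl ltW.
by lra.
Qed.

Lemma exists_small (a b c : R) : 0 < a -> 0 < b -> 0 < c ->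
  exists2 d : R, 0 < d & [/\ d <= a, d <= b & d <= c].
Proof.
move=> a0 b0 c0; exists (Num.min a (Num.min b c)).
  by rewrite !lt_min a0 b0.
by rewrite !ge_min !lexx !orbT.
Qed.

(** The 3 is that of [box_ratio_upper]; the [+ 1] pays for [eta] and for the error in counting
    coprime pairs. *)
Definition cusp_slope : R := 3 * (rho / m%:R) * (x2 * y2) + 1.

Lemma near_density_cusp (e f g h sg : int) (K k : nat) :
  0 < g -> 0 < h -> e * h - f * g = sg -> (sg == 1) || (sg == -1) ->
  (0 < K)%N -> (K <= k)%N ->
  x1 * (1 + K%:R^-1) <= x2 -> y1 < y2 * (1 - K%:R^-1) ->
  let lo := cusp_lo R e f g h sg (k * m) (k * m + m) in
  let hi := cusp_hi R e f g h sg (k * m) (k * m + m) in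
  near_density lo hi (cusp_slope / K%:R * (hi - lo)).
Proof.
move=> g0 h0 det_sg sg1 K0 kK kx ky lo hi.
set a := (k * m)%N in lo hi *.
have len := cusp_length R g0 h0 det_sg sg1 a (a + m).
rewrite -/lo -/hi natrD in len.
have sa0 := cusp_den_gt0 R g0 h0 a; have sb0 := cusp_den_gt0 R g0 h0 (a + m).
have U := @cusp_bases_le R m m_gt0 e f g h sg g0 h0 det_sg sg1 x1 x2 y1 y2.
have L := @pairs_le_cusp_bases R m m_gt0 e f g h sg g0 h0 det_sg sg1 x1 x2 y1 y2.
have {U} U eta T := U eta T M1 M2 M3 M4 a x10 (ltW x12) y10 (ltW y12).
have {L} L eta T := L eta T M1 M2 M3 M4 a x10 (ltW x12) y10 (ltW y12).
rewrite -/lo -/hi in U L.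
have adm := inv_den_coprime det_sg sg1.
set r1 := inv_den _ _ _ _ _ in adm U L; set r2 := inv_den _ _ _ _ _ in adm U L.
(* Since [K <= k], [g * m] is at most [g * (k * m) / K]: far along the progression the two
   denominators differ by a factor of at most [1 + 1 / K]. *)
have ratio : (g * (a + m)%N%:Z + h)%:~R <=
   (g * a%:Z + h)%:~R * (1 + K%:R^-1) :> R.
  rewrite mulrDr mulr1 -lerBlDl ler_pdivlMr ?ltr0n// -rmorphB/=.
  rewrite -[K%:R]/(K%:Z%:~R) -rmorphM/= ler_int.
  have -> : g * (a + m)%N%:Z + h - (g * a%:Z + h) = g * m%:Z by rewrite PoszD; ring.
  rewrite -mulrA mulrC [m%:Z * _]mulrC -PoszM.
  apply: (@le_trans _ _ (g * a%:Z)); last by rewrite lerDl ltW.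
  by rewrite [X in X <= _]mulrC ler_pM2l// lez_nat leq_mul2r kK orbT.
have g0' : (0 : R) < g%:~R by rewrite ltr0z.
have sab : (g * a%:Z + h)%:~R <= (g * (a + m)%N%:Z + h)%:~R :> R.
  by rewrite ler_int lerD2r ler_pM2l// lez_nat leq_addr.
set sa : R := (g * a%:Z + h)%:~R in len U L sa0 sab ratio.
set sb : R := (g * (a + m)%N%:Z + h)%:~R in len U L sb0 sab ratio.
set G : R := g%:~R in U L g0'.
clearbody sa sb r1 r2 lo hi G.
have lenE : hi - lo = m%:R * (sa^-1 * sb^-1).
  by rewrite len [a%:R + _]addrC addrK invfM.
set u := sa^-1 in lenE U L; set v := sb^-1 in lenE U L.
have u0 : 0 < u by rewrite invr_gt0.
have v0 : 0 < v by rewrite invr_gt0.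
have vu : v <= u by rewrite lef_pV2 ?posrE.
pose kap : R := K%:R^-1.
have kap0 : 0 < kap by rewrite invr_gt0 ltr0n.
have kap1 : kap <= 1 by rewrite invf_le1 ?ltr0n// ler1n.
have uv : u <= v * (1 + kap).
  rewrite -(ler_pM2r (mulr_gt0 sa0 sb0)) /u /v mulKf ?gt_eqF//.
  by rewrite mulrC mulrA mulfK ?gt_eqF.
rewrite -/kap in kx ky *.
pose c := kap * m%:R * v / (8 * (rho * x2 + 1)).
have rx : 0 < rho * x2 + 1 by rewrite ltr_wpDl// mulr_ge0// ltW.
have c0 : 0 < c by rewrite /c divr_gt0 ?mulr_gt0.
have b0 : 0 < u * (y2 * (1 - kap) - y1) / 2.
  by rewrite divr_gt0// mulr_gt0// subr_gt0.
have yv0 : 0 < y1 * v / 2 by rewrite divr_gt0// mulr_gt0.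
(* The three bounds keep the enlarged box in the positive quadrant, make the cost of [eta] at most a
   quarter of [kap * m * (u * v)], and keep the shrunk box nonempty. *)
have [eta eta0 [etay etac etab]] := exists_small yv0 c0 b0.
have yvk : y1 * u + 2 * eta <= y2 * v.
  have vk : u * (1 - kap) <= v.
    have : u * (1 - kap) <= v * (1 + kap) * (1 - kap) by rewrite ler_wpM2r// subr_ge0.
    have : 0 <= v * kap ^+ 2 by rewrite mulr_ge0 ?sqr_ge0// ltW.
    by rewrite (_ : v * (1 + kap) * (1 - kap) = v - v * kap ^+ 2); [lra|ring].
  have := ler_wpM2l (ltW y20) vk.
  move: etab; rewrite ler_pdivlMr//; lra.
have xvu : x1 * u <= x2 * v.
  have h1 := ler_wpM2l (ltW x10) uv.
  have h2 := ler_wpM2r (ltW v0) kx; lra.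
pose eps : R := kap * m%:R * (u * v) / 4.
have eps0 : 0 < eps by rewrite /eps divr_gt0// !mulr_gt0.
have X1 : 0 < x1 * v <= x2 * u.
  by rewrite mulr_gt0//=; apply: ler_pM => //; exact: ltW.
have Y1 : 0 < y1 * v - eta <= y2 * u + eta.
  have : y1 * v <= y2 * u by apply: ler_pM => //; exact: ltW.
  have : 0 < y1 * v by rewrite mulr_gt0.
  by move=> h1 h2; keep h1 h2 etay eta0; apply/andP; split; lra.
have X2 : 0 < x1 * u <= x2 * v by rewrite mulr_gt0.
have Y2 : 0 < y1 * u + eta <= y2 * v - eta.
  have : 0 < y1 * u by rewrite mulr_gt0.
  by move=> h1; keep h1 yvk eta0; apply/andP; split; lra.
have [TU TU1 hU] := rhoP adm X1 Y1 eps0.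
have [TL TL1 hL] := rhoP adm X2 Y2 eps0.
(* The last two terms secure the hypotheses [sb <= T * x1] and [G <= T * eta * (T * x1)] of the
   comparison. *)
exists (TU + TL + sb / x1 + G / (eta * x1)) => [|T hT].
  have : 0 <= sb / x1 by rewrite divr_ge0 ?ltW.
  have : 0 <= G / (eta * x1) by rewrite divr_ge0 ?mulr_ge0 ?ltW.
  by keep TU1 TL1; lra.
have hb : 0 <= sb / x1 by rewrite divr_ge0 ?ltW.
have hG : 0 <= G / (eta * x1) by rewrite divr_ge0 ?mulr_ge0 ?ltW.
have T1 : 1 <= T by keep hT TU1 TL1 hb hG; lra.
have T0 : 0 < T by exact: lt_le_trans T1.
have sbT : sb <= T * x1 by rewrite -ler_pdivrMr//; keep hT TU1 TL1 hG; lra.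
have saT : sa <= T * x1 by exact: le_trans sbT.
have GT : G <= T * eta * (T * x1).
  have h1 : G <= T * (eta * x1) by rewrite -ler_pdivrMr ?mulr_gt0//; keep hT TU1 TL1 hb; lra.
  apply: le_trans h1 _; rewrite (_ : T * eta * (T * x1) = T * (T * (eta * x1))); last by ring.
  by rewrite ler_peMl// mulr_ge0 ?mulr_ge0 ?ltW.
have {}U := U eta T T0 GT sbT.
have {}L := L eta T T0 GT saT detM.
have {}hU := hU T ltac:(keep hT TU1 TL1 hb hG; lra).
have {}hL := hL T ltac:(keep hT TU1 TL1 hb hG; lra).
rewrite -(ler_nat R) -/(N lo hi T) in U; rewrite -(ler_nat R) -/(N lo hi T) in L.
have F1 := box_ratio_upper v0 vu uv (introT andP (conj (ltW kap0) kap1)).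
have F2 := box_ratio_lower v0 vu uv (introT andP (conj (ltW kap0) kap1)) kx (ltW ky).
have etaR : rho * (2 * eta * (x2 * u)) <= kap * m%:R * (u * v) / 4.
  have : eta * (8 * (rho * x2 + 1)) <= kap * m%:R * v.
    by rewrite -ler_pdivlMr// mulr_gt0.
  move=> h1; have h2 : 2 * eta * (rho * x2) <= kap * m%:R * v / 4 by keep h1 eta0; lra.
  by have h3 := ler_wpM2r (ltW u0) h2; keep h3; lra.
have T20 : 0 <= T ^+ 2 by exact: sqr_ge0.
pose B := (x2 - x1) * (y2 - y1).
have densE : dens * (hi - lo) = rho * (u * v * B).
  by rewrite lenE /dens -/B /u /v; field; rewrite !gt_eqF.
have slopeE : cusp_slope / K%:R * (hi - lo) =
    rho * (u * v * (3 * kap * (x2 * y2))) + kap * m%:R * (u * v).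
  have hs (ka w : R) : (3 * (rho / m%:R) * (x2 * y2) + 1) * ka * (m%:R * w) =
      rho * (w * (3 * ka * (x2 * y2))) + ka * m%:R * w by field; rewrite gt_eqF.
  by rewrite lenE; exact: hs.
rewrite slopeE densE.
have xun : 0 <= x2 * u - x1 * v by rewrite subr_ge0; case/andP: X1.
have up : rho * ((x2 * u - x1 * v) * (y2 * u + eta - (y1 * v - eta))) <=
    rho * (u * v * B) + rho * (u * v * (3 * kap * (x2 * y2))) + eps.
  have h1 := ler_wpM2l rho0 F1.
  have h2 : rho * (2 * eta * (x2 * u - x1 * v)) <= rho * (2 * eta * (x2 * u)).
    rewrite ler_wpM2l// ler_wpM2l//; first by rewrite mulr_ge0// ltW.
    by rewrite lerBlDr lerDl mulr_ge0 ?ltW.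
  by rewrite /eps /B; keep h1 h2 etaR; lra.
have lo' : rho * (u * v * B) - rho * (u * v * (3 * kap * (x2 * y2))) - eps <=
    rho * ((x2 * v - x1 * u) * (y2 * v - eta - (y1 * u + eta))).
  have h1 := ler_wpM2l rho0 F2.
  have h2 : rho * (2 * eta * (x2 * v - x1 * u)) <= rho * (2 * eta * (x2 * u)).
    rewrite ler_wpM2l// ler_wpM2l//; first by rewrite mulr_ge0// ltW.
    have k1 : x2 * v <= x2 * u by rewrite ler_pM2l.
    have k2 : 0 <= x1 * u by rewrite mulr_ge0 ?ltW.
    by keep k1 k2; lra.
  have h3 : 0 <= rho * (u * v * (kap * (x2 * y2))).
    by rewrite mulr_ge0// mulr_ge0 ?mulr_ge0 ?ltW.
  by rewrite /eps /B; keep h1 h2 h3 etaR; lra.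
have upT := ler_wpM2r T20 up; have loT := ler_wpM2r T20 lo'.
have epsT : 0 <= eps * T ^+ 2 by rewrite mulr_ge0// ltW.
have epsE : kap * m%:R * (u * v) = 4 * eps by rewrite /eps; field.
rewrite epsE.
move: hU hL; rewrite !ler_norml => /andP[_ hU] /andP[hL _].
by keep U L upT loT hU hL epsT; apply/andP; split; lra.
Qed.

End NearDensity.

(** * Farey induction *)

(** A property of the left end is carried along the mediant construction, so that facts on Farey
    fractions follow by induction: when the left end changes, it moves from [p / q] to the
    mediant. *)
Lemma farey_cover (R : realType) (P : int -> int -> Prop) :
  (forall n : nat, P n%:Z 1) ->
  (forall p q p' q' : int, 0 < q -> 0 < q' -> p' * q - p * q' = 1 ->
     P p q -> P (p + p') (q + q')) ->
  forall (n : nat) (xi : R), 0 <= xi -> exists p q p' q' : int,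
  [/\ p' * q - p * q' = 1, 0 < q <= n.+1%:Z, 0 < q' <= n.+1%:Z,
      n.+1%:Z < q + q' & p%:~R <= xi * q%:~R /\ xi * q'%:~R < p'%:~R /\ P p q].
Proof.
move=> P1 Pmed; elim=> [|n IH] xi xi0.
  have f0 : 0 <= Num.floor xi by rewrite floor_ge_int.
  exists (Num.floor xi), 1, (Num.floor xi + 1), 1; split => //.
    by rewrite !mulr1 addrAC subrr add0r.
  rewrite !mulr1; have /andP[h1 h2] := floor_itv xi; do 2 split => //.
  by rewrite -(gez0_abs f0); exact: P1.
have [p [q [p' [q' [d /andP[q0 qn] /andP[q0' qn'] s [h1 [h2 h3]]]]]]] := IH xi xi0.
have [big|small] := ltP n.+2%:Z (q + q').
  exists p, q, p', q'; split => //; apply/andP; split => //; move: qn qn'; clear; lia.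
have [lt|ge] := ltP (xi * (q + q')%:~R) ((p + p')%:~R).
  exists p, q, (p + p'), (q + q'); split => //.
  - by rewrite -d; ring.
  - by apply/andP; split => //; move: qn; clear; lia.
  - by apply/andP; split; move: q0 q0' small; clear; lia.
  - by move: q0 q0' s; clear; lia.
exists (p + p'), (q + q'), p', q'; split => //.
- by rewrite -d; ring.
- by apply/andP; split; move: q0 q0' small; clear; lia.
- by apply/andP; split => //; move: qn'; clear; lia.
- by move: q0 q0' s; clear; lia.
- by do 2 split => //; exact: Pmed h3.
Qed.

(* nd s t eps reads: the count in [s, t[ has the right density up to eps.  Near a
   cusp the relative error is C1 / K; the mediant structure of Farey intervals
   makes the error tend to 0 on every interval. *)
Section FareyInduction.
Variables (R : realType) (m K0 : nat) (nd : R -> R -> R -> Prop) (C0 C1 : R).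
Hypothesis m_gt0 : (0 < m)%N.
Hypotheses (C00 : 0 <= C0) (C10 : 0 <= C1).
Hypothesis nd_le : forall s t e1 e2, e1 <= e2 -> nd s t e1 -> nd s t e2.
Hypothesis nd_add : forall s t u e1 e2, s <= t -> t <= u ->
  nd s t e1 -> nd t u e2 -> nd s u (e1 + e2).
Hypothesis nd_sub : forall s t u e1 e2, s <= t -> t <= u ->
  nd s u e1 -> nd s t e2 -> nd t u (e1 + e2).
Hypothesis nd_crude : forall s t, s <= t -> nd s t (C0 * (t - s)).
Hypothesis nd_cusp : forall (e f g h sg : int) (K k : nat),
  0 < g -> 0 < h -> e * h - f * g = sg -> (sg == 1) || (sg == -1) ->
  (0 < K)%N -> (K0 <= K)%N -> (K <= k)%N ->
  let lo := cusp_lo R e f g h sg (k * m) (k * m + m) in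
  let hi := cusp_hi R e f g h sg (k * m) (k * m + m) in
  nd lo hi (C1 / K%:R * (hi - lo)).

Let le_of_eq (x y : R) : x = y -> x <= y. Proof. by move=> ->. Qed.

Section Cusp.
Variables (e f g h sg : int).
Hypotheses (g0 : 0 < g) (h0 : 0 < h) (det_sg : e * h - f * g = sg)
  (sg1 : (sg == 1) || (sg == -1)).

Let lo := cusp_lo R e f g h sg.
Let hi := cusp_hi R e f g h sg.
Let pt := cusp_pt R e f g h.
Let ndc i j eps := nd (lo i j) (hi i j) eps.

(** Errors proportional to the length add up; for [sg = -1] the pieces come in reverse order. *)
Lemma cusp_chain (d : R) (st a b : nat) : (a <= b)%N ->
  (forall k, (a <= k < b)%N -> ndc (k * st) (k * st + st)
     (d * (hi (k * st) (k * st + st) - lo (k * st) (k * st + st)))) ->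
  ndc (a * st) (b * st) (d * (hi (a * st) (b * st) - lo (a * st) (b * st))).
Proof.
elim: b => [|b IH].
  rewrite leqn0 => /eqP -> _; rewrite /ndc.
  have -> : hi (0 * st) (0 * st) = lo (0 * st) (0 * st).
    by rewrite /hi /lo /cusp_hi /cusp_lo; case: ifP.
  by have := nd_crude (lexx (lo (0 * st) (0 * st))); rewrite subrr !mulr0.
rewrite leq_eqVlt => /orP[/eqP -> _|].
  rewrite /ndc.
  have -> : hi (b.+1 * st) (b.+1 * st) = lo (b.+1 * st) (b.+1 * st).
    by rewrite /hi /lo /cusp_hi /cusp_lo; case: ifP.
  by have := nd_crude (lexx (lo (b.+1 * st) (b.+1 * st))); rewrite subrr !mulr0.
rewrite ltnS => ab hk.
have h1 : ndc (a * st) (b * st) (d * (hi (a * st) (b * st) - lo (a * st) (b * st))).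
  by apply: IH => // k /andP[ak kb]; apply: hk; rewrite ak ltnS ltnW.
have h2 := hk b; rewrite ab ltnSn in h2; have {}h2 := h2 isT.
have -> : (b.+1 * st = b * st + st)%N by rewrite mulSn addnC.
have l1 : lo (a * st) (b * st) <= hi (a * st) (b * st).
  by apply: (cusp_lo_le_hi R g0 h0 det_sg sg1); rewrite leq_mul2r ab orbT.
have l2 : lo (b * st) (b * st + st) <= hi (b * st) (b * st + st).
  by apply: (cusp_lo_le_hi R g0 h0 det_sg sg1); rewrite leq_addr.
move: h1 h2 l1 l2; rewrite /ndc /lo /hi /cusp_lo /cusp_hi; case: ifP => _ h1 h2 l1 l2.
  have := nd_add l1 l2 h1 h2; apply: nd_le; rewrite -mulrDr.
  by apply: le_of_eq; congr (_ * _); ring.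
have := nd_add l2 l1 h2 h1; apply: nd_le; rewrite -mulrDr.
by apply: le_of_eq; congr (_ * _); ring.
Qed.

Let pinf : R := e%:~R / g%:~R.

Lemma cusp_pt_inf (i : nat) :
  sg%:~R * (pinf - pt i) = (g%:~R * (g * i%:Z + h)%:~R)^-1.
Proof.
have d0 := cusp_den_gt0 R g0 h0 i; have g0' : (0 : R) < g%:~R by rewrite ltr0z.
have sg2 : sg%:~R * sg%:~R = 1 :> R by rewrite -intrM (sg_sqr sg1).
have E : pinf - pt i = sg%:~R * (g%:~R * (g * i%:Z + h)%:~R)^-1.
  rewrite /pinf /pt /cusp_pt -det_sg; move: d0.
  rewrite !rmorphD/= rmorphN !rmorphM/= => d0.
  by field; rewrite !gt_eqF.
by rewrite E mulrA sg2 mul1r.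
Qed.

Let tlo (x y : R) := if sg == 1 then x else y.
Let thi (x y : R) := if sg == 1 then y else x.

(** The tile between [pt 0] and the cusp is cut at [pt (K * m)] and [pt (K' * m)]. The first piece
    consists of tiles with relative error [C + del], the second obeys [nd_cusp], and the third is so
    short that the crude bound costs only [C0 / K] of what lies beyond the first. As [g <= h], that
    remainder is at least [1 / (K * m + 1)] of the tile, and it is free of [del]; hence the
    contraction factor. *)
Lemma cusp_step (K : nat) (del : R) : (0 < K)%N -> (K0 <= K)%N -> g <= h ->
  0 <= del ->
  let C := (C1 + C0) / K%:R in
  (forall i : nat, ndc i i.+1 ((C + del) * (hi i i.+1 - lo i i.+1))) ->
  nd (tlo (pt 0) pinf) (thi (pt 0) pinf)
    ((C + del * (1 - ((K * m)%:R + 1)^-1)) / (g%:~R * h%:~R)).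
Proof.
move=> K1 KK gh del0 C IH.
(* This makes the denominator at [pt (K' * m)] at least [K] times that at [pt (K * m)], so the
   distance to the cusp drops by a factor [K]. *)
pose K' := (K * K + K * `|h|)%N.
have KK' : (K <= K')%N.
  by rewrite (leq_trans _ (leq_addr _ _))// leq_pmulr.
have c1 : ndc 0 (K * m) ((C + del) * (hi 0 (K * m) - lo 0 (K * m))).
  have := @cusp_chain (C + del) 1 0 (K * m) (leq0n _); rewrite !muln1; apply.
  by move=> k _; rewrite muln1 addn1; exact: IH.
have c2 : ndc (K * m) (K' * m)
    (C1 / K%:R * (hi (K * m) (K' * m) - lo (K * m) (K' * m))).
  apply: cusp_chain => // k /andP[Kk _].
  exact: (nd_cusp g0 h0 det_sg sg1 K1 KK Kk).
have KR : (0 : R) < K%:R by rewrite ltr0n.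
have X0 := cusp_pt_inf 0; have Y0 := cusp_pt_inf (K * m).
have Z0 := cusp_pt_inf (K' * m).
have g0' : (0 : R) < g%:~R by rewrite ltr0z.
have h0' : (0 : R) < h%:~R by rewrite ltr0z.
have dY := cusp_den_gt0 R g0 h0 (K * m); have dZ := cusp_den_gt0 R g0 h0 (K' * m).
rewrite mulr0 add0r in X0.
set X := _ * (pinf - pt 0) in X0; set Y := _ * (pinf - pt (K * m)) in Y0.
set Z := _ * (pinf - pt (K' * m)) in Z0.
have Zp : 0 < Z by rewrite Z0 invr_gt0 mulr_gt0.
have YX : Y <= X.
  rewrite X0 Y0 lef_pV2 ?posrE ?mulr_gt0// ler_pM2l// ler_int.
  by rewrite lerDr mulr_ge0// ltW.
have ZY : Z <= Y / K%:R.
  rewrite Z0 Y0 -invfM lef_pV2 ?posrE ?mulr_gt0// -mulrA ler_pM2l//.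
  rewrite -[K%:R]/(K%:Z%:~R) -intrM ler_int mulrDl /K'.
  have hh : h = `|h|%N%:Z by rewrite gez0_abs// ltW.
  have h1 : h * K%:Z <= g * (K * `|h|)%N%:Z * m%:Z.
    rewrite PoszM -hh mulrC; have w0 : 0 <= K%:Z * h by rewrite mulr_ge0// ltW.
    apply: (@le_trans _ _ (g * (K%:Z * h))); first by rewrite ler_peMl// -gtz0_ge1.
    by rewrite ler_peMr ?mulr_ge0// ltW.
  have h2 : g * (K * m)%N%:Z * K%:Z = g * (K * K)%N%:Z * m%:Z.
    by rewrite !PoszM; ring.
  rewrite h2 mulnDl PoszD mulrDr !PoszM !mulrA.
  rewrite !PoszM !mulrA in h1.
  by rewrite -addrA lerD2l (le_trans h1)// lerDl ltW.
have kX : ((K * m)%:R + 1)^-1 * X <= Y.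
  have km0 : (0 : R) < (K * m)%:R + 1 by rewrite ltr_wpDl.
  rewrite X0 Y0 -invfM lef_pV2 ?posrE ?mulr_gt0//.
  rewrite mulrCA ler_pM2l// rmorphD/= mulrDl mul1r lerD2r rmorphM/= mulrC.
  by apply: ler_wpM2l; rewrite ?ler_int.
have tot : (C + del) * (X - Y) + C1 / K%:R * (Y - Z) + C0 * Z <=
    (C + del * (1 - ((K * m)%:R + 1)^-1)) / (g%:~R * h%:~R).
  rewrite -X0; have h1 : C0 * Z <= C0 / K%:R * Y.
    by rewrite (_ : C0 / K%:R * Y = C0 * (Y / K%:R)); [exact: ler_wpM2l|ring].
  have h2 : 0 <= C1 / K%:R * Z.
    by apply: mulr_ge0; [apply: divr_ge0 => //; exact: ltW|exact: ltW].
  have h3 := ler_wpM2l del0 kX.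
  have CE : C = C1 / K%:R + C0 / K%:R by rewrite /C mulrDl.
  move: h1 h2; rewrite CE; move: (C1 / K%:R) (C0 / K%:R) (_^-1) h3 => a b k h3 h1 h2.
  by lra.
apply: nd_le tot _.
have Z0' : 0 <= Z := ltW Zp.
have l1 : lo 0 (K * m) <= hi 0 (K * m) by exact: (cusp_lo_le_hi R g0 h0 det_sg sg1).
have l2 : lo (K * m) (K' * m) <= hi (K * m) (K' * m).
  by apply: (cusp_lo_le_hi R g0 h0 det_sg sg1); rewrite leq_mul2r KK' orbT.
move: c1 c2 Z0' l1 l2; rewrite /ndc /X /Y /Z /tlo /thi /lo /hi /cusp_lo /cusp_hi.
rewrite -/pt; have [s1|s1] := boolP (sg == 1).
  rewrite (eqP s1) !mul1r subr_ge0 => c1 c2 l3 l1 l2.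
  have := nd_add (le_trans l1 l2) l3 (nd_add l1 l2 c1 c2) (nd_crude l3).
  by apply: nd_le; apply: le_of_eq; ring.
have sE : sg = -1 by move: sg1; rewrite (negbTE s1)/= => /eqP.
rewrite sE !mulN1r oppr_ge0 subr_le0 => c1 c2 l3 l1 l2.
have := nd_add l3 (le_trans l2 l1) (nd_crude l3) (nd_add l2 l1 c2 c1).
by apply: nd_le; apply: le_of_eq; ring.
Qed.

End Cusp.

(** All tiles are treated at once in the induction on [n], since the piece between [pt i] and
    [pt i.+1] is again a tile, with larger denominators; each step contracts the part of the error
    beyond [C]. *)
Lemma farey_tile_step (K : nat) (n : nat) : (0 < K)%N -> (K0 <= K)%N ->
  let C := (C1 + C0) / K%:R in
  forall p q p' q' : int, 0 < q -> 0 < q' -> p' * q - p * q' = 1 ->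
  nd (p%:~R / q%:~R) (p'%:~R / q'%:~R)
    ((C + C0 * (1 - ((K * m)%:R + 1)^-1) ^+ n) / (q%:~R * q'%:~R)).
Proof.
move=> K1 KK C; set kap : R := 1 - _.
have KR : (0 : R) < K%:R by rewrite ltr0n.
have kap0 : 0 <= kap by rewrite subr_ge0 invf_le1 ?lerDr// ltr_wpDl.
have Cge0 : 0 <= C by rewrite divr_ge0 ?addr_ge0// ltW.
have len (p q p' q' : int) : 0 < q -> 0 < q' -> p' * q - p * q' = 1 ->
    p'%:~R / q'%:~R - p%:~R / q%:~R = (q%:~R * q'%:~R)^-1 :> R.
  move=> q0 q0' /(congr1 (fun z : int => z%:~R : R)).
  rewrite rmorphB !rmorphM rmorph1/= => d.
  have a : (0 : R) < q%:~R by rewrite ltr0z.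
  have b : (0 : R) < q'%:~R by rewrite ltr0z.
  rewrite [RHS](_ : _ = (p'%:~R * q%:~R - p%:~R * q'%:~R) / (q%:~R * q'%:~R));
    last by rewrite d mul1r.
  by field; rewrite !gt_eqF.
elim: n => [|n IH] p q p' q' q0 q0' d.
  have h : p%:~R / q%:~R <= p'%:~R / q'%:~R :> R.
    rewrite -subr_ge0 len// invr_ge0 mulr_ge0// ler0z ltW//.
  have := nd_crude h; apply: nd_le; rewrite len// expr0 mulr1 ler_wpM2r//.
    by rewrite invr_ge0 mulr_ge0// ler0z ltW.
  by rewrite lerDr.
have del0 : 0 <= C0 * kap ^+ n by rewrite mulr_ge0// exprn_ge0.
rewrite exprSr mulrA.
(* The end with the smaller denominator serves as the cusp, which gives [g <= h]; when it is the
   left end the determinant is -1. *)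
have [q'q|qq'] := leP q' q.
  have det : p' * q - p * q' = 1 by [].
  have := @cusp_step p' p q' q 1 q0' q0 d isT K _ K1 KK q'q del0.
  rewrite /= /cusp_pt !mulr0 !add0r [q'%:~R * q%:~R]mulrC; apply => i.
  rewrite /cusp_lo /cusp_hi/= /cusp_pt.
  have a : 0 < q' * i%:Z + q by rewrite ltr_wpDl// mulr_ge0// ltW.
  have b : 0 < q' * i.+1%:Z + q by rewrite ltr_wpDl// mulr_ge0// ltW.
  have e : (p' * i.+1%:Z + p) * (q' * i%:Z + q) -
      (p' * i%:Z + p) * (q' * i.+1%:Z + q) = 1.
    by rewrite -det -[i.+1]addn1 PoszD; ring.
  by rewrite len//; exact: IH.
have det : p * q' - p' * q = -1 by rewrite -opprB d.
have := @cusp_step p p' q q' (-1) q0 q0' det isT K _ K1 KK (ltW qq') del0.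
rewrite /= /cusp_pt !mulr0 !add0r; apply => i.
rewrite /cusp_lo /cusp_hi/= /cusp_pt.
have a : 0 < q * i%:Z + q' by rewrite ltr_wpDl// mulr_ge0// ltW.
have b : 0 < q * i.+1%:Z + q' by rewrite ltr_wpDl// mulr_ge0// ltW.
have e : (p * i%:Z + p') * (q * i.+1%:Z + q') -
    (p * i.+1%:Z + p') * (q * i%:Z + q') = 1.
  by rewrite -d -[i.+1]addn1 PoszD; ring.
by rewrite len//; exact: IH.
Qed.

Lemma exists_expr_lt (x eps : R) : 0 <= x < 1 -> 0 < eps -> exists n : nat, x ^+ n < eps.
Proof.
move=> /andP[x0 x1] e0; have nx : `|x| < 1 by rewrite ger0_norm.
have /cvgr0_norm_lt /(_ _ e0)[n _ /(_ n (leqnn n))] := cvg_expr nx.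
by rewrite ger0_norm ?exprn_ge0// => h; exists n.
Qed.

(** [K] is fixed first, to make [C] small, and [n] afterwards, because the contraction factor
    depends on [K]. *)
Lemma farey_tile_limit (p q p' q' : int) (eps : R) :
  0 < q -> 0 < q' -> p' * q - p * q' = 1 -> 0 < eps ->
  nd (p%:~R / q%:~R) (p'%:~R / q'%:~R) eps.
Proof.
move=> q0 q0' d e0.
have [K K1 KP] := exists_nat_gt ((C1 + C0) / (eps / 2)).
pose K' := (K + K0)%N; have K'1 : (0 < K')%N by rewrite ltn_addr.
have k0 : (0 : R) < ((K' * m)%:R + 1)^-1 by rewrite invr_gt0 ltr_wpDl.
have kb : 0 <= (1 - ((K' * m)%:R + 1)^-1 : R) < 1.
  apply/andP; split; last by lra.
  by rewrite subr_ge0 invf_le1 ?lerDr// ltr_wpDl.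
have e1 : 0 < eps / 2 / (C0 + 1) by rewrite !divr_gt0// ltr_wpDl.
have [n hn] := exists_expr_lt kb e1.
have := @farey_tile_step K' n K'1 (leq_addl _ _) p q p' q' q0 q0' d.
apply: nd_le.
set x := (1 - _) in kb hn *.
have x0 : 0 <= x ^+ n by rewrite exprn_ge0//; case/andP: kb.
have h1 : C0 * x ^+ n <= eps / 2.
  move: hn; rewrite ltr_pdivlMr ?ltr_wpDl// => hn; lra.
have h2 : (C1 + C0) / K'%:R <= eps / 2.
  rewrite ler_pdivrMr ?ltr0n//; have e2 : 0 < eps / 2 by lra.
  move: KP; rewrite ltr_pdivrMr// => KP; apply: le_trans (ltW KP) _.
  by rewrite mulrC ler_pM2l// ler_nat leq_addr.
have q1 : (1 : R) <= q%:~R by rewrite ler1z -gtz0_ge1.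
have q1' : (1 : R) <= q'%:~R by rewrite ler1z -gtz0_ge1.
have qq : (1 : R) <= q%:~R * q'%:~R by have := ler_pM ler01 ler01 q1 q1'; rewrite mulr1.
rewrite ler_pdivrMr ?(lt_le_trans ltr01 qq)//.
apply: (@le_trans _ _ eps); first by lra.
by rewrite ler_peMr// ltW.
Qed.

(** A Farey fraction is reached from 0 through finitely many tiles. Between it and [x] the crude
    bound suffices, the Farey interval of large order around [x] being short. A general interval is
    the difference of two that start at 0. *)
Lemma near_density_limit (s t eps : R) : 0 <= s -> s <= t -> 0 < eps -> nd s t eps.
Proof.
move=> s0 st e0.
pose P (p q : int) := forall eps : R, 0 < eps -> nd 0 (p%:~R / q%:~R) eps /\ 0 <= p.
have P1 (n : nat) : P n%:Z 1.
  elim: n => [|n IH] e e1; split=> //.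
    have := nd_crude (lexx 0); rewrite subrr mulr0 mul0r; apply: nd_le; exact: ltW.
  have e2 : 0 < e / 2 by lra.
  have [h1 _] := IH _ e2; have := @farey_tile_limit n%:Z 1 n.+1%:Z 1 _ isT isT _ e2.
  have -> : n.+1%:Z * 1 - n%:Z * 1 = 1 by rewrite !mulr1 -addn1 PoszD addrAC subrr add0r.
  move=> /(_ erefl) h2; rewrite (_ : e = e / 2 + e / 2); last by lra.
  by apply: nd_add h1 h2; rewrite !divr1 ?ler0z// ler_int lez_nat.
have Pm (p q p' q' : int) : 0 < q -> 0 < q' -> p' * q - p * q' = 1 ->
    P p q -> P (p + p') (q + q').
  move=> q0 q0' d h e e1; have e2 : 0 < e / 2 by lra.
  have [h1 p0] := h _ e2.
  have qq : 0 < q + q' by rewrite addr_gt0.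
  have d' : (p + p') * q - p * (q + q') = 1 by rewrite -d; ring.
  have h2 := farey_tile_limit q0 qq d' e2.
  have a : (0 : R) < q%:~R by rewrite ltr0z.
  have b : (0 : R) < (q + q')%:~R by rewrite ltr0z.
  split.
    rewrite (_ : e = e / 2 + e / 2); last by lra.
    apply: nd_add h1 h2; first by rewrite divr_ge0 ?ler0z// ltW.
    rewrite ler_pdivrMr// mulrAC ler_pdivlMr// -!intrM ler_int.
    by rewrite -subr_ge0 d'.
  by rewrite addr_ge0//; have := mulr_ge0 p0 (ltW q0'); nia.
have lim0 (x e : R) : 0 <= x -> 0 < e -> nd 0 x e.
  move=> x0 e1; have e2 : 0 < e / 2 by lra.
  have [n n0 hn] := exists_nat_gt (C0 / (e / 2)).
  have [p [q [p' [q' [d /andP[q0 _] /andP[q0' _] sum [h1 [h2 h3]]]]]]] :=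
    farey_cover P1 Pm n x0.
  have [h p0] := h3 _ e2.
  have a : (0 : R) < q%:~R by rewrite ltr0z.
  have b : (0 : R) < q'%:~R by rewrite ltr0z.
  have px : p%:~R / q%:~R <= x by rewrite ler_pdivrMr.
  rewrite (_ : e = e / 2 + e / 2); last by lra.
  apply: nd_add (divr_ge0 _ (ltW a)) px h (nd_le _ (nd_crude px)); first by rewrite ler0z.
  have qq : n%:R <= q%:~R * q'%:~R :> R.
    rewrite -[n%:R]/(n%:Z%:~R) -intrM ler_int.
    by move: q0 q0' sum; clear; nia.
  have : x - p%:~R / q%:~R <= n%:R^-1.
    apply: (@le_trans _ _ (q%:~R * q'%:~R)^-1); last by rewrite lef_pV2 ?posrE ?mulr_gt0 ?ltr0n.
    have : x <= p'%:~R / q'%:~R by rewrite ler_pdivlMr// ltW.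
    have -> : (q%:~R * q'%:~R)^-1 = p'%:~R / q'%:~R - p%:~R / q%:~R :> R.
      move/(congr1 (fun z : int => z%:~R : R)): d.
      rewrite rmorphB !rmorphM rmorph1/= => d.
      rewrite [LHS](_ : _ = (p'%:~R * q%:~R - p%:~R * q'%:~R) / (q%:~R * q'%:~R));
        last by rewrite d mul1r.
      by field; rewrite !gt_eqF.
    by lra.
  move=> h4; apply: le_trans (ler_wpM2l C00 h4) _.
  by rewrite ler_pdivrMr ?ltr0n// mulrC -ler_pdivrMr// ltW.
have e2 : 0 < eps / 2 by lra.
rewrite (_ : eps = eps / 2 + eps / 2); last by lra.
by apply: nd_sub s0 st (lim0 _ _ (le_trans s0 st) e2) (lim0 _ _ s0 e2).
Qed.

End FareyInduction.

Lemma near_density_sub (R : realType) (m : nat) (m_gt0 : (0 < m)%N)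
  (x1 x2 y1 y2 : R) (M1 M2 M3 M4 : int) (rho s t u e1 e2 : R) :
  0 < x1 -> x1 < x2 -> 0 < y1 -> y1 < y2 -> s <= t -> t <= u ->
  near_density m x1 x2 y1 y2 M1 M2 M3 M4 rho s u e1 ->
  near_density m x1 x2 y1 y2 M1 M2 M3 M4 rho s t e2 ->
  near_density m x1 x2 y1 y2 M1 M2 M3 M4 rho t u (e1 + e2).
Proof.
move=> x10 x12 y10 y12 st tu [T1 T11 h1] [T2 T21 h2].
exists (T1 + T2) => [|T hT]; first by lra.
have T0 : 0 < T by lra.
have {}h1 := h1 T ltac:(lra); have {}h2 := h2 T ltac:(lra).
have := bases_add m_gt0 M1 M2 M3 M4 x10 x12 y10 y12 st tu T0.
set Nsu : R := (cnt _)%:R in h1 *; set Nst : R := (cnt _)%:R in h2 *.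
set Ntu : R := (cnt _)%:R => E.
rewrite [X in `|X|](_ : _ = (Nsu - rho / m%:R * ((x2 - x1) * (y2 - y1)) * (u - s) * T ^+ 2) -
  (Nst - rho / m%:R * ((x2 - x1) * (y2 - y1)) * (t - s) * T ^+ 2)); last by rewrite E; ring.
by rewrite [X in _ <= X]mulrDl; apply: le_trans (ler_normB _ _) _; exact: lerD.
Qed.

Lemma bases_density (R : realType) (m : nat) : (0 < m)%N ->
  exists2 rho : R, 0 <= rho &
  forall (M1 M2 M3 M4 : int) (x1 x2 y1 y2 s t eps : R),
  (m %| M3 * M2 - M1 * M4 - 1)%Z ->
  0 < x1 -> x1 < x2 -> 0 < y1 -> y1 < y2 -> 0 <= s -> s <= t -> 0 < eps ->
  exists2 T0, 1 <= T0 & forall T, T0 <= T ->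
    `|(cnt (bases m x1 x2 y1 y2 M1 M2 M3 M4 s t T))%:R
      - rho * ((x2 - x1) * (y2 - y1)) * (t - s) * T ^+ 2| <= eps * T ^+ 2.
Proof.
move=> m_gt0; have [rho rho0 rhoP] := @pairs_density R m m_gt0.
exists (rho / m%:R) => [|M1 M2 M3 M4 x1 x2 y1 y2 s t eps detM x10 x12 y10 y12 s0 st e0].
  by rewrite divr_ge0.
have dx : 0 < x2 - x1 by rewrite subr_gt0.
have dy : 0 < y2 - y1 by rewrite subr_gt0.
(* [Kx] and [Ky] secure the two conditions of [near_density_cusp], which keep the shrunk box
   nonempty. *)
have [Kx Kx0 hKx] := exists_nat_gt (x1 / (x2 - x1)).
have [Ky Ky0 hKy] := exists_nat_gt (y2 / (y2 - y1)).
apply: (@near_density_limit R m (Kx + Ky) (near_density m x1 x2 y1 y2 M1 M2 M3 M4 rho)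
  (crude_slope m x1 x2 y1 y2 rho) (cusp_slope m x2 y2 rho)) => //.
- exact: crude_slope_ge0.
- rewrite /cusp_slope addr_ge0// mulr_ge0//; first by rewrite mulr_ge0// divr_ge0.
  by rewrite mulr_ge0// ltW//; [exact: lt_trans x12|exact: lt_trans y12].
- by move=> s' t' e1 e2; exact: near_density_le.
- by move=> s' t' u e1 e2; exact: near_density_add.
- by move=> s' t' u e1 e2; exact: near_density_sub.
- by move=> s' t'; exact: near_density_crude.
- move=> e f g h sg K k g0 h0 d sg1 K0 KK Kk.
  have KR : (0 : R) < K%:R by rewrite ltr0n.
  apply: near_density_cusp => //.
    rewrite mulrDr mulr1 -lerBrDl ler_pdivrMr// mulrC -ler_pdivrMr//.
    by apply: (le_trans (ltW hKx)); rewrite ler_nat (leq_trans _ KK)// leq_addr.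
  rewrite mulrBr mulr1 ltrBrDr -ltrBrDl ltr_pdivrMr// mulrC -ltr_pdivrMr//.
  by apply: (lt_le_trans hKy); rewrite ler_nat (leq_trans _ KK)// leq_addl.
Qed.

(** * Lebesgue measure of bounded sets *)

Section BoundedMeasure.
Variable R : realType.
Implicit Types (E A B : set R) (a b : R).

Definition bmeas E : Prop :=
  measurable (E : set (measurableTypeR R)) /\ exists M : R, E `<=` `[- M, M].

(** [fine] sends an infinite measure to 0, a case that [bmeas] excludes. *)
Definition lam E : R := fine (lebesgue_measure (E : set (measurableTypeR R))).

Lemma lebesgue_le_itv E a b : measurable (E : set (measurableTypeR R)) ->
  a <= b -> E `<=` `[a, b] -> (lebesgue_measure E <= (b - a)%:E)%E.
Proof.
move=> mE ab Eab.
have -> : (b - a)%:E = lebesgue_measure (`[a, b]%classic : set R).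
  rewrite lebesgue_measure_itv/= lte_fin; case: ltgtP ab => // -> _.
  by rewrite subrr.
apply: le_measure; [exact/mem_set|apply/mem_set|exact: Eab].
exact: measurable_itv.
Qed.

Lemma lamE E : bmeas E -> lebesgue_measure E = (lam E)%:E.
Proof.
move=> [mE [M EM]]; rewrite /lam fineK// ge0_fin_numE//.
apply: (@le_lt_trans _ _ ((`|M| - - `|M|)%:E)); last exact: ltry.
apply: lebesgue_le_itv => //; first by rewrite ge0_cp.
move=> x /EM/=; rewrite !in_itv/= => /andP[h1 h2]; apply/andP; split.
  by apply: le_trans h1; rewrite lerN2 ler_norm.
by apply: le_trans h2 _; rewrite ler_norm.
Qed.

Lemma bmeas_sub A B : measurable (A : set (measurableTypeR R)) -> A `<=` B ->
  bmeas B -> bmeas A.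
Proof. by move=> mA AB [_ [M BM]]; split => //; exists M; exact: subset_trans BM. Qed.

Lemma bmeas_itv E a b : measurable (E : set (measurableTypeR R)) ->
  E `<=` `[a, b] -> bmeas E.
Proof.
move=> mE Eab; split => //; exists (Num.max `|a| `|b|).
move=> x /Eab/=; rewrite !in_itv/= => /andP[h1 h2]; apply/andP; split.
  apply: le_trans h1; rewrite lerNl le_max; apply/orP; left.
  by rewrite -normrN ler_norm.
by apply: le_trans h2 _; rewrite le_max ler_norm orbT.
Qed.

Lemma lam_ge0 E : 0 <= lam E.
Proof. by rewrite /lam fine_ge0. Qed.

Lemma lam_itv_le E a b : measurable (E : set (measurableTypeR R)) ->
  a <= b -> E `<=` `[a, b] -> lam E <= b - a.
Proof.
move=> mE ab Eab; rewrite -lee_fin -lamE; first exact: lebesgue_le_itv.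
exact: bmeas_itv Eab.
Qed.

Lemma lam_le A B : measurable (A : set (measurableTypeR R)) -> bmeas B ->
  A `<=` B -> lam A <= lam B.
Proof.
move=> mA bB AB; have bA := bmeas_sub mA AB bB.
rewrite -lee_fin -!lamE//; apply: le_measure; [exact/mem_set|apply/mem_set|exact: AB].
by case: bB.
Qed.

Lemma lam_cover (I : choiceType) (D : set I) (F : I -> set R) E (w : I -> R) :
  measurable (E : set (measurableTypeR R)) -> finite_set D ->
  (forall i, D i -> bmeas (F i)) -> (forall i, D i -> lam (F i) <= w i) ->
  (E `<=` \bigcup_(i in D) F i) -> lam E <= \sum_(i <- fset_set D) w i.
Proof.
move=> mE fD bF Fw EF.
have h : (lebesgue_measure E <= (\sum_(i <- fset_set D) w i)%:E)%E.
  apply: le_trans (content_sub_fsum _ fD _ mE EF) _.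
    by move=> i Di; case: (bF i Di).
  rewrite fsbig_finite// -sumEFin big_seq [X in (_ <= X)%E]big_seq.
  apply: lee_sum => i; rewrite in_fset_set// => /set_mem Di.
  rewrite -[X in (X <= _)%E]/(lebesgue_measure (F i)) (lamE (bF i Di)) lee_fin.
  exact: Fw.
rewrite /lam -lee_fin fineK// ge0_fin_numE//.
exact: (le_lt_trans h (ltry _)).
Qed.

Lemma lam_packing (I : choiceType) (D : set I) (F : I -> set R) E (w : I -> R) :
  bmeas E -> finite_set D -> trivIset D F ->
  (forall i, D i -> measurable (F i : set (measurableTypeR R))) ->
  (forall i, D i -> w i <= lam (F i)) ->
  (forall i, D i -> F i `<=` E) -> \sum_(i <- fset_set D) w i <= lam E.
Proof.
move=> bE fD tF mF Fw FE; rewrite -lee_fin -(lamE bE).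
apply: (@le_trans _ _ (lebesgue_measure (\bigcup_(i in D) F i))).
  rewrite measure_fin_bigcup// fsbig_finite// -sumEFin big_seq [X in (_ <= X)%E]big_seq.
  apply: lee_sum => i; rewrite in_fset_set// => /set_mem Di.
  rewrite -[X in (_ <= X)%E]/(lebesgue_measure (F i)).
  by rewrite (lamE (bmeas_sub (mF i Di) (FE i Di) bE)) lee_fin; exact: Fw.
apply: le_measure; [apply/mem_set|apply/mem_set|].
- by apply: fin_bigcup_measurable.
- by case: bE.
- by move=> x [i Di Fx]; exact: FE Fx.
Qed.

Lemma sum_fset_const (I : choiceType) (D : set I) (c : R) :
  \sum_(i <- fset_set D) c = (cnt D)%:R * c.
Proof. by rewrite big_const_seq count_predT iter_addr_0 mulr_natl. Qed.

Lemma lam_cover_const (I : choiceType) (D : set I) (F : I -> set R) E (w : R) :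
  measurable (E : set (measurableTypeR R)) -> finite_set D ->
  (forall i, D i -> bmeas (F i)) -> (forall i, D i -> lam (F i) <= w) ->
  (E `<=` \bigcup_(i in D) F i) -> lam E <= (cnt D)%:R * w.
Proof.
by move=> mE fD bF Fw EF; rewrite -sum_fset_const; exact: lam_cover EF.
Qed.

Lemma lam_packing_const (I : choiceType) (D : set I) (F : I -> set R) E (w : R) :
  bmeas E -> finite_set D -> trivIset D F ->
  (forall i, D i -> measurable (F i : set (measurableTypeR R))) ->
  (forall i, D i -> w <= lam (F i)) ->
  (forall i, D i -> F i `<=` E) -> (cnt D)%:R * w <= lam E.
Proof.
by move=> bE fD tF mF Fw FE; rewrite -sum_fset_const; exact: lam_packing FE.
Qed.

Lemma sum_fset_fin (I : finType) (P : pred I) (w : I -> R) :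
  \sum_(i <- fset_set [set i | P i]) w i = \sum_(i | P i) w i.
Proof.
rewrite -[RHS]big_filter; apply: perm_big; apply: uniq_perm.
- exact: fset_uniq.
- by rewrite filter_uniq// index_enum_uniq.
move=> i; rewrite in_fset_set; last exact: finite_finset.
by rewrite mem_filter mem_index_enum andbT; apply/idP/idP => [/set_mem|/mem_set].
Qed.

Lemma lam_cover_fin (I : finType) (P : pred I) (F : I -> set R) E (w : I -> R) :
  measurable (E : set (measurableTypeR R)) ->
  (forall i, P i -> bmeas (F i)) -> (forall i, P i -> lam (F i) <= w i) ->
  (forall x, E x -> exists2 i, P i & F i x) -> lam E <= \sum_(i | P i) w i.
Proof.
move=> mE bF Fw EF; rewrite -sum_fset_fin.
by apply: (lam_cover (F := F)) => //; exact: finite_finset.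
Qed.

Lemma lam_packing_fin (I : finType) (P : pred I) (F : I -> set R) E (w : I -> R) :
  bmeas E -> (forall i j x, P i -> P j -> F i x -> F j x -> i = j) ->
  (forall i, P i -> measurable (F i : set (measurableTypeR R))) ->
  (forall i, P i -> w i <= lam (F i)) ->
  (forall i, P i -> F i `<=` E) -> \sum_(i | P i) w i <= lam E.
Proof.
move=> bE tF mF Fw FE; rewrite -sum_fset_fin.
apply: (lam_packing (F := F)) => //; first exact: finite_finset.
by move=> i j /= Pi Pj [x [Fi Fj]]; exact: tF Fi Fj.
Qed.

Lemma lam_cover2 E A B : measurable (E : set (measurableTypeR R)) -> bmeas A ->
  bmeas B -> E `<=` A `|` B -> lam E <= lam A + lam B.
Proof.
move=> mE bA bB EAB.
have -> : lam A + lam B = \sum_(i : bool) lam (if i then A else B).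
  by rewrite big_bool.
apply: (lam_cover_fin (F := fun i : bool => if i then A else B)) => //.
- by case.
- by move=> x /EAB[Ax|Bx]; [exists true|exists false].
Qed.

Definition affine_inv (b c x : R) : R := (x - b) / c.

Lemma measurable_affine_inv (b c : R) :
  measurable_fun setT (affine_inv b c : measurableTypeR R -> measurableTypeR R).
Proof.
apply: measurable_funM; last exact: measurable_cst.
by apply: measurable_funB; [exact: measurable_id|exact: measurable_cst].
Qed.

(** The pushforward of Lebesgue measure under [affine_inv b c], divided by [c], has the right value
    on half-open intervals, so by uniqueness it is Lebesgue measure. *)
Lemma lam_affine (b c : R) (A : set R) : 0 < c -> bmeas A ->
  lam [set x | A (affine_inv b c x)] = c * lam A.
Proof.
move=> c0 bA; have c1 : 0 <= c^-1 by rewrite invr_ge0 ltW.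
pose phi : measurableTypeR R -> measurableTypeR R := affine_inv b c.
have mphi : measurable_fun setT phi by exact: measurable_affine_inv.
have h := @lebesgue_measure_unique R (@mscale _ (measurableTypeR R) R (NngNum c1)
  (@pushforward _ _ (measurableTypeR R) (measurableTypeR R) R lebesgue_measure phi)).
have {}h := h mphi.
have e : lebesgue_measure A = (c^-1%:E * lebesgue_measure (affine_inv b c @^-1` A))%E.
  apply: h; last by case: bA.
  move=> _ [[x y] _ <-]; rewrite -[RHS]/(c^-1%:E * lebesgue_measure (phi @^-1` `]x, y]))%E.
  have -> : phi @^-1` `]x, y] = `]c * x + b, c * y + b]%classic.
    apply/seteqP; split => z /=; rewrite !in_itv/= /phi /affine_inv ltr_pdivlMr// ler_pdivrMr//.
      by move=> /andP[h1 h2]; apply/andP; split; lra.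
    by move=> /andP[h1 h2]; apply/andP; split; lra.
  rewrite !lebesgue_measure_itv/= !lte_fin ltrD2r ltr_pM2l//.
  case: ifP => _; last by rewrite mule0.
  by rewrite -!EFinD -EFinM; congr (_%:E); field; rewrite gt_eqF.
have bB : bmeas [set x | A (affine_inv b c x)].
  case: bA => mA [M AM]; split.
    by rewrite -[X in measurable X]setTI; exact: measurable_affine_inv.
  exists (c * `|M| + `|b|) => x /AM /=; rewrite !in_itv/= /affine_inv.
  rewrite ler_pdivlMr// ler_pdivrMr// => /andP[h1 h2].
  have b1 := ler_norm b; have := ler_norm (- b); rewrite normrN => b2.
  have := ler_wpM2r (ltW c0) (ler_norm M).
  by move=> m1; apply/andP; split; lra.
move: e; rewrite (lamE bA) (lamE bB) -EFinM => -[->].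
by rewrite mulrA divff ?mul1r// gt_eqF.
Qed.

End BoundedMeasure.

(** * The approximation set inside a Farey tile *)

Section Tiles.
Variables (R : realType) (m : nat).
Hypothesis m_gt0 : (0 < m)%N.
Variable A : {set 'I_m * 'I_m}.

Definition inA (a q : int) : bool := (residuez m_gt0 a, residuez m_gt0 q) \in A.

Lemma inA_congr (a q a' q' : int) : (m %| a - a')%Z -> (m %| q - q')%Z ->
  inA a q = inA a' q'.
Proof.
have h (x x' : int) : (m %| x - x')%Z -> residuez m_gt0 x = residuez m_gt0 x'.
  move=> d; apply/residuezP.
  have d' := (residuezP m_gt0 x' (residuez m_gt0 x')).1 erefl.
  by apply: (dvdz_add d d'); rewrite addrA subrK.
by move=> /h ha /h hq; rewrite /inA ha hq.
Qed.

(* The paper's set is Sset 1 c alpha n; the parameters z1, z2, bet leave room for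
   slightly enlarged versions of it. *)
Definition Sset (z1 z2 bet : R) (n : nat) : set R :=
  [set xi | exists a q : int, [/\ coprimez a q, inA a q,
     n%:R * z1 <= q%:~R, q%:~R <= n%:R * z2 & `|q%:~R * xi - a%:~R| * q%:~R <= bet]].

(* Sset inside a tile, in the coordinate tau = (xi - p/q) q q' of the tile, for
   x = q/n, y = q'/n and (M1, M2, M3, M4) = (p, q, p', q') modulo m: the fraction
   with denominator z is i (p, q) + j (p', q'). *)
Definition Dset (x y z1 z2 bet : R) (M1 M2 M3 M4 : int) : set R :=
  [set tau | 0 <= tau < 1 /\ exists i j : int,
    [/\ coprimez i j, inA (i * M1 + j * M3) (i * M2 + j * M4),
     z1 <= i%:~R * x + j%:~R * y, i%:~R * x + j%:~R * y <= z2 &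
     `|(i%:~R * x + j%:~R * y) * tau - j%:~R * y| * (i%:~R * x + j%:~R * y)
       <= bet * (x * y)]].

Lemma measurable_abs_le (u v w z : R) :
  measurable ([set x | `|u * x - v| * w <= z] : set (measurableTypeR R)).
Proof.
pose f : measurableTypeR R -> measurableTypeR R := fun x => `|u * x - v| * w.
have mf : measurable_fun setT f.
  apply: measurable_funM; last exact: measurable_cst.
  apply: measurableT_comp => //; apply: measurable_funB; last exact: measurable_cst.
  by apply: measurable_funM; [exact: measurable_cst|exact: measurable_id].
have := mf measurableT _ (measurable_itv `]-oo, z]); rewrite setTI.
by congr measurable; apply/seteqP; split => x /=; rewrite in_itv.
Qed.

Lemma measurable_countable_exists (P : int -> int -> Prop) (F : int -> int -> set R) :
  (forall i j, measurable (F i j : set (measurableTypeR R))) ->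
  measurable ([set x | exists i j : int, P i j /\ F i j x] : set (measurableTypeR R)).
Proof.
move=> mF.
have -> : [set x | exists i j : int, P i j /\ F i j x] =
    \bigcup_(ij : int * int) (if `[< P ij.1 ij.2 >] then F ij.1 ij.2 else set0).
  apply/seteqP; split => x /=.
    by move=> [i [j [Pij Fx]]]; exists (i, j) => //=; rewrite asboolT.
  by move=> [[i j] _ /=]; case: asboolP => // Pij Fx; exists i, j.
apply: countable_bigcupT_measurable => [|[i j] /=]; first exact: countableP.
by case: ifP.
Qed.

Lemma measurable_Sset z1 z2 bet n :
  measurable (Sset z1 z2 bet n : set (measurableTypeR R)).
Proof.
rewrite (_ : Sset _ _ _ _ = [set xi | exists a q : int,
  [/\ coprimez a q, inA a q, n%:R * z1 <= q%:~R & q%:~R <= n%:R * z2] /\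
  `|q%:~R * xi - a%:~R| * q%:~R <= bet]).
  by apply: measurable_countable_exists => a q; exact: measurable_abs_le.
by apply/seteqP; split => x /= [a [q]]; [case=> ? ? ? ? ?|case=> -[? ? ? ?] ?]; exists a, q.
Qed.

Lemma Dset_itv x y z1 z2 bet M1 M2 M3 M4 :
  Dset x y z1 z2 bet M1 M2 M3 M4 `<=` `[0, 1].
Proof. by move=> t [/andP[t0 t1] _] /=; rewrite in_itv/= t0 ltW. Qed.

Lemma bmeas_Dset x y z1 z2 bet M1 M2 M3 M4 :
  bmeas (Dset x y z1 z2 bet M1 M2 M3 M4).
Proof.
apply: bmeas_itv (@Dset_itv _ _ _ _ _ _ _ _ _).
rewrite (_ : Dset _ _ _ _ _ _ _ _ _ = `[0, 1[%classic `&` [set t | exists i j : int,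
  [/\ coprimez i j, inA (i * M1 + j * M3) (i * M2 + j * M4),
     z1 <= i%:~R * x + j%:~R * y & i%:~R * x + j%:~R * y <= z2] /\
     `|(i%:~R * x + j%:~R * y) * t - j%:~R * y| * (i%:~R * x + j%:~R * y)
       <= bet * (x * y)]).
  apply: measurableI; first exact: measurable_itv.
  by apply: measurable_countable_exists => a q; exact: measurable_abs_le.
apply/seteqP; split => t /=; rewrite in_itv/=.
  by move=> [t01 [i [j [? ? ? ? ?]]]]; split=> //; exists i, j.
by move=> [t01 [i [j [[? ? ? ?] ?]]]]; split=> //; exists i, j.
Qed.

Definition tile (p q p' q' : int) : set R :=
  [set xi | p%:~R <= xi * q%:~R /\ xi * q'%:~R < p'%:~R].

Lemma unimodular_coprime (p q p' q' i j : int) : p' * q - p * q' = 1 ->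
  coprimez i j -> coprimez (i * p + j * p') (i * q + j * q').
Proof.
move=> d /coprimezP[[u v] /= uv]; apply/coprimezP.
exists (v * q - u * q', u * p' - v * p) => /=.
rewrite [LHS](_ : _ = (p' * q - p * q') * (u * i + v * j)); last by ring.
by rewrite d uv.
Qed.

Lemma tile_tau (p q p' q' : int) (xi : R) : 0 < q -> 0 < q' ->
  p' * q - p * q' = 1 ->
  let tau := affine_inv (p%:~R / q%:~R) (q%:~R * q'%:~R)^-1 xi in
  tile p q p' q' xi <-> 0 <= tau < 1.
Proof.
move=> q0 q0' d; rewrite /tile /affine_inv/= invrK.
have a : (0 : R) < q%:~R by rewrite ltr0z.
have b : (0 : R) < q'%:~R by rewrite ltr0z.
have dR : p'%:~R * q%:~R - p%:~R * q'%:~R = 1 :> R by rewrite -!intrM -rmorphB d.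
have -> : (xi - p%:~R / q%:~R) * (q%:~R * q'%:~R) =
    xi * q%:~R * q'%:~R - p%:~R * q'%:~R by field; rewrite gt_eqF.
rewrite -mulrBl; split => [[h1 h2]|/andP[h1 h2]].
  rewrite mulr_ge0 ?subr_ge0 ?(ltW b)//= mulrBl mulrAC.
  by have := ltr_pM2r a (xi * q'%:~R) p'%:~R; rewrite h2 => h3; lra.
split; first by move: h1; rewrite pmulr_lge0// subr_ge0.
by rewrite -(ltr_pM2r a); move: h2; rewrite mulrBl; lra.
Qed.

(** With [z = i * q + j * q'] and [a = i * p + j * p'], determinant 1 gives
    [(z * xi - a) * q * q' = z * tau - j * q']. The matrix being unimodular, coprime [(a, z)]
    correspond to coprime [(i, j)]. *)
Lemma tile_Sset (p q p' q' : int) (n : nat) (xi z1 z2 bet : R) M1 M2 M3 M4 :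
  0 < q -> 0 < q' -> (0 < n)%N -> 0 < z1 -> p' * q - p * q' = 1 ->
  (m %| p - M1)%Z -> (m %| q - M2)%Z -> (m %| p' - M3)%Z -> (m %| q' - M4)%Z ->
  (tile p q p' q' `&` Sset z1 z2 bet n) xi <->
  Dset (q%:~R / n%:R) (q'%:~R / n%:R) z1 z2 bet M1 M2 M3 M4
     (affine_inv (p%:~R / q%:~R) (q%:~R * q'%:~R)^-1 xi).
Proof.
move=> q0 q0' n0 z10 d c1 c2 c3 c4; rewrite /setI/= /Dset/=.
set tau := affine_inv _ _ _.
have a : (0 : R) < q%:~R by rewrite ltr0z.
have b : (0 : R) < q'%:~R by rewrite ltr0z.
have nR : (0 : R) < n%:R by rewrite ltr0n.
have dR : p'%:~R * q%:~R - p%:~R * q'%:~R = 1 :> R by rewrite -!intrM -rmorphB d.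
have zE (i j : int) : i%:~R * (q%:~R / n%:R) + j%:~R * (q'%:~R / n%:R) =
    (i * q + j * q')%:~R / n%:R :> R.
  by rewrite rmorphD !rmorphM/=; ring.
have key (i j : int) : let z := (i * q + j * q')%:~R : R in
   `|z / n%:R * tau - j%:~R * (q'%:~R / n%:R)| * (z / n%:R) <=
     bet * (q%:~R / n%:R * (q'%:~R / n%:R)) <->
   `|z * xi - (i * p + j * p')%:~R| * z <= bet.
  move=> z.
  have -> : z / n%:R * tau - j%:~R * (q'%:~R / n%:R) =
     (z * xi - (i * p + j * p')%:~R) * (q%:~R * q'%:~R / n%:R).
    rewrite /tau /affine_inv invrK /z !rmorphD !rmorphM/=.
    have -> : p'%:~R = (1 + p%:~R * q'%:~R) / q%:~R :> R.
      by rewrite -[LHS](mulfK (lt0r_neq0 a)); congr (_ / _); lra.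
    by field; rewrite !gt_eqF.
  rewrite normrM (gtr0_norm (_ : 0 < q%:~R * q'%:~R / n%:R)); last first.
    by rewrite divr_gt0// mulr_gt0.
  have -> (e : R) : e * (q%:~R * q'%:~R / n%:R) * (z / n%:R) =
     (e * z) * (q%:~R / n%:R * (q'%:~R / n%:R)) by field; rewrite gt_eqF.
  by rewrite ler_pM2r// mulr_gt0// divr_gt0.
have cong (i j : int) : inA (i * M1 + j * M3) (i * M2 + j * M4) =
    inA (i * p + j * p') (i * q + j * q').
  have h (x y x' y' : int) : (m %| x - x')%Z -> (m %| y - y')%Z ->
      (m %| (i * x' + j * y') - (i * x + j * y))%Z.
    move=> /dvdzP[u eu] /dvdzP[v ev]; apply/dvdzP; exists (- (i * u + j * v)).
    rewrite [LHS](_ : _ = - (i * (x - x') + j * (y - y'))); last by ring.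
    by rewrite eu ev; ring.
  by apply: inA_congr; apply: h.
have T := tile_tau xi q0 q0' d; rewrite -/tau /= in T.
split=> [[tl [a0 [q1 [cop Aaq l1 l2 l3]]]]|[tau01 [i [j [cop Aij]]]]].
  split; first exact/T.
  pose i := p' * q1 - q' * a0; pose j := q * a0 - p * q1.
  have ea : i * p + j * p' = a0.
    by transitivity ((p' * q - p * q') * a0); [rewrite /i /j; ring|rewrite d mul1r].
  have eq : i * q + j * q' = q1.
    by transitivity ((p' * q - p * q') * q1); [rewrite /i /j; ring|rewrite d mul1r].
  exists i, j; rewrite !zE cong ea eq; split => //.
  - move/coprimezP : cop => [[u v] /= uv]; apply/coprimezP.
    exists (u * p + v * q, u * p' + v * q') => /=.
    by rewrite -uv -ea -eq; ring.
  - by rewrite ler_pdivlMr// mulrC.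
  - by rewrite ler_pdivrMr// mulrC.
  - by have := key i j; rewrite /= eq ea => k; apply/k.
rewrite !zE => l1 l2 /key l3; split; first exact/T.
exists (i * p + j * p'), (i * q + j * q'); split => //.
- exact: unimodular_coprime.
- by rewrite -cong.
- by rewrite [_ * z1]mulrC -ler_pdivlMr.
- by rewrite [_ * z2]mulrC -ler_pdivrMr.
Qed.

Lemma lam_tile_Sset (p q p' q' : int) (n : nat) (z1 z2 bet : R) M1 M2 M3 M4 :
  0 < q -> 0 < q' -> (0 < n)%N -> 0 < z1 -> p' * q - p * q' = 1 ->
  (m %| p - M1)%Z -> (m %| q - M2)%Z -> (m %| p' - M3)%Z -> (m %| q' - M4)%Z ->
  lam (tile p q p' q' `&` Sset z1 z2 bet n) =
  lam (Dset (q%:~R / n%:R) (q'%:~R / n%:R) z1 z2 bet M1 M2 M3 M4) / (q%:~R * q'%:~R).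
Proof.
move=> q0 q0' n0 z10 d c1 c2 c3 c4.
rewrite mulrC -(lam_affine (p%:~R / q%:~R) _ (bmeas_Dset _ _ _ _ _ _ _ _ _)).
  congr lam; apply/seteqP; split => xi /=;
    by move/(tile_Sset xi z2 bet q0 q0' n0 z10 d c1 c2 c3 c4).
by rewrite invr_gt0 mulr_gt0 ?ltr0z.
Qed.

End Tiles.

(** [w] is the rescaled denominator of a fraction and [e] its error at [(x, y)]; [w'] and [e'] are
    those at [(x', y')], moved by multiples of [H * kap]. The long factor of [kap] collects the
    cross terms of [e' * w'] and the change of [x * y]. *)
Lemma product_stable (R : realType)
  (b bet del eta H kap z2 w w' e e' x y x' y' : R) :
  0 <= b <= bet -> 0 < del -> 0 < eta -> 0 < H -> 0 < kap -> kap <= 1 ->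
  kap * (4 * bet * H + 3 * H * z2 + 6 * (H * H) + 2 * bet) <= del * (eta * eta) ->
  eta <= x' -> eta <= y' -> 0 <= y -> y <= 1 -> x' <= 1 ->
  `|x' - x| <= kap -> `|y' - y| <= kap ->
  0 <= w -> w <= z2 -> 0 <= e -> e <= 2 * bet -> e * w <= b * (x * y) ->
  w' <= w + 2 * (H * kap) -> 0 <= e' -> e' <= e + 3 * (H * kap) ->
  e' * w' <= (b + del) * (x' * y').
Proof.
move=> /andP[b0 bb] del0 eta0 H0 kap0 k1 k3 x0' y0' yp y1 x1' dx dy w0 wz e0 eb
  l3 ww e'0 ee'.
have Hk : 0 <= H * kap by rewrite mulr_ge0 ?ltW.
have s1 : e' * w' <= (e + 3 * (H * kap)) * (w + 2 * (H * kap)).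
  apply: (@le_trans _ _ (e' * (w + 2 * (H * kap)))); first by rewrite ler_wpM2l.
  by rewrite ler_wpM2r// addr_ge0// mulr_ge0.
have s2 : e * (H * kap) <= 2 * bet * (H * kap) by rewrite ler_wpM2r.
have s3 : (H * kap) * w <= (H * kap) * z2 by rewrite ler_wpM2l.
have s4 : (H * kap) * (H * kap) <= kap * (H * H).
  rewrite (_ : H * kap * (H * kap) = kap * kap * (H * H)); last by ring.
  rewrite ler_wpM2r ?mulr_ge0 ?(ltW H0)//.
  by have := ler_wpM2l (ltW kap0) k1; rewrite mulr1.
have s5 : x * y - 2 * kap <= x' * y'.
  have -> : x' * y' = x * y + x' * (y' - y) + y * (x' - x) by ring.
  move: dx dy; rewrite !ler_norml => /andP[dx1 dx2] /andP[dy1 dy2].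
  have x'p : 0 <= x' by exact: le_trans (ltW eta0) x0'.
  have h1 := ler_wpM2l x'p dy1; have h2 := ler_wpM2l yp dx1.
  have h3 := ler_wpM2r (ltW kap0) x1'; have h4 := ler_wpM2r (ltW kap0) y1.
  clear -h1 h2 h3 h4; lra.
have s6 : b * (x * y) <= b * (x' * y') + 2 * bet * kap.
  have h1 := ler_wpM2l b0 s5; have h2 := ler_wpM2r (ltW kap0) bb.
  clear -h1 h2; lra.
have s7 : del * (eta * eta) <= del * (x' * y').
  rewrite ler_wpM2l ?(ltW del0)//.
  by apply: ler_pM => //; exact: ltW.
clear -s1 s2 s3 s4 s6 s7 k3 l3; lra.
Qed.

(** * Perturbation of the sets inside a tile; uniqueness of the tile *)

Section Estimates.
Variables (R : realType) (m : nat).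
Hypothesis m_gt0 : (0 < m)%N.
Variable A : {set 'I_m * 'I_m}.

Let D := @Dset R m m_gt0 A.

(** The coefficients [i], [j] are bounded by [H]: [w * tau] lies between 0 and [z2], [j * y] is
    within [2 * bet] of it, and [x], [y] are at least [eta]. So moving [(x, y)] by [kap] changes
    each condition by a multiple of [kap], and the same [i], [j] and [tau] serve. *)
Lemma Dset_stable (z2 bet eta del : R) : 0 < z2 -> 0 < bet -> 0 < eta -> 0 < del ->
  exists2 k0 : R, 0 < k0 & forall kap, 0 < kap -> kap <= k0 ->
  forall x y x' y' z1 z b M1 M2 M3 M4, 2^-1 <= z1 -> z <= z2 -> 0 <= b <= bet ->
  eta <= x <= 1 -> eta <= y <= 1 -> eta <= x' <= 1 -> eta <= y' <= 1 ->
  `|x' - x| <= kap -> `|y' - y| <= kap ->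
  D x y z1 z b M1 M2 M3 M4 `<=` D x' y' (z1 - del) (z + del) (b + del) M1 M2 M3 M4.
Proof.
move=> z20 bet0 eta0 del0.
pose H := (2 * z2 + 2 * bet) / eta.
have H0 : 0 < H by rewrite divr_gt0// addr_gt0// mulr_gt0.
pose Q := 4 * bet * H + 3 * H * z2 + 6 * (H * H) + 2 * bet.
have Q0 : 0 < Q.
  have h1 : 0 < bet * H by rewrite mulr_gt0.
  have h2 : 0 < H * z2 by rewrite mulr_gt0.
  have h3 : 0 < H * H by rewrite mulr_gt0.
  by rewrite /Q; lra.
have [k0 k00 [k1 k2 k3]] := exists_small (@ltr01 R)
  (divr_gt0 del0 (mulr_gt0 (ltr0n R 2) H0))
  (divr_gt0 (mulr_gt0 del0 (mulr_gt0 eta0 eta0)) Q0).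
exists k0 => // kap kap0 kk0 x y x' y' z1 z b M1 M2 M3 M4 hz1 hz /andP[b0 bb].
move=> /andP[x0 x1] /andP[y0 y1] /andP[x0' x1'] /andP[y0' y1'] dx dy.
have {}k1 : kap <= 1 := le_trans kk0 k1.
have {}k2 : 2 * H * kap <= del.
  by have := le_trans kk0 k2; rewrite ler_pdivlMr; [lra|exact: mulr_gt0].
have {}k3 : kap * Q <= del * (eta * eta).
  by move: (le_trans kk0 k3); rewrite ler_pdivlMr.
move=> tau [/andP[t0 t1] [i [j [cop Aij]]]].
set w := i%:~R * x + j%:~R * y => l1 l2 l3.
have w0 : 2^-1 <= w by lra.
have xy1 : x * y <= 1.
  have := ler_pM (ltW (lt_le_trans eta0 x0)) (ltW (lt_le_trans eta0 y0)) x1 y1.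
  by rewrite mulr1.
pose e := `|w * tau - j%:~R * y|.
have e0 : 0 <= e by exact: normr_ge0.
have eb : e <= 2 * bet.
  have h1 : e * w <= bet.
    apply: le_trans l3 _; by have := ler_wpM2l b0 xy1; clear -bb; lra.
  have h2 : e * 2^-1 <= e * w by rewrite ler_wpM2l.
  by clear -h1 h2; lra.
have eE : - e <= w * tau - j%:~R * y <= e by rewrite -ler_norml.
case/andP: eE => eE1 eE2.
have wt : 0 <= w * tau <= w.
  have w1 : 0 <= w by clear -w0; lra.
  by rewrite mulr_ge0// ler_piMr// ltW.
case/andP: wt => wt0 wt1.
have Heta : H * eta = 2 * z2 + 2 * bet by rewrite /H divfK ?gt_eqF.
have bound (u v : R) : eta <= v -> `|u| * v <= 2 * z2 + 2 * bet -> `|u| <= H.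
  move=> ev uv; rewrite /H ler_pdivlMr//; apply: le_trans uv.
  by rewrite ler_wpM2l.
have jH : `|j%:~R| <= H.
  apply: (bound _ y) => //.
  rewrite -[X in _ * X](ger0_norm (ltW (lt_le_trans eta0 y0))) -normrM ler_norml.
  by clear -eE1 eE2 eb wt0 wt1 l2 hz bet0; apply/andP; split; lra.
have iH : `|i%:~R| <= H.
  apply: (bound _ x) => //.
  rewrite -[X in _ * X](ger0_norm (ltW (lt_le_trans eta0 x0))) -normrM ler_norml.
  have -> : i%:~R * x = w - j%:~R * y by rewrite /w addrK.
  by clear -eE1 eE2 eb wt0 wt1 l2 hz bet0; apply/andP; split; lra.
set w' := i%:~R * x' + j%:~R * y'.
have ww : `|w' - w| <= 2 * H * kap.
  have -> : w' - w = i%:~R * (x' - x) + j%:~R * (y' - y) by rewrite /w /w'; ring.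
  apply: le_trans (ler_normD _ _) _; rewrite !normrM.
  have h1 := ler_pM (normr_ge0 _) (normr_ge0 _) iH dx.
  have h2 := ler_pM (normr_ge0 _) (normr_ge0 _) jH dy.
  by clear -h1 h2; lra.
have ww' := ww; move: ww'; rewrite ler_norml => /andP[ww1 ww2].
pose e' := `|w' * tau - j%:~R * y'|.
have e'0 : 0 <= e' by exact: normr_ge0.
have ee' : e' <= e + 3 * H * kap.
  have -> : e' = `|(w * tau - j%:~R * y) + ((w' - w) * tau - j%:~R * (y' - y))|.
    by rewrite /e'; congr `|_|; ring.
  apply: le_trans (ler_normD _ _) _; rewrite -/e lerD2l.
  apply: le_trans (ler_normB _ _) _; rewrite !normrM (ger0_norm t0).
  have h2 := ler_pM (normr_ge0 _) (normr_ge0 _) jH dy.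
  have h1 : `|w' - w| * tau <= `|w' - w| by rewrite ler_piMr// ltW.
  apply: le_trans (lerD (le_trans h1 ww) h2) _.
  by rewrite (_ : 2 * H * kap + H * kap = 3 * H * kap)//; ring.
have ww3 : w' <= w + 2 * (H * kap) by rewrite -lerBlDl mulrA.
have ww4 : w - 2 * (H * kap) <= w' by rewrite lerBlDr -lerBlDl mulrA -opprB lerNl.
have Hk2 : 2 * (H * kap) <= del by rewrite mulrA.
split; first by rewrite t0 t1.
exists i, j; split => //; rewrite -/w'.
- by clear -ww4 Hk2 l1; lra.
- by clear -ww3 Hk2 l2; lra.
rewrite -mulrA in ee'; rewrite -/e in l3.
apply: (@product_stable R b bet del eta H kap z2 w w' e e' x y x' y') => //.
- by rewrite b0.
- by clear -eta0 y0; lra.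
- by clear -w0; lra.
- by clear -l2 hz; lra.
Qed.

Lemma neg_ge1 (r : int) : r < 0 -> 1 <= - r.
Proof. by clear; lia. Qed.

Lemma no_between (u v a b c n : int) : 1 <= u -> 1 <= v -> c = u * a + v * b ->
  n < a + b -> c <= n -> 0 < a -> 0 < b -> False.
Proof.
move=> u1 v1 cE nab cn a0 b0.
have h1 : a <= u * a by rewrite ler_peMl// ltW.
have h2 : b <= v * b by rewrite ler_peMl// ltW.
have := lt_le_trans nab (lerD h1 h2); rewrite -cE => /lt_le_trans/(_ cn).
by rewrite ltxx.
Qed.

(* The cross determinants u, v are positive; if two tiles differed, one of the
   denominators would be at least a sum of two adjacent ones, which exceeds n. *)
Lemma tile_unique (n : nat) (p1 q1 p1' q1' p2 q2 p2' q2' : int) (xi : R) :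
  0 < q1 <= n%:Z -> 0 < q1' <= n%:Z -> n%:Z < q1 + q1' -> p1' * q1 - p1 * q1' = 1 ->
  0 < q2 <= n%:Z -> 0 < q2' <= n%:Z -> n%:Z < q2 + q2' -> p2' * q2 - p2 * q2' = 1 ->
  tile p1 q1 p1' q1' xi -> tile p2 q2 p2' q2' xi ->
  [/\ p1 = p2, q1 = q2, p1' = p2' & q1' = q2'].
Proof.
have cmp (p q p' q' : int) : 0 < q -> 0 < q' -> p%:~R <= xi * q%:~R ->
    xi * q'%:~R < p'%:~R -> 1 <= p' * q - p * q'.
  move=> q0 q0' h1 h2; rewrite -gtz0_ge1 subr_gt0 -(ltr_int R) !rmorphM/=.
  have a : (0 : R) < q%:~R by rewrite ltr0z.
  have b : (0 : R) < q'%:~R by rewrite ltr0z.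
  apply: (@le_lt_trans _ _ (xi * q%:~R * q'%:~R)); first by rewrite ler_pM2r.
  by rewrite mulrAC ltr_pM2r.
move=> /andP[a1 b1] /andP[a1' b1'] s1 d1 /andP[a2 b2] /andP[a2' b2'] s2 d2.
move=> [t1 t1'] [t2 t2'].
have c12 := cmp _ _ _ _ a1 a2' t1 t2'; have c21 := cmp _ _ _ _ a2 a1' t2 t1'.
pose u := p2' * q1 - p1 * q2'; pose v := p1' * q2 - p2 * q1'.
pose r := p2 * q1 - p1 * q2; pose r' := p2' * q1' - p1' * q2'.
have q2E : q2 = v * q1 + r * q1'.
  transitivity ((p1' * q1 - p1 * q1') * q2); first by rewrite d1 mul1r.
  by rewrite /v /r; ring.
have q2E' : q2' = u * q1' - r' * q1.
  transitivity ((p1' * q1 - p1 * q1') * q2'); first by rewrite d1 mul1r.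
  by rewrite /u /r'; ring.
have q1E : q1 = u * q2 - r * q2'.
  transitivity ((p2' * q2 - p2 * q2') * q1); first by rewrite d2 mul1r.
  by rewrite /u /r; ring.
have q1E' : q1' = v * q2' + r' * q2.
  transitivity ((p2' * q2 - p2 * q2') * q1'); first by rewrite d2 mul1r.
  by rewrite /v /r'; ring.
have r0 : r = 0.
  have [rn|rp|//] := ltgtP r 0; exfalso.
    apply: (@no_between u (- r) q2 q2' q1 n) => //; first by exact: neg_ge1.
    by rewrite mulNr.
  exact: (@no_between v r q1 q1' q2 n).
have r0' : r' = 0.
  have [rn|rp|//] := ltgtP r' 0; exfalso.
    apply: (@no_between u (- r') q1' q1 q2' n) => //.
    + exact: neg_ge1.
    + by rewrite mulNr.
    + by rewrite addrC.
  apply: (@no_between v r' q2' q2 q1' n) => //.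
  by rewrite addrC.
have ge (w a b : int) : 0 < b -> 1 <= w -> a = w * b -> b <= a.
  by move=> b0 w1 ->; rewrite ler_peMl// ltW.
have qq : q1 = q2.
  apply/eqP; rewrite eq_le; apply/andP; split.
    by apply: (ge v) => //; rewrite q2E r0 mul0r addr0.
  by apply: (ge u) => //; rewrite q1E r0 mul0r subr0.
have qq' : q1' = q2'.
  apply/eqP; rewrite eq_le; apply/andP; split.
    by apply: (ge u) => //; rewrite q2E' r0' mul0r subr0.
  by apply: (ge v) => //; rewrite q1E' r0' mul0r addr0.
have q1n0 : q1 != 0 by rewrite gt_eqF.
have q1n0' : q1' != 0 by rewrite gt_eqF.
split => //.
  by apply: (mulIf q1n0); apply/esym/eqP; rewrite -subr_eq0 {2}qq -/r r0.
by apply: (mulIf q1n0'); apply/esym/eqP; rewrite -subr_eq0 {2}qq' -/r' r0'.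
Qed.

End Estimates.

(** * Union bounds *)

Lemma cnt_int_itv (R : realType) (u v : R) : u <= v ->
  (cnt [set b : int | u < b%:~R <= v])%:R <= v - u + 1.
Proof.
move=> uv; have [_ ->] := int_window uv.
have h : Num.floor u <= Num.floor v by exact: le_floor.
have e : `|Num.floor v - Num.floor u| = Num.floor v - Num.floor u.
  by rewrite ger0_norm ?subr_ge0.
rewrite natr_absz e rmorphB/=; have h1 := floor_le v.
by have := floorD1_gt u; rewrite rmorphD/= => h2; lra.
Qed.

(** A denominator [b] has at most [3 * C * b] numerators, each costing [w / b], so its total cost
    does not depend on [b]; there are at most [v - u + 1] denominators. *)
Lemma rat_cover (R : realType) (E : set R) (u v w : R) (C : nat) (F : int -> int -> set R) :
  measurable (E : set (measurableTypeR R)) -> E `<=` `[0, 1] ->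
  0 <= u -> u <= v -> (0 < C)%N -> 0 <= w ->
  (forall b a : int, u < b%:~R <= v -> bmeas (F b a) /\ lam (F b a) <= w / b%:~R) ->
  (forall xi, E xi -> exists b a : int,
     [/\ u < b%:~R <= v, `|a| <= C%:Z * b & F b a xi]) ->
  lam E <= (v - u + 1) * (3 * C%:R * w).
Proof.
move=> mE E01 u0 uv C0 w0 bF EF.
pose B := [set b : int | u < b%:~R <= v].
pose Ab (b : int) := [set a : int | - (C%:Z * b) - 1 < a <= C%:Z * b].
have b0 (b : int) : B b -> 0 < b.
  by move=> /andP[ub _]; rewrite -(ltr0z R); exact: le_lt_trans ub.
have range (b : int) : 0 < b -> - (C%:Z * b) - 1 <= C%:Z * b.
  move=> bp; have h : 0 <= C%:Z * b by rewrite mulr_ge0// ltW.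
  by move: (_ * _) h; clear; lia.
pose F' b := \bigcup_(a in Ab b) (F b a `&` `[0, 1]%classic).
have fB : finite_set B := (int_window uv).1.
have mFba b a : B b -> measurable (F b a `&` `[0, 1] : set (measurableTypeR R)).
  move=> Bb; apply: measurableI; last exact: measurable_itv.
  by case: (bF b a Bb) => -[].
have bF' b : B b -> bmeas (F' b).
  move=> Bb; apply: (@bmeas_itv _ _ 0 1).
    apply: fin_bigcup_measurable; first exact: (int_range (range _ (b0 _ Bb))).1.
    by move=> a _; exact: mFba.
  by move=> x [a _ []].
have lF' b : B b -> lam (F' b) <= 3 * C%:R * w.
  move=> Bb; have bp := b0 _ Bb; have [fA cA] := int_range (range _ bp).
  have bR : (0 : R) < b%:~R by rewrite ltr0z.
  apply: (@le_trans _ _ ((cnt (Ab b))%:R * (w / b%:~R))).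
    apply: (lam_cover_const (F := fun a => F b a `&` `[0, 1]%classic)) => //.
    - by case: (bF' b Bb).
    - move=> a _; apply: (@bmeas_itv _ _ 0 1); first exact: mFba.
      by move=> x [].
    - move=> a _; apply: le_trans (bF b a Bb).2; apply: lam_le; first exact: mFba.
        exact: (bF b a Bb).1.
      exact: subIsetl.
  have cb : 0 <= 2 * (C%:Z * b) + 1 by rewrite addr_ge0// !mulr_ge0// ltW.
  have cE : (cnt (Ab b))%:R = 2 * (C%:R * b%:~R) + 1 :> R.
    rewrite cA (_ : C%:Z * b - (- (C%:Z * b) - 1) = 2 * (C%:Z * b) + 1); last by ring.
    by rewrite natr_absz ger0_norm// rmorphD !rmorphM.
  have cb1 : 1 <= C%:R * b%:~R :> R.
    have h1 : (1 : R) <= C%:R by rewrite ler1n.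
    have h2 : (1 : R) <= b%:~R by rewrite ler1z -gtz0_ge1.
    by have := ler_pM ler01 ler01 h1 h2; rewrite mulr1.
  rewrite cE (_ : 3 * C%:R * w = 3 * (C%:R * b%:~R) * (w / b%:~R)); last first.
    by field; rewrite gt_eqF.
  by rewrite ler_wpM2r ?divr_ge0 ?(ltW bR)//; lra.
apply: (@le_trans _ _ ((cnt B)%:R * (3 * C%:R * w))); last first.
  by rewrite ler_wpM2r ?mulr_ge0// cnt_int_itv.
apply: (lam_cover_const (F := F')) => // xi Exi.
have [b [a [Bb ab Fx]]] := EF _ Exi; exists b => //; exists a.
  by move: ab; rewrite ler_norml /Ab/=; move: (C%:Z * b) => z; clear; lia.
by split => //; exact: E01.
Qed.

Lemma tile_sum (R : realType) (p q p' q' : int) (xi : R) :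
  0 < q -> 0 < q' -> p' * q - p * q' = 1 -> tile p q p' q' xi ->
  [/\ 0 <= xi * q%:~R - p%:~R, 0 <= p'%:~R - xi * q'%:~R,
     (xi * q%:~R - p%:~R) * q'%:~R <= 1 & (p'%:~R - xi * q'%:~R) * q%:~R <= 1].
Proof.
move=> q0 q0' d [h1 h2].
have a : (0 : R) < q%:~R by rewrite ltr0z.
have b : (0 : R) < q'%:~R by rewrite ltr0z.
have dR : p'%:~R * q%:~R - p%:~R * q'%:~R = 1 :> R by rewrite -!intrM -rmorphB d.
have g1 : 0 <= xi * q%:~R - p%:~R by rewrite subr_ge0.
have g2 : 0 <= p'%:~R - xi * q'%:~R by rewrite subr_ge0 ltW.
have E : (xi * q%:~R - p%:~R) * q'%:~R + (p'%:~R - xi * q'%:~R) * q%:~R = 1.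
  by transitivity (p'%:~R * q%:~R - p%:~R * q'%:~R : R); [ring|exact: dR].
have k1 := mulr_ge0 g1 (ltW b); have k2 := mulr_ge0 g2 (ltW a).
by split => //; clear -E k1 k2; lra.
Qed.

Lemma bmeas_cc (R : realType) (a b : R) : bmeas (`[a, b]%classic : set R).
Proof. by apply: (@bmeas_itv _ _ a b) => //; exact: measurable_itv. Qed.

Lemma lam_cc (R : realType) (a b : R) : a <= b -> lam (`[a, b]%classic : set R) <= b - a.
Proof. by move=> ab; apply: lam_itv_le => //; exact: measurable_itv. Qed.

(** If one denominator is at most [n / e], the other is at least [n / 2], so the tile lies within
    [2 / (b * n)] of the fraction with the small denominator [b]. The number of such fractions is of
    order [b] for each [b] up to [n / e], which gives measure of order [1 / e]. *)
Lemma leftover_bound (R : realType) (n e : nat) (E : set R) :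
  measurable (E : set (measurableTypeR R)) -> E `<=` `[0, 1] ->
  (0 < n)%N -> (1 < e)%N ->
  (forall xi, E xi -> exists p q p' q' : int, [/\ 0 < q, 0 < q', n%:Z < q + q' &
     [/\ p' * q - p * q' = 1, tile p q p' q' xi, 0 <= p &
       q * e%:Z <= n%:Z \/ q' * e%:Z <= n%:Z]]) ->
  lam E <= 24 / e%:R + 24 / n%:R.
Proof.
move=> mE E01 n0 e1 EF.
have nR : (0 : R) < n%:R by rewrite ltr0n.
have eR : (0 : R) < e%:R by rewrite ltr0n (leq_trans _ e1).
(* [rat_cover] is applied with intervals of length [4 / (b * n)] and [C = 2], since the right
   numerator [p'] may exceed [q'] by 1. *)
have -> : 24 / e%:R + 24 / n%:R = (n%:R / e%:R - 0 + 1) * (3 * 2%:R * (4 / n%:R)) :> R.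
  by field; rewrite !gt_eqF.
pose F (b a : int) := `[a%:~R / b%:~R - 2 / (b%:~R * n%:R),
  a%:~R / b%:~R + 2 / (b%:~R * n%:R)]%classic : set R.
apply: (rat_cover (F := F)) => //.
- move=> b a /andP[b0 _]; split; first exact: bmeas_cc.
  have r0 : 0 < 2 / (b%:~R * n%:R) :> R by rewrite divr_gt0// mulr_gt0.
  apply: le_trans (lam_cc _) _; first by clear -r0; lra.
  by rewrite le_eqVlt; apply/orP; left; apply/eqP; field; rewrite !gt_eqF.
move=> xi Exi.
have := E01 _ Exi; rewrite /= in_itv/= => /andP[xi0 xi1].
have [p [q [p' [q' [q0 q0' s [d tl p0 small]]]]]] := EF _ Exi.
have [g1 g2 k1 k2] := tile_sum q0 q0' d tl.
have a : (0 : R) < q%:~R by rewrite ltr0z.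
have b : (0 : R) < q'%:~R by rewrite ltr0z.
have sR : n%:R <= q%:~R + q'%:~R :> R.
  by rewrite -rmorphD/= -[n%:R]/(n%:Z%:~R) ler_int ltW.
have q1 : (1 : R) <= q%:~R by rewrite ler1z -gtz0_ge1.
have q1' : (1 : R) <= q'%:~R by rewrite ler1z -gtz0_ge1.
have e2 : (2 : R) <= e%:R by rewrite ler_nat.
have half (x y : R) : 0 < x -> x * e%:R <= n%:R -> n%:R <= x + y -> n%:R / 2 <= y.
  move=> x0 xe xy; have : x * 2 <= x * e%:R by rewrite ler_pM2l.
  by clear -xe xy; lra.
case: small => small; rewrite -(ler_int R) rmorphM/= in small.
  exists q, p; split.
  - by rewrite a/= ler_pdivlMr.
  - rewrite ger0_norm// -(ler_int R) rmorphM/=.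
    have : xi * q%:~R <= q%:~R by rewrite ler_piMl// ltW.
    by clear -a g1; lra.
  - have hq' := half _ _ a small sR.
    have h1 : (xi * q%:~R - p%:~R) * (n%:R / 2) <= 1.
      by apply: le_trans k1; rewrite ler_wpM2l.
    have xe : xi = p%:~R / q%:~R + (xi * q%:~R - p%:~R) / q%:~R by field; rewrite gt_eqF.
    have h2 : (xi * q%:~R - p%:~R) / q%:~R <= 2 / (q%:~R * n%:R).
      rewrite ler_pdivrMr// [X in _ <= X](_ : _ = 2 / n%:R); last by field; rewrite !gt_eqF.
      by rewrite ler_pdivlMr//; clear -h1; lra.
    have h3 : 0 <= (xi * q%:~R - p%:~R) / q%:~R by rewrite divr_ge0// ltW.
    have h4 : 0 <= 2 / (q%:~R * n%:R) :> R by apply: divr_ge0 => //; apply: mulr_ge0; exact: ltW.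
    rewrite /F/= in_itv/= {1 2}xe; apply/andP; split; clear -h2 h3 h4; lra.
rewrite addrC in sR; exists q', p'; split.
- by rewrite b/= ler_pdivlMr.
- have p'0 : 0 <= p'.
    rewrite -(ler0z R); have : 0 <= xi * q'%:~R by rewrite mulr_ge0// ltW.
    by clear -g2; lra.
  rewrite ger0_norm// -(ler_int R) rmorphM/=.
  have h1 : xi * q'%:~R <= q'%:~R by rewrite ler_piMl// ltW.
  have h2 : p'%:~R - xi * q'%:~R <= 1.
    by apply: le_trans k2; rewrite ler_peMr.
  by clear -h1 h2 q1'; lra.
have hq := half _ _ b small sR.
have h1 : (p'%:~R - xi * q'%:~R) * (n%:R / 2) <= 1.
  by apply: le_trans k2; rewrite ler_wpM2l.
have xe : xi = p'%:~R / q'%:~R - (p'%:~R - xi * q'%:~R) / q'%:~R by field; rewrite gt_eqF.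
have h2 : (p'%:~R - xi * q'%:~R) / q'%:~R <= 2 / (q'%:~R * n%:R).
  rewrite ler_pdivrMr// [X in _ <= X](_ : _ = 2 / n%:R); last by field; rewrite !gt_eqF.
  by rewrite ler_pdivlMr//; clear -h1; lra.
have h3 : 0 <= (p'%:~R - xi * q'%:~R) / q'%:~R by rewrite divr_ge0// ltW.
have h4 : 0 <= 2 / (q'%:~R * n%:R) :> R by apply: divr_ge0 => //; apply: mulr_ge0; exact: ltW.
rewrite /F/= in_itv/= {1 2}xe; apply/andP; split; clear -h2 h3 h4; lra.
Qed.

(** * Cost of enlarging the parameters *)

Section Fuzz.
Variables (R : realType) (m : nat).
Hypothesis m_gt0 : (0 < m)%N.
Variable A : {set 'I_m * 'I_m}.
Let S := @Sset R m m_gt0 A.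

Local Tactic Notation "keep" ne_hyp_list(hs) := clear -m_gt0 A S hs.

(** With [lo = -1] and positive [q] the lower condition is void, so thin annuli and full
    neighbourhoods share one estimate. *)
Definition near_rat (P : int -> int -> Prop) (lo hi : R) : set R :=
  `[0, 1]%classic `&` [set xi | exists a q : int,
    P a q /\ lo < `|q%:~R * xi - a%:~R| * q%:~R <= hi].

Lemma measurable_near_rat P lo hi :
  measurable (near_rat P lo hi : set (measurableTypeR R)).
Proof.
apply: measurableI; first exact: measurable_itv.
rewrite (_ : [set xi | _] = [set xi | exists a q : int, P a q /\
  ([set x | `|q%:~R * x - a%:~R| * q%:~R <= hi] `\`
   [set x | `|q%:~R * x - a%:~R| * q%:~R <= lo]) xi]).
  apply: measurable_countable_exists => a q.
  by apply: measurableD; exact: measurable_abs_le.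
apply/seteqP; split => x /= [a [q [Paq]]].
  by move=> /andP[h1 h2]; exists a, q; split=> //; split => //; apply/negP; rewrite -ltNge.
by move=> [h1 /negP]; rewrite -ltNge => h2; exists a, q; rewrite h1 h2.
Qed.

Lemma lam_annulus (a q : int) (lo hi : R) : 0 < q -> -1 <= lo -> lo <= hi -> 0 <= hi ->
  let E := [set xi : R | lo < `|q%:~R * xi - a%:~R| * q%:~R <= hi] in
  bmeas E /\ lam E <= 2 * (hi - lo) / q%:~R ^+ 2.
Proof.
move=> q0 lo1 lohi hi0 E; have qR : (0 : R) < q%:~R by rewrite ltr0z.
have q2 : (0 : R) < q%:~R ^+ 2 by rewrite exprn_gt0.
have mE : measurable (E : set (measurableTypeR R)).
  rewrite (_ : E = [set x | `|q%:~R * x - a%:~R| * q%:~R <= hi] `\`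
     [set x | `|q%:~R * x - a%:~R| * q%:~R <= lo]).
    by apply: measurableD; exact: measurable_abs_le.
  apply/seteqP; split => x /=.
    by move=> /andP[h1 h2]; split => //; apply/negP; rewrite -ltNge.
  by move=> [h1 /negP]; rewrite -ltNge => h2; apply/andP.
pose c : R := a%:~R / q%:~R.
have xE (x : R) : (q%:~R * x - a%:~R) * q%:~R = (x - c) * q%:~R ^+ 2.
  by rewrite /c; field; rewrite gt_eqF.
have EE (x : R) : E x -> lo / q%:~R ^+ 2 < `|x - c| <= hi / q%:~R ^+ 2.
  rewrite /E/= -{2 4}(ger0_norm (ltW qR)) -normrM xE normrM (ger0_norm (ltW q2)).
  by rewrite ltr_pdivrMr// ler_pdivlMr.
have h0 : 0 <= hi / q%:~R ^+ 2 by rewrite divr_ge0// ltW.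
have l1 : lo / q%:~R ^+ 2 <= hi / q%:~R ^+ 2 by rewrite ler_pM2r// invr_gt0.
have sub : E `<=` `[c - hi / q%:~R ^+ 2, c - lo / q%:~R ^+ 2]%classic `|`
     `[c + lo / q%:~R ^+ 2, c + hi / q%:~R ^+ 2]%classic.
  move=> x /EE /andP[h1 h2]; have [xc|xc] := leP c x; [right|left];
    rewrite /= in_itv/=.
    rewrite ger0_norm ?subr_ge0// in h1 h2; apply/andP; split; clear -h1 h2; lra.
  rewrite ltr0_norm ?subr_lt0// in h1 h2; apply/andP; split; clear -h1 h2; lra.
split.
  apply: (@bmeas_itv _ _ (c - hi / q%:~R ^+ 2) (c + hi / q%:~R ^+ 2)) => //.
  move=> x /EE /andP[_]; rewrite /= in_itv/= ler_norml => /andP[h1 h2].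
  by apply/andP; split; clear -h1 h2; lra.
apply: le_trans (lam_cover2 mE (bmeas_cc _ _) (bmeas_cc _ _) sub) _.
have h1 := @lam_cc R (c - hi / q%:~R ^+ 2) (c - lo / q%:~R ^+ 2).
have h2 := @lam_cc R (c + lo / q%:~R ^+ 2) (c + hi / q%:~R ^+ 2).
have {}h1 := h1 ltac:(clear -l1; lra); have {}h2 := h2 ltac:(clear -l1; lra).
apply: le_trans (lerD h1 h2) _.
by rewrite le_eqVlt; apply/orP; left; apply/eqP; ring.
Qed.

Lemma near_rat_bound (P : int -> int -> Prop) (lo hi u v : R) (n C : nat) :
  (0 < n)%N -> -1 <= lo -> lo <= hi -> 0 <= hi -> n%:R / 4 <= u -> u <= v ->
  hi + 1 <= C%:R -> (forall a q, P a q -> u < q%:~R <= v) ->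
  lam (near_rat P lo hi) <= (v - u + 1) * (24 * C%:R * (hi - lo) / n%:R).
Proof.
move=> n0 lo1 lohi hi0 un uv hC Pq.
have nR : (0 : R) < n%:R by rewrite ltr0n.
have u0 : 0 < u by apply: lt_le_trans un; rewrite divr_gt0.
pose F (b a : int) := [set xi : R | lo < `|b%:~R * xi - a%:~R| * b%:~R <= hi].
have -> : 24 * C%:R * (hi - lo) / n%:R = 3 * C%:R * (8 * (hi - lo) / n%:R) by ring.
have C1 : (1 : R) <= C%:R by clear -hC hi0; lra.
apply: (rat_cover (F := F)) => //.
- exact: measurable_near_rat.
- by move=> x [].
- exact: ltW.
- by rewrite -(ltr_nat R); apply: lt_le_trans C1.
- by rewrite divr_ge0 ?mulr_ge0 ?subr_ge0 ?(ltW nR).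
- move=> b a /andP[ub _]; have b0 : (0 : R) < b%:~R by exact: lt_trans ub.
  have bz : 0 < b by rewrite -(ltr0z R).
  have [h1 h2] := @lam_annulus a b lo hi bz lo1 lohi hi0.
  split => //; apply: le_trans h2 _.
  rewrite expr2 invfM mulrA ler_pM2r ?invr_gt0//.
  rewrite ler_pdivrMr// mulrAC ler_pdivlMr//.
  have bn : n%:R / 4 <= b%:~R :> R by apply: le_trans (ltW ub).
  have hl : 0 <= hi - lo by rewrite subr_ge0.
  have := ler_wpM2l hl bn; clear; lra.
move=> xi [/=]; rewrite in_itv/= => /andP[x0 x1] [a [q [Paq Fx]]].
exists q, a; split => //; first exact: Pq Paq.
have /andP[uq _] := Pq _ _ Paq; have q0 : (0 : R) < q%:~R by exact: lt_trans uq.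
have q1 : (1 : R) <= q%:~R by rewrite ler1z -gtz0_ge1 -(ltr0z R).
case/andP: Fx => _ Fx; rewrite -(ler_int R) rmorphM/= intr_norm.
have h1 : `|q%:~R * xi - a%:~R| <= hi.
  by apply: le_trans Fx; rewrite ler_peMr.
have h2 : `|a%:~R| <= q%:~R * xi + hi :> R.
  rewrite -[q%:~R * xi]ger0_norm ?mulr_ge0 ?(ltW q0)//.
  rewrite (_ : a%:~R = q%:~R * xi - (q%:~R * xi - a%:~R)); last by ring.
  by apply: le_trans (ler_normB _ _) _; rewrite lerD2l.
have h3 : q%:~R * xi <= q%:~R by rewrite ler_piMr// ltW.
have h4 : q%:~R * (hi + 1) <= q%:~R * C%:R by rewrite ler_wpM2l// ltW.
have h5 : hi <= q%:~R * hi by rewrite ler_peMl.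
by clear -h2 h3 h4 h5; lra.
Qed.

(** A point gained by the enlargement is close to a fraction whose denominator is just below [n]
    ([P1]) or just above [c * n] ([P2]), or whose error lies in an annulus of width [2 * del]
    ([P3]). The first two cases have few denominators, the third has thin sets. *)
Lemma fuzz_bound (alpha c : R) : 0 < alpha -> 1 <= c ->
  exists2 K : R, 0 <= K & forall (del : R) (n : nat), 0 < del -> del <= 4^-1 -> (3 < n)%N ->
  lam (`[0, 1]%classic `&`
    (S (1 - 2 * del) (c + 2 * del) (alpha + 2 * del) n `\` S 1 c alpha n))
    <= K * (del + n%:R^-1).
Proof.
move=> al0 c1.
have [C C0 hC] := exists_nat_gt (alpha + 2).
pose K1 : R := 24 * C%:R * (alpha + 2).
pose K : R := 8 * K1 + 48 * C%:R * (c + 1).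
have K10 : 0 <= K1 by rewrite /K1 !mulr_ge0// addr_ge0// ltW.
exists K => [|del n del0 del4 n4].
  have c0 : 0 <= c + 1 by rewrite addr_ge0// (le_trans _ c1).
  by rewrite /K addr_ge0 ?(mulr_ge0 _ K10)//; do 2 apply: mulr_ge0 => //.
rewrite /K.
have nR : (4 : R) <= n%:R by rewrite ler_nat.
have n0 : (0 < n)%N by apply: leq_trans n4.
have nR0 : (0 : R) < n%:R by rewrite ltr0n.
pose P1 (a q : int) := n%:R * (1 - 2 * del) - 1 < (q%:~R : R) <= n%:R.
pose P2 (a q : int) := c * n%:R < (q%:~R : R) <= (c + 2 * del) * n%:R.
pose P3 (a q : int) := n%:R - 1 < (q%:~R : R) <= c * n%:R.
have nd : n%:R * del <= n%:R / 4 by rewrite ler_pM2l.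
have nd0 : 0 <= n%:R * del by rewrite mulr_ge0 ?(ltW nR0) ?(ltW del0).
have cn : n%:R <= c * n%:R by rewrite ler_peMl// ltW.
have hiC : alpha + 2 * del + 1 <= C%:R by keep hC del4; lra.
have b1 : lam (near_rat P1 (-1) (alpha + 2 * del)) <=
    (n%:R - (n%:R * (1 - 2 * del) - 1) + 1) * (24 * C%:R * (alpha + 2 * del - -1) / n%:R).
  apply: near_rat_bound => //.
  - by keep al0 del0; lra.
  - by keep al0 del0; lra.
  - by keep nd nR; lra.
  - by keep nd0; lra.
have b2 : lam (near_rat P2 (-1) (alpha + 2 * del)) <=
    ((c + 2 * del) * n%:R - c * n%:R + 1) * (24 * C%:R * (alpha + 2 * del - -1) / n%:R).
  apply: near_rat_bound => //.
  - by keep al0 del0; lra.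
  - by keep al0 del0; lra.
  - by keep cn nR0; lra.
  - by keep nd0; lra.
have b3 : lam (near_rat P3 alpha (alpha + 2 * del)) <=
    (c * n%:R - (n%:R - 1) + 1) * (24 * C%:R * (alpha + 2 * del - alpha) / n%:R).
  apply: near_rat_bound => //.
  - by keep al0; lra.
  - by keep del0; lra.
  - by keep al0 del0; lra.
  - by keep nR; lra.
  - by keep cn; lra.
have bm P lo hi : bmeas (near_rat P lo hi).
  apply: (@bmeas_itv _ _ 0 1); first exact: measurable_near_rat.
  by move=> x [].
set E := _ `&` _.
have mE : measurable (E : set (measurableTypeR R)).
  apply: measurableI; first exact: measurable_itv.
  by apply: measurableD; exact: measurable_Sset.
have bU : bmeas (near_rat P1 (-1) (alpha + 2 * del) `|` near_rat P2 (-1) (alpha + 2 * del)).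
  apply: (@bmeas_itv _ _ 0 1); first by apply: measurableU; exact: measurable_near_rat.
  by move=> x [[]|[]].
have sub : E `<=` (near_rat P1 (-1) (alpha + 2 * del) `|` near_rat P2 (-1) (alpha + 2 * del))
    `|` near_rat P3 alpha (alpha + 2 * del).
  move=> xi [x01 [[a [q [cop Aaq l1 l2 l3]]] nS]].
  have q0 : (0 : R) < q%:~R.
    apply: lt_le_trans l1; rewrite mulr_gt0//; keep del4; lra.
  have ab : -1 < `|q%:~R * xi - a%:~R| * q%:~R.
    by apply: (@lt_le_trans _ _ 0); rewrite ?ltrN10// mulr_ge0// ltW.
  have [lt|ge] := ltP (q%:~R : R) n%:R.
    left; left; split => //; exists a, q; split; last by rewrite ab l3.
    by apply/andP; split; [keep l1; lra|exact: ltW].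
  have [le|gt] := leP (q%:~R : R) (c * n%:R); last first.
    left; right; split => //; exists a, q; split; last by rewrite ab l3.
    by rewrite /P2 gt/= mulrC.
  right; split => //; exists a, q; split.
    by rewrite /P3 le andbT; keep ge; lra.
  rewrite l3 andbT ltNge; apply/negP => l3'; apply: nS.
  by exists a, q; split => //; rewrite ?mulr1// mulrC.
have bP3 := bm P3 alpha (alpha + 2 * del).
apply: le_trans (lam_cover2 mE bU bP3 sub) _.
have mU : measurable ((near_rat P1 (-1) (alpha + 2 * del) `|`
   near_rat P2 (-1) (alpha + 2 * del)) : set (measurableTypeR R)) by case: bU.
have := lam_cover2 mU (bm P1 (-1) (alpha + 2 * del)) (bm P2 (-1) (alpha + 2 * del)) (fun x h => h).
move: b1 b2 b3; set L1 := lam _; set L2 := lam _; set L3 := lam _; set L4 := lam _ => b1 b2 b3 b4.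
have w1 : 24 * C%:R * (alpha + 2 * del - -1) / n%:R <= K1 / n%:R.
  rewrite ler_pM2r ?invr_gt0// /K1 ler_wpM2l ?mulr_ge0//; keep del4; lra.
have n1 : 0 <= n%:R * (1 - (1 - 2 * del)) + 2 by keep nd0; lra.
have c1' : L1 <= (n%:R * (2 * del) + 2) * (K1 / n%:R).
  apply: le_trans b1 _.
  rewrite (_ : n%:R - (n%:R * (1 - 2 * del) - 1) + 1 = n%:R * (2 * del) + 2); last by ring.
  by rewrite ler_wpM2l//; keep nd0; lra.
have c2' : L2 <= (n%:R * (2 * del) + 2) * (K1 / n%:R).
  apply: le_trans b2 _.
  apply: (@le_trans _ _ ((n%:R * (2 * del) + 1) * (K1 / n%:R))).
    rewrite (_ : (c + 2 * del) * n%:R - c * n%:R + 1 = n%:R * (2 * del) + 1); last by ring.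
    by rewrite ler_wpM2l//; keep nd0; lra.
  by rewrite ler_wpM2r ?divr_ge0 ?(ltW nR0)// lerD2l ler1n.
have c3' : L3 <= (c + 1) * n%:R * (48 * C%:R * del / n%:R).
  apply: le_trans b3 _.
  rewrite (_ : 24 * C%:R * (alpha + 2 * del - alpha) / n%:R = 48 * C%:R * del / n%:R); last by ring.
  rewrite ler_wpM2r//; first by rewrite divr_ge0 ?mulr_ge0 ?(ltW nR0) ?(ltW del0).
  by keep nR; lra.
have e1 : (n%:R * (2 * del) + 2) * (K1 / n%:R) = 2 * K1 * (del + n%:R^-1).
  by field; rewrite gt_eqF.
have e3 : (c + 1) * n%:R * (48 * C%:R * del / n%:R) = 48 * C%:R * (c + 1) * del.
  by field; rewrite gt_eqF.
rewrite e1 in c1' c2'; rewrite e3 in c3'.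
have iN : (0 : R) <= n%:R^-1 by rewrite invr_ge0 ltW.
have z1 : 0 <= K1 * (del + n%:R^-1) by rewrite mulr_ge0// addr_ge0// ltW.
have z2 : 0 <= 48 * C%:R * (c + 1) * n%:R^-1.
  by rewrite !mulr_ge0//; keep c1; lra.
by keep c1' c2' c3' b4 z1 z2; lra.
Qed.

End Fuzz.

(** * Comparison on a grid *)

Lemma weighted_density (R : realType) (I : finType) (P : pred I) (f : I -> R -> R)
  (v w : I -> R) (eps : R) :
  (forall i, P i -> forall e, 0 < e -> exists2 T0, 1 <= T0 & forall T, T0 <= T ->
    `|f i T - v i * T ^+ 2| <= e * T ^+ 2) -> 0 < eps ->
  exists N : nat, forall n, (N <= n)%N ->
    `|\sum_(i | P i) f i n%:R * (w i / n%:R ^+ 2) - \sum_(i | P i) v i * w i| <= eps.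
Proof.
move=> hf eps0; pose W := \sum_(i | P i) `|w i| + 1.
have W0 : 0 < W by rewrite ltr_wpDl// sumr_ge0.
have /choice[T0 hT0] : forall i, exists T0, 1 <= T0 /\ (P i -> forall T, T0 <= T ->
    `|f i T - v i * T ^+ 2| <= eps / W * T ^+ 2).
  move=> i; have [Pi|nPi] := boolP (P i); last by exists 1; rewrite lexx.
  have [T0 T01 hT] := hf i Pi _ (divr_gt0 eps0 W0).
  by exists T0; split => // _.
have [N N0 hN] := exists_nat_gt (\sum_i T0 i).
exists N => n Nn; have nR : (0 : R) < n%:R by rewrite ltr0n (leq_trans N0).
have n2 : (0 : R) < n%:R ^+ 2 by rewrite exprn_gt0.
rewrite -sumrB; apply: le_trans (ler_norm_sum _ _ _) _.
apply: (@le_trans _ _ (\sum_(i | P i) eps / W * `|w i|)); last first.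
  rewrite -mulr_sumr mulrAC ler_pdivrMr// ler_wpM2l ?(ltW eps0)//.
  by rewrite lerDl.
apply: ler_sum => i Pi; have [T01 hTi] := hT0 i.
have Tn : T0 i <= n%:R.
  apply: le_trans (le_trans (ltW hN) _); last by rewrite ler_nat.
  rewrite (bigD1 i)//= lerDl sumr_ge0// => j _.
  by case: (hT0 j) => h _; exact: le_trans h.
rewrite [X in `|X|](_ : _ = (f i n%:R - v i * n%:R ^+ 2) / n%:R ^+ 2 * w i); last first.
  by field; rewrite gt_eqF.
rewrite normrM normrM ler_wpM2r// [X in _ * X]ger0_norm ?invr_ge0 ?(ltW n2)//.
by rewrite ler_pdivrMr// hTi.
Qed.

Section OneCell.
Variables (R : realType) (m : nat).
Hypothesis m_gt0 : (0 < m)%N.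
Variable A : {set 'I_m * 'I_m}.
Let D := @Dset R m m_gt0 A.
Let S := @Sset R m m_gt0 A.

Lemma tile_itv (p q p' q' : int) : 0 < q -> 0 < q' ->
  tile p q p' q' = `[p%:~R / q%:~R, p'%:~R / q'%:~R[%classic :> set R.
Proof.
move=> q0 q0'; have a : (0 : R) < q%:~R by rewrite ltr0z.
have b : (0 : R) < q'%:~R by rewrite ltr0z.
apply/seteqP; split => x /=; rewrite in_itv/= ler_pdivrMr// ltr_pdivlMr//.
  by case=> -> ->.
by move=> /andP[].
Qed.

Lemma bmeas_tile_Sset (p q p' q' : int) z1 z2 bet n : 0 < q -> 0 < q' ->
  bmeas (tile p q p' q' `&` S z1 z2 bet n).
Proof.
move=> q0 q0'; rewrite tile_itv//.
apply: (@bmeas_itv _ _ (p%:~R / q%:~R) (p'%:~R / q'%:~R)).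
  by apply: measurableI; [exact: measurable_itv|exact: measurable_Sset].
by move=> x [] /=; rewrite !in_itv/= => /andP[-> /ltW ->].
Qed.

Lemma basis_pos x1 x2 y1 y2 M1 M2 M3 M4 s t T p q p' q' :
  0 < x1 -> 0 < y1 -> (0 : R) < T ->
  basis_in m x1 x2 y1 y2 M1 M2 M3 M4 s t T p q p' q' -> 0 < q /\ 0 < q'.
Proof.
move=> x0 y0 T0 [_ _ /andP[h1 _] /andP[h2 _] _]; rewrite -!(ltr0z R).
by split; [apply: lt_trans h1|apply: lt_trans h2]; rewrite mulr_gt0.
Qed.

Lemma basis_ratio (n : nat) (x1 x2 : R) (q : int) : (0 < n)%N ->
  n%:R * x1 < q%:~R <= n%:R * x2 -> x1 < q%:~R / n%:R <= x2.
Proof.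
by move=> n0 h; rewrite ltr_pdivlMr ?ltr0n// ler_pdivrMr ?ltr0n// mulrC [x2 * _]mulrC.
Qed.

Lemma cell_upper (n : nat) (X : set R) (x1 x2 y1 y2 z1 z2 bet s t : R) M1 M2 M3 M4 p q p' q' :
  (0 < n)%N -> 0 < x1 -> 0 < y1 -> 0 < z1 -> bmeas X ->
  (forall x y, x1 < x <= x2 -> y1 < y <= y2 -> D x y z1 z2 bet M1 M2 M3 M4 `<=` X) ->
  basis_in m x1 x2 y1 y2 M1 M2 M3 M4 s t n%:R p q p' q' ->
  lam (tile p q p' q' `&` S z1 z2 bet n) <= lam X / (x1 * y1) / n%:R ^+ 2.
Proof.
move=> n0 x10 y10 z10 bX DX g; have nR : (0 : R) < n%:R by rewrite ltr0n.
have [q0 q0'] := basis_pos x10 y10 nR g.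
case: g => d _ hq hq' [c1 c2 c3 c4].
rewrite (lam_tile_Sset m_gt0 A z2 bet q0 q0' n0 z10 d c1 c2 c3 c4).
have a : (0 : R) < q%:~R by rewrite ltr0z.
have b : (0 : R) < q'%:~R by rewrite ltr0z.
have /(DX _ _ (basis_ratio n0 hq)) sub := basis_ratio n0 hq'.
have h := lam_le (bmeas_Dset m_gt0 A _ _ _ _ _ _ _ _ _).1 bX sub.
rewrite -mulrA -invfM; apply: ler_pM h _.
- exact: lam_ge0.
- by rewrite invr_ge0 mulr_ge0// ltW.
rewrite lef_pV2 ?posrE ?mulr_gt0 ?exprn_gt0//.
rewrite (_ : x1 * y1 * n%:R ^+ 2 = (n%:R * x1) * (n%:R * y1)); last by ring.
move/andP: hq => [/ltW hq _]; move/andP: hq' => [/ltW hq' _].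
by apply: ler_pM => //; rewrite mulr_ge0 ?ltW.
Qed.

Lemma cell_lower (n : nat) (X : set R) (x1 x2 y1 y2 z1 z2 bet s t : R) M1 M2 M3 M4 p q p' q' :
  (0 < n)%N -> 0 < x1 -> 0 < y1 -> 0 < z1 -> bmeas X ->
  (forall x y, x1 < x <= x2 -> y1 < y <= y2 -> X `<=` D x y z1 z2 bet M1 M2 M3 M4) ->
  basis_in m x1 x2 y1 y2 M1 M2 M3 M4 s t n%:R p q p' q' ->
  lam X / (x2 * y2) / n%:R ^+ 2 <= lam (tile p q p' q' `&` S z1 z2 bet n).
Proof.
move=> n0 x10 y10 z10 bX DX g; have nR : (0 : R) < n%:R by rewrite ltr0n.
have [q0 q0'] := basis_pos x10 y10 nR g.
case: g => d _ hq hq' [c1 c2 c3 c4].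
rewrite (lam_tile_Sset m_gt0 A z2 bet q0 q0' n0 z10 d c1 c2 c3 c4).
have a : (0 : R) < q%:~R by rewrite ltr0z.
have b : (0 : R) < q'%:~R by rewrite ltr0z.
have /(DX _ _ (basis_ratio n0 hq)) sub := basis_ratio n0 hq'.
have h := lam_le bX.1 (bmeas_Dset m_gt0 A _ _ _ _ _ _ _ _ _) sub.
move/andP: hq => [_ hq]; move/andP: hq' => [_ hq'].
have x20 : 0 < n%:R * x2 by apply: lt_le_trans hq.
have y20 : 0 < n%:R * y2 by apply: lt_le_trans hq'.
rewrite -mulrA -invfM (_ : x2 * y2 * n%:R ^+ 2 = (n%:R * x2) * (n%:R * y2)); last by ring.
apply: ler_pM h _.
- exact: lam_ge0.
- by rewrite invr_ge0 mulr_ge0// ltW.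
rewrite lef_pV2 ?posrE ?(mulr_gt0 a b) ?(mulr_gt0 x20 y20)//.
by apply: ler_pM => //; exact: ltW.
Qed.

End OneCell.

Lemma cell_index (R : realType) (n k K0 e : nat) (q : int) : (0 < n)%N -> k = (e * K0)%N ->
  (0 < K0)%N -> 0 < q <= n%:Z -> n%:Z < q * e%:Z ->
  exists2 a : 'I_k, (K0 <= a)%N &
    n%:R * (a%:R / k%:R) < (q%:~R : R) <= n%:R * ((a.+1)%:R / k%:R).
Proof.
move=> n0 kE K00 /andP[q0 qn] nq.
have [Q QE] : exists Q : nat, q = Q%:Z by exists `|q|%N; rewrite gez0_abs// ltW.
have {q0} Q0 : (0 < Q)%N by move: q0; rewrite QE.
have {qn} Qn : (Q <= n)%N by move: qn; rewrite QE.
have {nq} nQ : (n < Q * e)%N by move: nq; rewrite QE.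
have e0 : (0 < e)%N by case: e nQ {kE} => //; rewrite muln0.
have k0 : (0 < k)%N by rewrite kE muln_gt0 e0.
(* Cells are open on the left, hence the predecessor: the index [a] satisfies
   [a * n < Q * k <= (a + 1) * n]. *)
have ak : ((Q * k).-1 %/ n < k)%N.
  rewrite ltn_divLR// prednK ?muln_gt0 ?Q0// mulnC leq_mul2l Qn orbT//.
exists (Ordinal ak) => /=.
  rewrite leq_divRL// -ltnS prednK ?muln_gt0 ?Q0//.
  have h : (K0 * n.+1 <= K0 * (Q * e))%N by rewrite leq_mul2l nQ orbT.
  rewrite kE (_ : Q * (e * K0) = K0 * (Q * e))%N; last by rewrite mulnA mulnC.
  by apply: leq_trans h; rewrite mulnS -[X in (X < _)%N]add0n ltn_add2r.
have kR : (0 : R) < k%:R by rewrite ltr0n.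
rewrite !mulrA ltr_pdivrMr// ler_pdivlMr// QE -[Q%:Z%:~R]/(Q%:R) -!natrM ltr_nat ler_nat.
apply/andP; split.
  have := leq_trunc_div (Q * k).-1 n; rewrite mulnC => h.
  by apply: (leq_ltn_trans h); rewrite prednK// muln_gt0 Q0.
have := ltn_ceil (Q * k).-1 n0; rewrite [X in (_ < X)%N]mulnC => h.
by apply: leq_trans h; rewrite prednK// muln_gt0 Q0.
Qed.

Lemma farey_area (R : realType) (n : nat) (q q' : int) : (0 < n)%N ->
  0 < q -> 0 < q' -> n%:Z < q + q' -> (q%:~R * q'%:~R : R)^-1 <= n%:R^-1.
Proof.
move=> n0 q0 q0' s; rewrite lef_pV2 ?posrE ?mulr_gt0 ?ltr0z ?ltr0n//.
rewrite -[n%:R]/(n%:Z%:~R) -intrM ler_int.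
by move: q0 q0' s; clear; nia.
Qed.

Notation cell m k := ('I_k * 'I_k * (('I_m * 'I_m) * ('I_m * 'I_m)))%type.

Section Grid.
Variables (R : realType) (m : nat).
Hypothesis m_gt0 : (0 < m)%N.
Variable A : {set 'I_m * 'I_m}.
Let D := @Dset R m m_gt0 A.
Let S := @Sset R m m_gt0 A.
Variables (alpha c del : R) (e K0 k : nat).
Hypotheses (al0 : 0 < alpha) (c1 : 1 <= c) (e1 : (1 < e)%N) (K04 : (3 < K0)%N).
Hypotheses (kE : k = (e * K0)%N) (del0 : 0 < del) (del4 : del <= 4^-1).
Hypothesis stable : forall x y x' y' z1 z b M1 M2 M3 M4,
  2^-1 <= z1 -> z <= c + 1 -> 0 <= b <= alpha + 1 ->
  e%:R^-1 <= x <= 1 -> e%:R^-1 <= y <= 1 -> e%:R^-1 <= x' <= 1 -> e%:R^-1 <= y' <= 1 ->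
  `|x' - x| <= k%:R^-1 -> `|y' - y| <= k%:R^-1 ->
  D x y z1 z b M1 M2 M3 M4 `<=` D x' y' (z1 - del) (z + del) (b + del) M1 M2 M3 M4.

(** Since [k = e * K0], the indices [a >= K0] are those with [grid_lo a >= 1 / e], away from the
    small denominators. *)
Definition grid_lo (a : 'I_k) : R := a%:R / k%:R.
Definition grid_hi (a : 'I_k) : R := a.+1%:R / k%:R.
Implicit Types C : cell m k.

Let M1 C : int := (nat_of_ord C.2.1.1)%:Z.
Let M2 C : int := (nat_of_ord C.2.1.2)%:Z.
Let M3 C : int := (nat_of_ord C.2.2.1)%:Z.
Let M4 C : int := (nat_of_ord C.2.2.2)%:Z.

(* D at the corner of the cell, with parameters enlarged by del: it contains D for
   the true parameters and is contained in D for parameters enlarged by 2 del, at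
   every point of the cell. *)
Definition cell_set C : set R :=
  D (grid_lo C.1.1) (grid_lo C.1.2) (1 - del) (c + del) (alpha + del) (M1 C) (M2 C) (M3 C) (M4 C).

(** A tile with [x = q / n] and [y = q' / n] meets the approximation set in measure
    [lam D / (x * y * n ^+ 2)]; the factor [n ^+ 2] is left to the sums. *)
Definition cell_weight C : R := lam (cell_set C) / (grid_lo C.1.1 * grid_lo C.1.2).

Definition cell_ok C : bool :=
  [&& (K0 <= C.1.1)%N, (K0 <= C.1.2)%N & (m %| M3 C * M2 C - M1 C * M4 C - 1)%Z].

Definition cell_bases C (s t : R) (n : nat) :=
  bases m (grid_lo C.1.1) (grid_hi C.1.1) (grid_lo C.1.2) (grid_hi C.1.2)
    (M1 C) (M2 C) (M3 C) (M4 C) s t n%:R.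

Let K00 : (0 < K0)%N. Proof. exact: leq_trans K04. Qed.
Let e0 : (0 < e)%N. Proof. exact: leq_trans e1. Qed.
Let k0 : (0 < k)%N. Proof. by rewrite kE muln_gt0 e0. Qed.
Let kR : (0 : R) < k%:R. Proof. by rewrite ltr0n. Qed.

Lemma grid_lo_ge (a : 'I_k) : (K0 <= a)%N -> e%:R^-1 <= grid_lo a.
Proof.
move=> h; rewrite /grid_lo ler_pdivlMr// (_ : k%:R = e%:R * K0%:R :> R).
  by rewrite mulKf ?ler_nat// pnatr_eq0 -lt0n.
by rewrite kE natrM.
Qed.

Lemma grid_lo_gt0 (a : 'I_k) : (K0 <= a)%N -> 0 < grid_lo a.
Proof. by move/grid_lo_ge; apply: lt_le_trans; rewrite invr_gt0 ltr0n. Qed.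

Lemma grid_hiE (a : 'I_k) : grid_hi a = grid_lo a + k%:R^-1.
Proof. by rewrite /grid_hi /grid_lo -natr1 mulrDl mul1r. Qed.

Lemma grid_lo_lt_hi (a : 'I_k) : grid_lo a < grid_hi a.
Proof. by rewrite grid_hiE ltrDl invr_gt0. Qed.

Lemma grid_hi_le1 (a : 'I_k) : grid_hi a <= 1.
Proof. by rewrite /grid_hi ler_pdivrMr// mul1r ler_nat. Qed.

Lemma cell_weight_ge0 C : cell_ok C -> 0 <= cell_weight C.
Proof.
move=> /and3P[/grid_lo_gt0 h1 /grid_lo_gt0 h2 _].
by apply: divr_ge0; [exact: lam_ge0|apply: mulr_ge0; exact: ltW].
Qed.

Lemma cell_weight_le C : cell_ok C -> cell_weight C <= e%:R ^+ 2.
Proof.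
move=> /and3P[a1 a2 _]; have h1 := grid_lo_ge a1; have h2 := grid_lo_ge a2.
have l1 := grid_lo_gt0 a1; have l2 := grid_lo_gt0 a2.
have lX : lam (cell_set C) <= 1.
  have := @lam_itv_le _ (cell_set C) 0 1 (bmeas_Dset m_gt0 A _ _ _ _ _ _ _ _ _).1 ler01.
  by rewrite subr0; apply; exact: Dset_itv.
have eR : (0 : R) < e%:R by rewrite ltr0n.
rewrite /cell_weight ler_pdivrMr; last exact: (mulr_gt0 l1 l2).
apply: (le_trans lX).
have := ler_pM (ltW (lt_le_trans _ (lexx e%:R^-1))) (ltW (lt_le_trans _ (lexx e%:R^-1))) h1 h2.
rewrite invr_gt0 => /(_ eR eR) h.
have := ler_wpM2l (ltW (exprn_gt0 2 eR)) h; apply: le_trans.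
by rewrite -invfM -expr2 mulfV// expf_neq0// gt_eqF.
Qed.

Lemma near_grid_lo (a : 'I_k) x : (K0 <= a)%N -> grid_lo a < x <= grid_hi a ->
  [/\ e%:R^-1 <= x <= 1, e%:R^-1 <= grid_lo a <= 1, `|grid_lo a - x| <= k%:R^-1 &
     `|x - grid_lo a| <= k%:R^-1].
Proof.
move=> /grid_lo_ge h /andP[h1 h2]; have h3 := grid_hi_le1 a; rewrite grid_hiE in h2 h3.
have k1 : (0 : R) < k%:R^-1 by rewrite invr_gt0.
split; [apply/andP; split|apply/andP; split| |].
- exact: le_trans h (ltW h1).
- exact: le_trans h2 h3.
- exact: h.
- by apply: le_trans h3; rewrite lerDl ltW.
- by rewrite ler0_norm; lra.
- by rewrite ger0_norm; lra.
Qed.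

Lemma cell_set_sub C x y : cell_ok C -> grid_lo C.1.1 < x <= grid_hi C.1.1 ->
  grid_lo C.1.2 < y <= grid_hi C.1.2 ->
  D x y 1 c alpha (M1 C) (M2 C) (M3 C) (M4 C) `<=` cell_set C.
Proof.
move=> /and3P[a1 a2 _] /(near_grid_lo a1)[hx lx dx _] /(near_grid_lo a2)[hy ly dy _].
by apply: stable => //; [lra|lra|rewrite (ltW al0) lerDl ler01].
Qed.

Lemma sub_cell_set C x y : cell_ok C -> grid_lo C.1.1 < x <= grid_hi C.1.1 ->
  grid_lo C.1.2 < y <= grid_hi C.1.2 -> cell_set C `<=`
  D x y (1 - 2 * del) (c + 2 * del) (alpha + 2 * del) (M1 C) (M2 C) (M3 C) (M4 C).
Proof.
move=> /and3P[a1 a2 _] /(near_grid_lo a1)[hx lx _ dx] /(near_grid_lo a2)[hy ly _ dy].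
have E (z : R) : z + 2 * del = z + del + del by ring.
have E' : 1 - 2 * del = 1 - del - del by ring.
have h0 : 0 <= alpha + del by rewrite addr_ge0 ?(ltW al0) ?(ltW del0).
have h4 := del4; rewrite !E E'; apply: stable => //.
- by lra.
- by lra.
- by rewrite h0/= lerD2l; lra.
Qed.

Lemma cell_exists (n : nat) (p q p' q' : int) : (0 < n)%N -> p' * q - p * q' = 1 ->
  0 < q <= n%:Z -> 0 < q' <= n%:Z -> n%:Z < q + q' -> n%:Z < q * e%:Z ->
  n%:Z < q' * e%:Z -> exists C, [/\ cell_ok C, (k <= C.1.1 + C.1.2 + 1)%N,
    n%:R * grid_lo C.1.1 < q%:~R <= n%:R * grid_hi C.1.1,
    n%:R * grid_lo C.1.2 < q'%:~R <= n%:R * grid_hi C.1.2 &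
    [/\ (m %| p - M1 C)%Z, (m %| q - M2 C)%Z, (m %| p' - M3 C)%Z & (m %| q' - M4 C)%Z]].
Proof.
move=> n0 d qn qn' s eq eq'.
have [a Ka qa] := cell_index R n0 kE K00 qn eq.
have [b Kb qb] := cell_index R n0 kE K00 qn' eq'.
have r x := (residuezP m_gt0 x (residuez m_gt0 x)).1 erefl.
exists (a, b, ((residuez m_gt0 p, residuez m_gt0 q), (residuez m_gt0 p', residuez m_gt0 q'))).
split; [|simpl|exact: qa|exact: qb|split; exact: r].
  rewrite /cell_ok/= Ka Kb/= /M1 /M2 /M3 /M4/= -d.
  have := r p; have := r q; have := r p'; have := r q'.
  set r1 := (nat_of_ord (residuez m_gt0 p))%:Z; set r2 := (nat_of_ord (residuez m_gt0 q))%:Z.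
  set r3 := (nat_of_ord (residuez m_gt0 p'))%:Z; set r4 := (nat_of_ord (residuez m_gt0 q'))%:Z.
  move=> /dvdzP[u4 E4] /dvdzP[u3 E3] /dvdzP[u2 E2] /dvdzP[u1 E1]; apply/dvdzP.
  exists (u1 * q' + r1 * u4 - u3 * q - r3 * u2).
  rewrite [LHS](_ : _ = (p - r1) * q' + r1 * (q' - r4) - (p' - r3) * q - r3 * (q - r2));
    last by ring.
  by rewrite E1 E2 E3 E4; ring.
move/andP: qa => [_ qa]; move/andP: qb => [_ qb].
have nR : (0 : R) < n%:R by rewrite ltr0n.
have : n%:R < n%:R * grid_hi a + n%:R * grid_hi b.
  apply: (@lt_le_trans _ _ (q%:~R + q'%:~R)); last exact: lerD.
  by rewrite -rmorphD/= -[n%:R]/(n%:Z%:~R) ltr_int.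
rewrite -mulrDr ltr_pMr// /grid_hi -mulrDl ltr_pdivlMr// mul1r -natrD ltr_nat.
by rewrite addSn addnS ltnS addn1.
Qed.

Lemma bases_finite_cell C s t n : (0 < n)%N -> s <= t -> cell_ok C ->
  finite_set (cell_bases C s t n).
Proof.
move=> n0 st /and3P[a1 a2 _].
have nR : (0 : R) < n%:R by rewrite ltr0n.
by have [] := bases_bound m_gt0 (M1 C) (M2 C) (M3 C) (M4 C) (grid_lo_gt0 a1)
  (ltW (grid_lo_lt_hi C.1.1)) (grid_lo_gt0 a2) (ltW (grid_lo_lt_hi C.1.2)) st nR.
Qed.

(* Adjacent denominators satisfy q + q' > n: an upper cell meets this half-plane, a
   lower cell lies inside it. *)
Definition upper_cell C := cell_ok C && (k <= C.1.1 + C.1.2 + 1)%N.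
Definition lower_cell C := cell_ok C && (k <= C.1.1 + C.1.2)%N.

(** Tiles are selected by their left end in [[s, t[], so the one straddling [s] is missed; its
    length is at most [1 / n]. Any other point lies in a tile of an upper cell or in one with a
    small denominator, which [leftover_bound] handles. *)
Lemma grid_upper (n : nat) (s t : R) : (0 < n)%N -> 0 <= s -> s <= t -> t <= 1 ->
  lam (`[s, t[%classic `&` S 1 c alpha n) <=
  n%:R^-1 + (24 / e%:R + 24 / n%:R) +
  \sum_(C | upper_cell C) (cnt (cell_bases C s t n))%:R * (cell_weight C / n%:R ^+ 2).
Proof.
move=> n0 s0 st t1; set E0 := _ `&` _.
have nR : (0 : R) < n%:R by rewrite ltr0n.
have ni : (0 : R) < n%:R^-1 by rewrite invr_gt0.
have mE0 : measurable (E0 : set (measurableTypeR R)).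
  by apply: measurableI; [exact: measurable_itv|exact: measurable_Sset].
have E01 : E0 `<=` `[0, 1].
  move=> x [/=]; rewrite !in_itv/= => /andP[h1 h2] _.
  by rewrite (le_trans s0 h1) (le_trans (ltW h2) t1).
have bE0 : bmeas E0 by exact: bmeas_itv E01.
pose F0 : set R := `[s, s + n%:R^-1]%classic.
pose T (g : int * int * int * int) : set R :=
  tile g.1.1.1 g.1.1.2 g.1.2 g.2 `&` S 1 c alpha n.
pose F C := E0 `&` \bigcup_(g in cell_bases C s t n) T g.
pose G := \bigcup_(C in [set C | upper_cell C]) F C.
have pos C g : cell_ok C -> cell_bases C s t n g -> 0 < g.1.1.2 /\ 0 < g.2.
  by move=> /and3P[a1 a2 _]; apply: basis_pos nR; exact: grid_lo_gt0.
have fin C : cell_ok C -> finite_set (cell_bases C s t n) by exact: bases_finite_cell.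
have bT C g : cell_ok C -> cell_bases C s t n g -> bmeas (T g).
  by move=> hC hg; have [h1 h2] := pos _ _ hC hg; exact: bmeas_tile_Sset.
have mF C : cell_ok C -> measurable (F C : set (measurableTypeR R)).
  move=> hC; apply: measurableI => //; apply: fin_bigcup_measurable; first exact: fin.
  by move=> g hg; case: (bT _ _ hC hg).
have bF C : cell_ok C -> bmeas (F C).
  by move=> hC; apply: bmeas_sub bE0; [exact: mF|exact: subIsetl].
have mG : measurable (G : set (measurableTypeR R)).
  apply: fin_bigcup_measurable; first exact: finite_finset.
  by move=> C /andP[hC _]; exact: mF.
have bG : bmeas G by apply: bmeas_sub bE0 => // x [C _ []].
pose L := E0 `\` (F0 `|` G).
have mL : measurable (L : set (measurableTypeR R)).
  by apply: measurableD => //; apply: measurableU => //; exact: measurable_itv.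
have bL : bmeas L by apply: bmeas_sub bE0 => // x [].
have bGL : bmeas (G `|` L).
  by apply: bmeas_sub bE0 => [|x [[C _ []]|[]]//]; exact: measurableU.
have lG : lam G <=
    \sum_(C | upper_cell C) (cnt (cell_bases C s t n))%:R * (cell_weight C / n%:R ^+ 2).
  apply: (lam_cover_fin (F := F)) => //.
  - by move=> C /andP[hC _]; exact: bF.
  - move=> C /andP[hC _]; apply: (lam_cover_const (F := T)).
    + exact: mF.
    + exact: fin.
    + by move=> g; exact: bT.
    + move=> g hg; have /and3P[a1 a2 _] := hC.
      apply: (cell_upper n0 (grid_lo_gt0 a1) (grid_lo_gt0 a2) ltr01 _ _ hg).
        exact: bmeas_Dset.
      by move=> x y hx hy; exact: cell_set_sub.
    + by move=> x [].
have lL : lam L <= 24 / e%:R + 24 / n%:R.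
  apply: leftover_bound => // [x []|xi [Exi nFG]]; first by move=> /E01.
  have := Exi; rewrite /E0 /= in_itv/= => -[/andP[sxi xit] Sxi].
  have n1 : n.-1.+1 = n by rewrite prednK.
  have := @farey_cover R (fun p q => 0 <= p) _ _ n.-1 xi (le_trans s0 sxi).
  rewrite n1; case=> //.
    by clear=> p q p' q'; nia.
  move=> p [q [p' [q' [d qn qn' sum [t1' [t2 p0]]]]]].
  have tl : tile p q p' q' xi by split.
  have /andP[q0 _] := qn; have /andP[q0' _] := qn'.
  exists p, q, p', q'; split => //; split => //.
  have [small|big] := leP (q * e%:Z) n%:Z; first by left.
  have [small|big'] := leP (q' * e%:Z) n%:Z; first by right.
  exfalso; apply: nFG.
  have [small|far] := leP xi (s + n%:R^-1).
    by left; rewrite /F0/= in_itv/= sxi.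
  right; have [C [hC kC hq hq' cong]] := cell_exists n0 d qn qn' sum big big'.
  exists C; first by rewrite /= /upper_cell hC kC.
  split => //; exists (p, q, p', q'); last by split.
  have a : (0 : R) < q%:~R by rewrite ltr0z.
  have b : (0 : R) < q'%:~R by rewrite ltr0z.
  split => //=; apply/andP; split; last first.
    by apply: le_lt_trans t1' _; rewrite ltr_pM2r.
  have [_ _ h1 _] := tile_sum q0 q0' d tl.
  have h2 := farey_area R n0 q0 q0' sum.
  have h3 : xi * q%:~R - p%:~R <= q%:~R * n%:R^-1.
    rewrite -ler_pdivlMr// in h1; apply: le_trans h1 _.
    rewrite mul1r (_ : q'%:~R^-1 = q%:~R * (q%:~R * q'%:~R)^-1 :> R).
      by rewrite ler_pM2l.
    by field; rewrite !gt_eqF.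
  have h4 : (s + n%:R^-1) * q%:~R <= xi * q%:~R by rewrite ler_pM2r// ltW.
  by lra.
have h1 := lam_cover2 mE0 (bmeas_cc s (s + n%:R^-1)) bGL.
have h2 := lam_cover2 (measurableU _ _ mG mL) bG bL (fun x h => h).
have h3 := @lam_cc R s (s + n%:R^-1).
have {}h3 : lam F0 <= n%:R^-1.
  by apply: le_trans (h3 _) _; [rewrite lerDl ltW|rewrite addrAC subrr add0r].
have {}h1 : lam E0 <= lam F0 + lam (G `|` L).
  apply: h1 => x Ex; have [hF|nF] := pselect (F0 x); first by left.
  have [hG|nG] := pselect (G x); first by right; left.
  by right; right; split => // -[].
by lra.
Qed.

(** In a lower cell every matrix has [q + q' > n] and both denominators at most [n], so
    [tile_unique] applies. *)
Lemma cell_disjoint (n : nat) (s t xi : R) C C' g g' : (0 < n)%N ->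
  lower_cell C -> lower_cell C' ->
  cell_bases C s t n g -> cell_bases C' s t n g' ->
  tile g.1.1.1 g.1.1.2 g.1.2 g.2 xi -> tile g'.1.1.1 g'.1.1.2 g'.1.2 g'.2 xi ->
  C = C' /\ g = g'.
Proof.
move=> n0 hC hC' hg hg' tg tg'; have nR : (0 : R) < n%:R by rewrite ltr0n.
have farey C0 g0 : lower_cell C0 -> cell_bases C0 s t n g0 ->
    [/\ 0 < g0.1.1.2 <= n%:Z, 0 < g0.2 <= n%:Z & n%:Z < g0.1.1.2 + g0.2].
  move=> /andP[/and3P[a1 a2 _] ab] g0P.
  have [q0 q0'] := basis_pos (grid_lo_gt0 a1) (grid_lo_gt0 a2) nR g0P.
  case: g0P => _ _ /andP[h1 h2] /andP[h3 h4] _; rewrite q0 q0'/=.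
  have le a : n%:R * grid_hi a <= n%:R by rewrite ler_piMr ?(ltW nR)// grid_hi_le1.
  split.
  - by rewrite -(ler_int R); exact: le_trans h2 (le _).
  - by rewrite -(ler_int R); exact: le_trans h4 (le _).
  rewrite -(ltr_int R) rmorphD/=; apply: le_lt_trans (ltrD h1 h3).
  rewrite -mulrDr ler_peMr ?(ltW nR)// /grid_lo -mulrDl ler_pdivlMr// mul1r -natrD.
  by rewrite ler_nat.
have [f1 f2 f3] := farey _ _ hC hg; have [f1' f2' f3'] := farey _ _ hC' hg'.
have [e1' e2' e3' e4'] : [/\ g.1.1.1 = g'.1.1.1, g.1.1.2 = g'.1.1.2, g.1.2 = g'.1.2 & g.2 = g'.2].
  case: hg hg' => d _ _ _ _ [d' _ _ _ _].
  exact: (tile_unique f1 f2 f3 d f1' f2' f3' d' tg tg').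
have gg : g = g'.
  by case: g g' e1' e2' e3' e4' {hg hg' tg tg' f1 f2 f3 f1' f2' f3'}
    => [[[p q] p'] q'] [[[p1 q1] p1'] q1'] /= -> -> -> ->.
split => //; rewrite -gg {g' gg e1' e2' e3' e4' tg' f1' f2' f3'} in hg' *.
have idx (a b : 'I_k) (q : R) : n%:R * grid_lo a < q <= n%:R * grid_hi a ->
    n%:R * grid_lo b < q <= n%:R * grid_hi b -> a = b.
  have le (x y : 'I_k) : n%:R * grid_lo x < q -> q <= n%:R * grid_hi y -> (x <= y)%N.
    move=> h1 h2; have := lt_le_trans h1 h2.
    by rewrite ltr_pM2l// /grid_lo /grid_hi ltr_pM2r ?invr_gt0// ltr_nat ltnS.
  move=> /andP[h1 h2] /andP[h3 h4]; apply/val_inj/eqP => /=.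
  by rewrite eqn_leq (le _ _ h1 h4) (le _ _ h3 h2).
case: hg hg' => _ _ q1 q2 [m1 m2 m3 m4] [_ _ q1' q2' [m1' m2' m3' m4']].
have ri (x : int) (i j : 'I_m) : (m %| x - (nat_of_ord i)%:Z)%Z ->
    (m %| x - (nat_of_ord j)%:Z)%Z -> i = j.
  by move=> /residuezP <- /residuezP <-.
have I1 := idx _ _ _ q1 q1'; have I2 := idx _ _ _ q2 q2'.
have I3 := ri _ _ _ m1 m1'; have I4 := ri _ _ _ m2 m2'.
have I5 := ri _ _ _ m3 m3'; have I6 := ri _ _ _ m4 m4'.
case: C C' I1 I2 I3 I4 I5 I6 {hC hC' q1 q2 q1' q2' m1 m2 m3 m4 m1' m2' m3' m4'}
  => [[a b] [[r1 r2] [r3 r4]]] [[a' b'] [[r1' r2'] [r3' r4']]] /=.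
by move=> -> -> -> -> -> ->.
Qed.

(** [cell_weight] divides by the product at the lower corner, whereas a lower bound needs the upper
    corner. Their ratio is at most [(1 + u) ^+ 2] with [u = 1 / K0], and
    [(1 - 2 * u) * (1 + u) ^+ 2 <= 1]. A tile whose left end is below [t] may go beyond [t] by
    [1 / n]. *)
Lemma grid_lower (n : nat) (s t : R) : (0 < n)%N -> s <= t ->
  (1 - 2 / K0%:R) *
  \sum_(C | lower_cell C) (cnt (cell_bases C s t n))%:R * (cell_weight C / n%:R ^+ 2) <=
  lam (`[s, t + n%:R^-1]%classic `&`
    S (1 - 2 * del) (c + 2 * del) (alpha + 2 * del) n).
Proof.
move=> n0 st; have nR : (0 : R) < n%:R by rewrite ltr0n.
have ni : (0 : R) < n%:R^-1 by rewrite invr_gt0.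
set S2 := S _ _ _ n; set E := _ `&` _.
have bE : bmeas E.
  apply: (@bmeas_itv _ _ s (t + n%:R^-1)); last exact: subIsetl.
  by apply: measurableI; [exact: measurable_itv|exact: measurable_Sset].
pose T (g : int * int * int * int) : set R := tile g.1.1.1 g.1.1.2 g.1.2 g.2 `&` S2.
pose F C := \bigcup_(g in cell_bases C s t n) T g.
have pos C g : cell_ok C -> cell_bases C s t n g -> 0 < g.1.1.2 /\ 0 < g.2.
  by move=> /and3P[a1 a2 _]; apply: basis_pos nR; exact: grid_lo_gt0.
have fin C : cell_ok C -> finite_set (cell_bases C s t n) by exact: bases_finite_cell.
have bT C g : cell_ok C -> cell_bases C s t n g -> bmeas (T g).
  by move=> hC hg; have [h1 h2] := pos _ _ hC hg; exact: bmeas_tile_Sset.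
have mF C : cell_ok C -> measurable (F C : set (measurableTypeR R)).
  move=> hC; apply: fin_bigcup_measurable; first exact: fin.
  by move=> g hg; case: (bT _ _ hC hg).
have FE C : lower_cell C -> F C `<=` E.
  move=> /[dup] hC' /andP[hC ab] xi [g hg [tl Sx]]; split => //.
  have [q0 q0'] := pos _ _ hC hg; have /and3P[a1 a2 _] := hC.
  case: hg => d /andP[l1 l2] /andP[hq _] /andP[hq' _] _.
  have sum : n%:Z < g.1.1.2 + g.2.
    rewrite -(ltr_int R) rmorphD/=; apply: le_lt_trans (ltrD hq hq').
    rewrite -mulrDr ler_peMr ?(ltW nR)// /grid_lo -mulrDl ler_pdivlMr// mul1r -natrD.
    by rewrite ler_nat.
  have area := farey_area R n0 q0 q0' sum.
  have a : (0 : R) < g.1.1.2%:~R by rewrite ltr0z.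
  have b : (0 : R) < g.2%:~R by rewrite ltr0z.
  have [_ _ h1 _] := tile_sum q0 q0' d tl; case: tl => t1 t2.
  rewrite /= in_itv/=; apply/andP; split.
    by rewrite -(ler_pM2r a); exact: le_trans l1 t1.
  rewrite (_ : xi = g.1.1.1%:~R / g.1.1.2%:~R +
    ((xi * g.1.1.2%:~R - g.1.1.1%:~R) * g.2%:~R) / (g.1.1.2%:~R * g.2%:~R)); last first.
    by field; rewrite !gt_eqF.
  apply: lerD; first by rewrite ler_pdivrMr// ltW.
  by apply: le_trans area; rewrite ler_piMl// invr_ge0 mulr_ge0// ltW.
have K0R : (4 : R) <= K0%:R by rewrite ler_nat.
rewrite mulr_sumr; apply: (lam_packing_fin (F := F)) => //.
- move=> C C' xi hC hC' [g hg [tg _]] [g' hg' [tg' _]].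
  by have [] := cell_disjoint n0 hC hC' hg hg' tg tg'.
- by move=> C /andP[hC _]; exact: mF.
- move=> C hC; have /andP[okC ab] := hC; have /and3P[a1 a2 _] := okC.
  rewrite mulrCA; apply: (lam_packing_const (F := T)).
  + apply: bmeas_sub bE; [exact: mF|exact: FE].
  + exact: fin.
  + move=> g g' hg hg' [xi [[tg _] [tg' _]]].
    by have [] := cell_disjoint n0 hC hC hg hg' tg tg'.
  + by move=> g hg; case: (bT _ _ okC hg).
  + move=> g hg; have d4 := del4.
    have z0 : 0 < 1 - 2 * del by lra.
    have l1 := grid_lo_gt0 a1; have l2 := grid_lo_gt0 a2.
    apply: le_trans (cell_lower n0 l1 l2 z0 _ _ hg); last first.
    * by move=> x y hx hy; exact: sub_cell_set.
    * exact: bmeas_Dset.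
    rewrite mulrA ler_pM2r ?invr_gt0 ?exprn_gt0// /cell_weight mulrCA.
    apply: ler_wpM2l; first exact: lam_ge0.
    have h1 := lt_trans l1 (grid_lo_lt_hi C.1.1); have h2 := lt_trans l2 (grid_lo_lt_hi C.1.2).
    rewrite ler_pdivrMr; last exact: (mulr_gt0 l1 l2).
    rewrite [leRHS]mulrC ler_pdivlMr; last exact: (mulr_gt0 h1 h2).
    pose u : R := K0%:R^-1.
    have u0 : 0 < u by rewrite invr_gt0; lra.
    have u4 : u <= 4^-1 by rewrite lef_pV2 ?posrE//; lra.
    have hil (a : 'I_k) : (K0 <= a)%N -> grid_hi a <= grid_lo a * (1 + u).
      move=> aK; rewrite grid_hiE mulrDr mulr1 lerD2l /grid_lo -mulrA [_^-1 * u]mulrC mulrA.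
      have au : 1 <= (nat_of_ord a)%:R * u :> R.
        by rewrite ler_pdivlMr ?mul1r ?ler_nat// (lt_le_trans _ K0R).
      by rewrite ler_peMl// invr_ge0 ltW.
    have p1 : 0 <= 1 - 2 * u by lra.
    have hh : grid_hi C.1.1 * grid_hi C.1.2 <=
        (grid_lo C.1.1 * (1 + u)) * (grid_lo C.1.2 * (1 + u)).
      by apply: ler_pM (ltW h1) (ltW h2) (hil _ a1) (hil _ a2).
    have := ler_wpM2l p1 hh; rewrite -/u => h; apply: (le_trans h).
    have ll := mulr_gt0 l1 l2.
    rewrite [leLHS](_ : _ =
      (grid_lo C.1.1 * grid_lo C.1.2) * (1 - (3 + 2 * u) * u ^+ 2)); last by ring.
    rewrite ler_piMr ?(ltW ll)// gerBl; apply: mulr_ge0; first by lra.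
    by rewrite exprn_ge0// ltW.
  + by move=> g hg x Tx; exists g.
Qed.

End Grid.

(** * Summation over the grid *)

Lemma diagonal_cells (m k K0 : nat) :
  (0 < k)%N -> (0 < m)%N ->
  (#|[pred C : cell m k | upper_cell K0 C && ~~ lower_cell K0 C]| <= k * (m * m * (m * m)))%N.
Proof.
move=> k0 m0; pose f (C : cell m k) := (C.1.1, C.2).
set P := [pred C | _].
(* The indices satisfy [a + b + 1 = k], so [a] determines [b]. *)
have fI : {in P &, injective f}.
  move=> [[a b] r] [[a' b'] r'].
  rewrite !inE /upper_cell /lower_cell /= => /andP[/andP[-> /= h1] h2].
  move=> /andP[/andP[-> /= h3] h4] [E <-]; rewrite -E in h3 h4 *.
  by congr (_, _, _); apply/val_inj => /=; move: h1 h2 h3 h4; clear; lia.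
rewrite -(card_in_image fI); apply: leq_trans (max_card _) _.
by rewrite !card_prod !card_ord.
Qed.

(** [W] is chosen from [eps], before [s] and [t]; this makes the limit proportional to the length.
    The order of choice is [del] (enlargement), [e] (small denominators), [K0] (stability at scale
    [1 / k], diagonal cells, ratio of corners), and [n] last. *)
Lemma window_density (R : realType) (m : nat) (m_gt0 : (0 < m)%N) (A : {set 'I_m * 'I_m})
  (alpha c eps : R) : 0 < alpha -> 1 <= c -> 0 < eps ->
  exists W : R, forall s t : R, 0 <= s -> s <= t -> t <= 1 ->
  exists N : nat, forall n, (N <= n)%N ->
  `|lam (`[s, t[%classic `&` Sset m_gt0 A 1 c alpha n) - (t - s) * W| <= eps.
Proof.
move=> al0 c1 eps0.
have [K Kge0 fuzz] := fuzz_bound m_gt0 A al0 c1.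
have [rho rho0 dens] := @bases_density R m m_gt0.
have eps10 : 0 < eps / 10 by lra.
have [del del0 [del4 delK _]] := exists_small (ltac:(lra) : 0 < 4^-1 :> R)
  (divr_gt0 eps10 (ltr_wpDl Kge0 ltr01)) (@ltr01 R).
have {}delK : K * del <= eps / 10.
  rewrite ler_pdivlMr ?ltr_wpDl// in delK; apply: le_trans delK.
  by rewrite mulrC ler_wpM2l ?(ltW del0)// lerDl.
have q0 : 0 <= 24 / (eps / 10) by rewrite divr_ge0// ltW.
have [e e0 he] := exists_nat_gt (24 / (eps / 10) + 1).
have e1 : (1 < e)%N by rewrite -(ltr_nat R); lra.
have eR : (0 : R) < e%:R by rewrite ltr0n.
have err_e : 24 / e%:R <= eps / 10.
  by rewrite ler_pdivrMr// mulrC -ler_pdivrMr//; lra.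
have ei : (0 : R) < e%:R^-1 by rewrite invr_gt0.
have [k0 k00 stable] := Dset_stable m_gt0 A (ltac:(lra) : 0 < c + 1)
  (ltac:(lra) : 0 < alpha + 1) ei del0.
(* At most [k * m ^ 4] cells are diagonal, each of weight at most [e ^+ 2] and with matrix density
   [rho / k ^+ 2]; together they contribute at most [B / k]. *)
pose B : R := rho * (m * m * (m * m))%:R * e%:R ^+ 2.
have B0 : 0 <= B by rewrite !mulr_ge0// exprn_ge0// ltW.
have p1 : 0 <= B / (eps / 10) by rewrite divr_ge0// ltW.
have p2 : 0 <= 8 / (eps / 10) by rewrite divr_ge0// ltW.
have p3 : 0 <= k0^-1 by rewrite invr_ge0 ltW.
have [K0 K00 hK0] := exists_nat_gt (B / (eps / 10) + 8 / (eps / 10) + k0^-1 + 4).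
have K0R : (0 : R) < K0%:R by rewrite ltr0n.
have K04 : (3 < K0)%N by rewrite -(ltr_nat R); lra.
pose k := (e * K0)%N.
have kE : k = (e * K0)%N by [].
have kgt0 : (0 < k)%N by rewrite muln_gt0 e0.
have kR : (0 : R) < k%:R by rewrite ltr0n.
have kK : K0%:R <= k%:R :> R by rewrite ler_nat leq_pmull.
have kk0 : k%:R^-1 <= k0.
  by rewrite -[k0]invrK lef_pV2 ?posrE ?invr_gt0//; lra.
have ki : (0 : R) < k%:R^-1 by rewrite invr_gt0.
have err_B : B / k%:R <= eps / 10.
  by rewrite ler_pdivrMr// mulrC -ler_pdivrMr//; clear -hK0 kK p1 p2 p3; lra.
have err_K : 8 / K0%:R <= eps / 10.
  by rewrite ler_pdivrMr// mulrC -ler_pdivrMr//; clear -hK0 p1 p2 p3; lra.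
move: (stable _ ki kk0) => {}stable.
pose w C := cell_weight m_gt0 A alpha c del (k := k) C.
pose v : R := rho * (k%:R^-1 * k%:R^-1).
have v0 : 0 <= v by rewrite mulr_ge0// mulr_ge0// ltW.
pose W1 := \sum_(C | upper_cell K0 C) v * w C.
pose W2 := \sum_(C | lower_cell K0 C) v * w C.
have okw C : cell_ok K0 C -> 0 <= w C.
  exact: (cell_weight_ge0 m_gt0 A alpha c del e1 K04 kE).
have okw2 C : cell_ok K0 C -> w C <= e%:R ^+ 2.
  exact: (cell_weight_le m_gt0 A alpha c del e1 K04 kE).
pose diag := [pred C : cell m k | upper_cell K0 C && ~~ lower_cell K0 C].
pose W3 := \sum_(C in diag) v * w C.
have W123 : W1 = W2 + W3.
  rewrite /W1 (bigID (fun C => lower_cell K0 C))/=; congr (_ + _).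
  apply: eq_bigl => C; rewrite /upper_cell /lower_cell.
  case: (cell_ok K0 C) => //=; apply/idP/idP => [/andP[]//|h].
  by rewrite h (leq_trans h)// leq_addr.
have W30 : 0 <= W3.
  by apply: sumr_ge0 => C /andP[/andP[hC _] _]; apply: mulr_ge0 => //; exact: okw.
have W3B : W3 <= eps / 10.
  apply: le_trans err_B; apply: (@le_trans _ _ (\sum_(C in diag) v * e%:R ^+ 2)).
    by apply: ler_sum => C /andP[/andP[hC _] _]; apply: ler_wpM2l => //; exact: okw2.
  rewrite sumr_const -[leLHS]mulr_natr.
  have ve : 0 <= v * e%:R ^+ 2 by rewrite mulr_ge0// exprn_ge0// ltW.
  apply: (@le_trans _ _ (v * e%:R ^+ 2 * (k * (m * m * (m * m)))%:R)).
    by rewrite ler_wpM2l// ler_nat diagonal_cells.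
  by rewrite le_eqVlt /B /v natrM; apply/orP; left; apply/eqP; field; rewrite gt_eqF.
have dv (P : pred (cell m k)) s t : (forall C, P C -> cell_ok K0 C) -> 0 <= s -> s <= t ->
    exists N : nat, forall n, (N <= n)%N ->
    `|\sum_(C | P C) (cnt (cell_bases C s t n))%:R * (w C / n%:R ^+ 2)
      - (t - s) * \sum_(C | P C) v * w C| <= eps / 10.
  move=> Pok s0 st.
  have [C PC e' e'0|N hN] := @weighted_density R _ P (fun C T =>
    (cnt (bases m (grid_lo R C.1.1) (grid_hi R C.1.1) (grid_lo R C.1.2) (grid_hi R C.1.2)
      (nat_of_ord C.2.1.1) (nat_of_ord C.2.1.2) (nat_of_ord C.2.2.1) (nat_of_ord C.2.2.2)
      s t T))%:R) (fun=> v * (t - s)) w _ _ eps10.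
    have /and3P[a1 a2 dt] := Pok _ PC.
    have l1 := grid_lo_gt0 R e1 K04 kE a1; have l2 := grid_lo_gt0 R e1 K04 kE a2.
    have [T0 T01 hT] := dens _ _ _ _ _ _ _ _ s t e' dt l1 (grid_lo_lt_hi R e1 K04 kE C.1.1)
      l2 (grid_lo_lt_hi R e1 K04 kE C.1.2) s0 st e'0.
    exists T0 => // T /hT.
    rewrite !grid_hiE [grid_lo _ C.1.1 + _ - _]addrAC [grid_lo _ C.1.2 + _ - _]addrAC.
    by rewrite !subrr !add0r.
  exists N => n /hN; rewrite [X in _ - X](_ : _ = (t - s) * \sum_(C | P C) v * w C)//.
  by rewrite mulr_sumr; apply: eq_bigr => C _; ring.
exists W1 => s t s0 st t1.
have uok (C : cell m k) : upper_cell K0 C -> cell_ok K0 C by case/andP.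
have lok (C : cell m k) : lower_cell K0 C -> cell_ok K0 C by case/andP.
have [N1 hN1] := dv _ s t uok s0 st; have [N2 hN2] := dv _ s t lok s0 st.
have q1 : 0 <= 25 / (eps / 10) by rewrite divr_ge0// ltW.
have q2 : 0 <= K / (eps / 10) by rewrite divr_ge0// ltW.
have [N3 N30 hN3] := exists_nat_gt (25 / (eps / 10) + K / (eps / 10) + 4).
exists (N1 + N2 + N3)%N => n hn.
have {}hN1 := hN1 n (leq_trans (leq_trans (leq_addr _ _) (leq_addr _ _)) hn).
have {}hN2 := hN2 n (leq_trans (leq_trans (leq_addl _ _) (leq_addr _ _)) hn).
have n3 : N3%:R <= n%:R :> R by rewrite ler_nat (leq_trans _ hn)// leq_addl.
have n4 : (3 < n)%N by rewrite -(ltr_nat R); clear -hN3 q1 q2 n3; lra.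
have n0 : (0 < n)%N by apply: leq_trans n4.
have nR : (0 : R) < n%:R by rewrite ltr0n.
have err_n : 25 / n%:R <= eps / 10.
  by rewrite ler_pdivrMr// mulrC -ler_pdivrMr//; clear -hN3 q1 q2 n3; lra.
have err_Kn : K / n%:R <= eps / 10.
  by rewrite ler_pdivrMr// mulrC -ler_pdivrMr//; clear -hN3 q1 q2 n3; lra.
have n1 : n%:R^-1 <= 1 :> R by rewrite invf_le1// ler1n.
have ni : 0 < n%:R^-1 :> R by rewrite invr_gt0.
have up := grid_upper al0 e1 K04 kE stable n0 s0 st t1.
have dn := grid_lower al0 e1 K04 kE del0 del4 stable n0 st.
have fz := fuzz del n del0 del4 n4.
set X1 := \sum_(C | upper_cell K0 C) _ in up hN1.
set X2 := \sum_(C | lower_cell K0 C) _ in dn hN2.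
set S1 := Sset _ _ 1 _ _ _ in up fz *; set S2 := Sset _ _ _ _ _ _ in dn fz.
set E := _ `&` S1 in up *; set F := _ `&` S2 in dn; set G := _ `&` (_ `\` _) in fz.
have mS1 : measurable (S1 : set (measurableTypeR R)) by exact: measurable_Sset.
have mS2 : measurable (S2 : set (measurableTypeR R)) by exact: measurable_Sset.
have bE : bmeas E.
  apply: (@bmeas_itv _ _ 0 1); first by apply: measurableI => //; exact: measurable_itv.
  move=> x [/=]; rewrite !in_itv/= => /andP[h1 h2] _.
  by rewrite (le_trans s0 h1) (le_trans (ltW h2) t1).
have bG : bmeas G.
  apply: (@bmeas_itv _ _ 0 1); last by move=> x [].
  by apply: measurableI; [exact: measurable_itv|exact: measurableD].
have mF : measurable (F : set (measurableTypeR R)).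
  by apply: measurableI => //; exact: measurable_itv.
have F2 : lam F <= 2.
  apply: le_trans (lam_itv_le mF (_ : s <= t + n%:R^-1) _) _.
  - by clear -st ni; lra.
  - exact: subIsetl.
  - by clear -n1 s0 t1; lra.
have bEG : bmeas (E `|` G).
  apply: (@bmeas_itv _ _ 0 1); first by apply: measurableU; [case: bE|case: bG].
  move=> x [[/= + _]|[]//]; rewrite !in_itv/= => /andP[h1 h2].
  by rewrite (le_trans s0 h1) (le_trans (ltW h2) t1).
have cover1 : lam F <= lam (E `|` G) + lam (`[t, t + n%:R^-1]%classic : set R).
  apply: lam_cover2 => //; first exact: bmeas_cc.
  move=> x [/=]; rewrite in_itv/= => /andP[h1 h2] Sx.
  have [xt|tx] := ltP x t; last by right; rewrite /= in_itv/= tx.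
  left; have [S1x|nS1] := pselect (S1 x); [left|right]; split => //=; rewrite in_itv/=.
    by rewrite h1.
  by rewrite (le_trans s0 h1) (le_trans (ltW xt) t1).
have cover2 := lam_cover2 bEG.1 bE bG (fun x h => h).
have tail := @lam_cc R t (t + n%:R^-1) ltac:(by rewrite lerDl ltW).
have X20 : 0 <= X2.
  apply: sumr_ge0 => C /lok /okw wC; apply: mulr_ge0 => //.
  by apply: divr_ge0 => //; exact: exprn_ge0.
pose u : R := K0%:R^-1.
have u0 : 0 < u by rewrite invr_gt0.
have u4 : u <= 4^-1 by rewrite lef_pV2 ?posrE ?ltr0n// ler_nat.
rewrite -/u in dn err_K.
(* From [(1 - 2 * u) * X2 <= lam F <= 2] and [u <= 1 / 4]. The factor [1 - 2 * u] thus costs an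
   additive [8 * u]. *)
have X24 : X2 <= 4.
  have := ler_wpM2r X20 u4; by move: dn F2; rewrite mulrBl mul1r -mulrA; clear; lra.
have uX : u * X2 <= u * 4 by rewrite ler_wpM2l// ltW.
rewrite -/W1 in hN1; rewrite -/W2 in hN2.
have ts : 0 <= t - s <= 1 by clear -s0 st t1; apply/andP; split; lra.
have tsW : (t - s) * W3 <= eps / 10.
  by apply: le_trans W3B; case/andP: ts => ts0 ts1; rewrite ler_piMl.
rewrite mulrDr in fz.
move: hN1 hN2; rewrite W123 mulrDr !ler_norml => /andP[_ hN1] /andP[hN2 _].
rewrite mulrBl mul1r -mulrA in dn.
clear -up fz dn err_n err_Kn err_e err_K cover1 cover2 tail uX tsW hN1 hN2 delK ni eps0.
by apply/andP; split; lra.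
Qed.

(** * Passage to the limit *)

(** A negative numerator, possible in [Sset] only, would give [|q * xi - a| * q >= q >= n > alpha].
    As [n > 0], no zero denominator occurs in [alpha / q]. *)
Lemma approx_setE (R : realType) (m : nat) (m_gt0 : (0 < m)%N) (A : {set 'I_m * 'I_m})
  (alpha c : R) (n : nat) : alpha < n%:R -> (0 < n)%N ->
  approx_set m_gt0 A alpha c n = `[0, 1]%classic `&` Sset m_gt0 A 1 c alpha n.
Proof.
move=> an n0; have nR : (0 : R) < n%:R by rewrite ltr0n.
have resE (a : nat) : residuez m_gt0 a%:Z = residue m_gt0 a.
  apply/residuezP => /=; rewrite {1}(divn_eq a m); apply/dvdzP; exists (a %/ m)%N%:Z.
  by rewrite PoszD PoszM addrK.
apply/seteqP; split => xi /=; rewrite in_itv/=.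
  move=> [x01 [a [q [cop Aaq nq qc close]]]]; split => //; exists a%:Z, q%:Z.
  have q0 : (0 : R) < q%:R by rewrite ltr0n (leq_trans n0).
  split => //; first by rewrite /inA !resE.
    by rewrite mulr1 ler_nat.
  by rewrite -ler_pdivlMr.
move=> [/[dup] x01 /andP[x0 x1] [a [q [cop Aaq nq qc close]]]]; split => //.
rewrite mulr1 in nq; have q0 : (0 : R) < q%:~R by exact: lt_le_trans nq.
have a0 : 0 <= a.
  rewrite leNgt; apply/negP => a0; move: close; apply/negP; rewrite -ltNge.
  apply: (lt_le_trans an); apply: (le_trans nq); rewrite ler_peMl ?(ltW q0)//.
  have a1 : a%:~R <= -1 :> R by rewrite -[-1]/((-1)%:~R) ler_int; move: a0; clear; lia.
  have := mulr_ge0 (ltW q0) x0 => h.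
  by apply: le_trans (ler_norm _); lra.
have [a' aE] : exists a' : nat, a = a'%:Z by exists `|a|%N; rewrite gez0_abs.
have [q' qE] : exists q' : nat, q = q'%:Z.
  by exists `|q|%N; rewrite gez0_abs// -(ler0z R) ltW.
subst a q; clear a0.
exists a', q'; split => //.
- by move: Aaq; rewrite /inA !resE.
- by rewrite -(ler_nat R).
- by rewrite ler_pdivlMr.
Qed.

(** [sup B] is the lower limit of the measures on the unit interval. For each [eps] the [W] of
    [window_density] is within [eps / 2] of it, by the window [[0, 1[], and the same [W] serves
    every other window. *)
Lemma window_limit (R : realType) (m : nat) (m_gt0 : (0 < m)%N) (A : {set 'I_m * 'I_m})
  (alpha c : R) : 0 < alpha -> 1 <= c ->
  exists l : R, forall s t : R, 0 <= s -> s <= t -> t <= 1 ->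
  lam (`[s, t[%classic `&` Sset m_gt0 A 1 c alpha n) @[n --> \oo] --> (t - s) * l.
Proof.
move=> al0 c1; pose u n := lam (`[0, 1[%classic `&` Sset m_gt0 A 1 c alpha n).
pose B := [set x : R | exists N : nat, forall n, (N <= n)%N -> x <= u n].
exists (sup B) => s t s0 st t1; apply/cvgrPdist_le => eps eps0.
have eps2 : 0 < eps / 2 by rewrite divr_gt0.
have [W hW] := window_density m_gt0 A al0 c1 eps2.
have [N1 hN1] := hW 0 1 (lexx _) ler01 (lexx _).
have [N2 hN2] := hW s t s0 st t1.
have WB : B (W - eps / 2).
  exists N1 => n /hN1; rewrite subr0 mul1r -/(u n) ler_norml => /andP[h _].
  by clear -h; lra.
have Bub : ubound B (W + eps / 2).
  move=> x [N hN]; have := hN1 (N + N1)%N (leq_addl _ _).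
  rewrite subr0 mul1r -/(u _) ler_norml => /andP[_ h].
  by apply: le_trans (hN _ (leq_addr _ _)) _; clear -h; lra.
have l1 : W - eps / 2 <= sup B by apply: ub_le_sup WB; exists (W + eps / 2).
have l2 : sup B <= W + eps / 2 by apply: ge_sup => //; exists (W - eps / 2).
exists N2 => // n /= /hN2; set v := lam _ => h.
have -> : (t - s) * sup B - v = (t - s) * (sup B - W) - (v - (t - s) * W) by ring.
apply: le_trans (ler_normB _ _) _; rewrite [leRHS](splitr eps); apply: lerD h.
have ts : 0 <= t - s by rewrite subr_ge0.
rewrite normrM (ger0_norm ts); apply: (@le_trans _ _ (1 * (eps / 2))); last by rewrite mul1r.
apply: ler_pM => //; first by clear -s0 t1; lra.
by rewrite ler_norml; apply/andP; split; clear -l1 l2; lra.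
Qed.

(** [I] differs from [[s, t[] at most by the end points, which are null. *)
Lemma interval_limit (R : realType) (m : nat) (m_gt0 : (0 < m)%N) (A : {set 'I_m * 'I_m})
  (alpha c s t l : R) (I : set R) :
  measurable (I : set (measurableTypeR R)) -> 0 <= s -> s <= t -> t <= 1 ->
  (forall x, s < x < t -> I x) -> (forall x, I x -> s <= x <= t) ->
  lam (`[s, t[%classic `&` Sset m_gt0 A 1 c alpha n) @[n --> \oo] --> (t - s) * l ->
  lebesgue_measure (I `&` approx_set m_gt0 A alpha c n) @[n --> \oo] --> ((t - s) * l)%:E.
Proof.
move=> mI s0 st t1 sub sup lim.
have [N N0 hN] := exists_nat_gt alpha.
have key n : (N <= n)%N -> lebesgue_measure (I `&` approx_set m_gt0 A alpha c n) =
    (lam (`[s, t[%classic `&` Sset m_gt0 A 1 c alpha n))%:E.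
  move=> Nn; rewrite approx_setE; first last.
  - exact: leq_trans Nn.
  - by apply: lt_le_trans hN _; rewrite ler_nat.
  set X := Sset _ _ _ _ _ _.
  have mX : measurable (X : set (measurableTypeR R)) by exact: measurable_Sset.
  have -> : I `&` (`[0, 1]%classic `&` X) = I `&` X.
    apply/seteqP; split => x [Ix]; first by case.
    move=> Xx; do 2 split => //; have /andP[h1 h2] := sup _ Ix.
    by rewrite /= in_itv/= (le_trans s0 h1) (le_trans h2 t1).
  have b1 : bmeas (I `&` X).
    apply: (@bmeas_itv _ _ s t); first exact: measurableI.
    by move=> x [/sup + _]; rewrite /= in_itv.
  have b2 : bmeas (`[s, t[%classic `&` X).
    apply: (@bmeas_itv _ _ s t); first by apply: measurableI => //; exact: measurable_itv.
    by move=> x [/= + _]; rewrite !in_itv/= => /andP[-> /ltW].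
  rewrite lamE//; congr (_%:E); apply/eqP; rewrite eq_le; apply/andP; split.
    apply: le_trans (lam_cover2 b1.1 b2 (bmeas_cc t t) _) _.
      move=> x [Ix Xx]; have /andP[h1 h2] := sup _ Ix.
      have [xt|tx] := ltP x t; [left|right]; last by rewrite /= in_itv/= h2 tx.
      by split => //; rewrite /= in_itv/= h1.
    by rewrite gerDl; have := lam_cc (lexx t); rewrite subrr.
  apply: le_trans (lam_cover2 b2.1 b1 (bmeas_cc s s) _) _.
    move=> x [/= + Xx]; rewrite in_itv/= => /andP[h1 h2].
    have [xs|sx] := leP x s; [right|left]; first by rewrite /= in_itv/= h1 xs.
    by split => //; apply: sub; rewrite sx.
  by rewrite gerDl; have := lam_cc (lexx s); rewrite subrr.
have h : (lam (`[s, t[%classic `&` Sset m_gt0 A 1 c alpha n))%:E @[n --> \oo] -->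
    ((t - s) * l)%:E by apply: cvg_EFin => //; exact: nearW.
apply: cvg_trans h; apply: near_eq_cvg; exists N => // n /= Nn.
by rewrite -key.
Qed.

Theorem corollary2 (R : realType) (m : nat) (m_gt0 : (0 < m)%N)
    (A : {set 'I_m * 'I_m})
    (hA : exists n1 n2 : 'I_m, (n1, n2) \in A /\ gcdn (gcdn n1 n2) m = 1%N)
    (alpha c : R) (alpha_gt0 : 0 < alpha) (c_ge1 : 1 <= c)
    (I : set R) (hI : is_interval I) (I01 : I `<=` `[0, 1]) :
  exists l lI : R,
    [/\ lebesgue_measure (approx_set m_gt0 A alpha c n) @[n --> \oo] --> l%:E,
        lebesgue_measure (I `&` approx_set m_gt0 A alpha c n) @[n --> \oo]
          --> lI%:E
      & lI = interval_length I * l].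
Proof.
have [l hl] := window_limit m_gt0 A alpha_gt0 c_ge1.
exists l, (interval_length I * l); split => //.
  have E n : approx_set m_gt0 A alpha c n = `[0, 1]%classic `&` approx_set m_gt0 A alpha c n.
    by apply/esym/setIidr => x [x01 _]; rewrite /= in_itv.
  under eq_fun do rewrite E.
  rewrite -[l]mul1r -[X in X * _]subr0.
  apply: interval_limit (hl 0 1 (lexx 0) ler01 (lexx 1)) => //.
  by move=> x /andP[/ltW h1 /ltW h2]; rewrite /= in_itv/= h1 h2.
rewrite /interval_length; have [->|/set0P I0] := eqVneq I set0.
  rewrite sup0 inf0 subrr mul0r; under eq_fun do rewrite set0I measure0.
  exact: cvg_cst.
have Ilu x : I x -> 0 <= x <= 1 by move=> /I01/=; rewrite in_itv.
have hub : has_ubound I by exists 1 => x /Ilu/andP[].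
have hlb : has_lbound I by exists 0 => x /Ilu/andP[].
have inI x : I x -> inf I <= x <= sup I.
  by move=> Ix; rewrite (ge_inf hlb Ix) (ub_le_sup hub Ix).
have s0 : 0 <= inf I by apply: lb_le_inf => // x /Ilu/andP[].
have t1 : sup I <= 1 by apply: ge_sup => // x /Ilu/andP[].
have st : inf I <= sup I by case: I0 => x /inI/andP[]; exact: le_trans.
apply: interval_limit (hl _ _ s0 st t1) => //; first exact: is_interval_measurable.
move=> x /andP[sx xt]; have [y Iy yx] := inf_lt I0 sx; have [z Iz xz] := sup_gt I0 xt.
by apply: (hI y z Iy Iz x); rewrite (ltW yx) (ltW xz).
Qed.
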